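(* Let $d\ge 2$, let $\Omega\subset\mathbb{R}^d$ be a bounded, connected, simply connected Lipschitz domain and let $D$ be a connected Lipschitz subdomain with $\overline D\subset\Omega$. Then there exist a countable number of generalized eigenvalues $\{\lambda_k\}_{k=1}^\infty$ with $0<\lambda_k\to\infty$ as $k\to\infty$, and associated generalized eigenfunctions $\{\phi_k\}_{k=1}^\infty\subset H^1(\Omega)$ (not identically zero) satisfying $$-\Delta\phi_k=\lambda_k 1_D\,\phi_k\ \text{ in }\Omega,\qquad \partial_{\nu_\Omega}\phi_k=0\ \text{ on }\partial\Omega .$$ These eigenfunctions satisfy $\int_D\phi_k\,dx=0$ and are orthogonal in the sense that $$\int_D\phi_k\phi_l\,dx=0\qquad\text{for } k\ne l .$$
   Context: $1_D$ is the indicator function of $D$ and $\nu_\Omega$ the outward unit normal to $\Omega$. The boundary value problem is understood in the weak sense: $\int_\Omega\nabla\phi_k\cdot\nabla\psi\,dx=\lambda_k\int_D\phi_k\psi\,dx$ for all $\psi\in H^1(\Omega)$. *)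

(* Defs.v *)
From HB Require Import structures.
From mathcomp Require Import all_boot all_order all_algebra.
From mathcomp Require Import all_classical all_reals all_analysis.

Set Implicit Arguments.
Unset Strict Implicit.
Unset Printing Implicit Defensive.

Import Order.TTheory GRing.Theory Num.Theory.
Import numFieldNormedType.Exports.

Local Open Scope classical_set_scope.
Local Open Scope ring_scope.

(* The sigma-algebra on R^n generated by the coordinate maps, as is done for
   tuples in the library; it is the Borel sigma-algebra. *)
Definition measure_rV_display : measure_display. Proof. exact. Qed.

Section measurable_rV.
Context (R : realType) (n : nat).

Definition coord_rV (i : 'I_n) (x : 'rV[R]_n) : measurableTypeR R := x ord0 i.

Let rV_set0 : g_sigma_preimage coord_rV set0.
Proof. exact: sigma_algebra0. Qed.

Let rV_setC A : g_sigma_preimage coord_rV A -> g_sigma_preimage coord_rV (~` A).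
Proof. exact: sigma_algebraC. Qed.

Let rV_bigcup (F : (set 'rV[R]_n)^nat) :
  (forall i, g_sigma_preimage coord_rV (F i)) ->
  g_sigma_preimage coord_rV (\bigcup_i F i).
Proof. exact: sigma_algebra_bigcup. Qed.

HB.instance Definition _ := @isMeasurable.Build measure_rV_display
  'rV[R]_n (g_sigma_preimage coord_rV) rV_set0 rV_setC rV_bigcup.

Lemma measurable_coord_rV (i : 'I_n) : measurable_fun setT (coord_rV i).
Proof.
move=> _ Y mY; rewrite setTI; apply: sub_sigma_algebra => /=.
rewrite -bigcup_seq/=; exists i => /=; first by rewrite mem_index_enum.
by exists Y => //; rewrite setTI.
Qed.

Lemma measurable_fun_rV d (T : measurableType d) (f : T -> 'rV[R]_n) :
  (forall i, measurable_fun setT (coord_rV i \o f)) -> measurable_fun setT f.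
Proof.
move=> mf _ A mA; rewrite setTI; move: A mA.
suff : measurable `<=` [set A : set 'rV[R]_n | measurable (f @^-1` A)] by [].
apply: smallest_sub.
  split => /=; first by rewrite preimage_set0.
    by move=> A mA; rewrite setTD -preimage_setC; exact: measurableC.
  by move=> F mF; rewrite preimage_bigcup; exact: bigcup_measurable.
rewrite -bigcup_seq => A [i _ [B mB <-]] /=; rewrite setTI.
by have := mf i measurableT _ mB; rewrite setTI.
Qed.

End measurable_rV.

Section cons_rV.
Context (R : realType) (n : nat).

Definition cons_rV (p : measurableTypeR R * 'rV[R]_n) : 'rV[R]_n.+1 :=
  row_mx (const_mx (p.1 : R) : 'rV[R]_1) p.2.

Lemma coord_cons_rV0 p : coord_rV ord0 (cons_rV p) = p.1.
Proof.
rewrite /coord_rV /cons_rV mxE.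
by case: fintype.splitP => [j _|j]; rewrite ?mxE//= add1n.
Qed.

Lemma coord_cons_rVS i p : coord_rV (lift ord0 i) (cons_rV p) = coord_rV i p.2.
Proof.
rewrite /coord_rV /cons_rV (_ : lift ord0 i = rshift 1 i); last exact: val_inj.
exact: row_mxEr.
Qed.

Lemma measurable_cons_rV : measurable_fun setT cons_rV.
Proof.
apply: measurable_fun_rV => i.
have -> : coord_rV i \o cons_rV = fun p => match fintype.split (i : 'I_(1 + n)) with
    inl _ => p.1 | inr j => coord_rV j p.2 end.
  apply/funext => p; rewrite /comp /coord_rV /cons_rV mxE.
  by case: fintype.split => j //; rewrite mxE.
case: fintype.split => j; first exact: measurable_fst.
exact: (measurableT_comp (measurable_coord_rV j) measurable_snd).
Qed.

Let uncons_rV (x : 'rV[R]_n.+1) : measurableTypeR R * 'rV[R]_n :=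
  (x ord0 ord0, rsubmx (x : 'rV[R]_(1 + n))).

Let cons_rVK : cancel cons_rV uncons_rV.
Proof.
move=> [a x]; rewrite /uncons_rV /cons_rV/= row_mxKr; congr pair.
rewrite mxE; case: fintype.splitP => [j _|j]; first by rewrite mxE.
by rewrite /= add1n.
Qed.

Let measurable_uncons_rV : measurable_fun setT uncons_rV.
Proof.
apply/measurable_fun_pairP; split; first exact: (measurable_coord_rV ord0).
apply: measurable_fun_rV => i.
rewrite (_ : _ \o _ = @coord_rV R n.+1 (rshift 1 i)).
  exact: measurable_coord_rV.
by apply/funext => x; rewrite /coord_rV /= mxE.
Qed.

Variable mu : {sigma_finite_measure set 'rV[R]_n -> \bar R}.

Definition lebesgue_rVS : set 'rV[R]_n.+1 -> \bar R :=
  pushforward (lebesgue_measure \x mu)%E cons_rV.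

Let lebesgue_rVS0 : lebesgue_rVS set0 = 0%E.
Proof. by rewrite /lebesgue_rVS /pushforward preimage_set0 measure0. Qed.

Let lebesgue_rVS_ge0 A : (0 <= lebesgue_rVS A)%E.
Proof. by rewrite /lebesgue_rVS /pushforward; exact: (measure_ge0 (lebesgue_measure \x mu)%E). Qed.

Let lebesgue_rVS_sigma_additive : semi_sigma_additive lebesgue_rVS.
Proof.
move=> F mF tF mUF; rewrite /lebesgue_rVS /pushforward preimage_bigcup.
have mS A : measurable A -> measurable (cons_rV @^-1` A).
  by move=> mA; rewrite -[X in measurable X]setTI; exact: measurable_cons_rV.
apply: measure_semi_sigma_additive.
- by move=> k; exact: mS.
- apply/trivIsetP => /= i j _ _ ij; rewrite -preimage_setI.
  by move/trivIsetP : tF => /(_ _ _ _ _ ij) ->//; rewrite preimage_set0.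
- by rewrite -preimage_bigcup; exact: mS.
Qed.

HB.instance Definition _ := isMeasure.Build _ _ _
  lebesgue_rVS lebesgue_rVS0 lebesgue_rVS_ge0 lebesgue_rVS_sigma_additive.

Let lebesgue_rVS_sigma_finite : sigma_finite setT lebesgue_rVS.
Proof.
have /sigma_finiteP[F [FT ndF mF]] := sigma_finiteT (@lebesgue_measure R).
have /sigma_finiteP[G [GT ndG mG]] := sigma_finiteT mu.
exists (fun k => uncons_rV @^-1` (F k `*` G k)) => [|k].
  rewrite -preimage_bigcup predeqE => x; split=> // _.
  have [i _ Fi] : (\bigcup_i F i) (uncons_rV x).1 by rewrite -FT.
  have [j _ Gj] : (\bigcup_i G i) (uncons_rV x).2 by rewrite -GT.
  exists (maxn i j) => //; split.
    by move: (_ x).1 Fi; exact/subsetPset/ndF/leq_maxl.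
  by move: (_ x).2 Gj; exact/subsetPset/ndG/leq_maxr.
have [mFk Fk] := mF k; have [mGk Gk] := mG k; split.
  by rewrite -[X in measurable X]setTI; apply: measurable_uncons_rV => //;
    exact: measurableX.
rewrite /lebesgue_rVS /pushforward -comp_preimage.
rewrite (_ : uncons_rV \o cons_rV = id)/=; last exact/funext.
by rewrite preimage_id product_measure1E// lte_mul_pinfty// ge0_fin_numE.
Qed.

HB.instance Definition _ := Measure_isSigmaFinite.Build _ _ _
  lebesgue_rVS lebesgue_rVS_sigma_finite.

End cons_rV.

Fixpoint lebesgue_rV (R : realType) (n : nat) :
    {sigma_finite_measure set 'rV[R]_n -> \bar R} :=
  match n with
  | 0 => \d_(0 : 'rV[R]_0)
  | n.+1 => lebesgue_rVS (lebesgue_rV R n)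
  end.

Lemma lebesgue_rV_box (R : realType) (n : nat)
    (A : 'I_n -> set (measurableTypeR R)) :
  (forall i, measurable (A i)) ->
  lebesgue_rV R n [set x | forall i, A i (coord_rV i x)] =
    (\prod_(i < n) lebesgue_measure (A i))%E.
Proof.
elim: n A => [|n IHn] A mA.
  rewrite big_ord0 /= diracE mem_set//; by case.
rewrite big_ord_recl -IHn; last by move=> i; exact: mA.
rewrite /= /lebesgue_rVS /pushforward.
rewrite (_ : _ @^-1` _ =
  A ord0 `*` [set x | forall i, A (lift ord0 i) (coord_rV i x)]).
  rewrite product_measure1E//.
  rewrite (_ : [set x | _] = \bigcap_(i in [set: 'I_n])
      (coord_rV i @^-1` A (lift ord0 i))).
    apply: fin_bigcap_measurable => // i _.
    rewrite -[X in measurable X]setTI.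
    exact: (measurable_coord_rV i measurableT).
  by apply/seteqP; split => x /= h; move=> i; [move=> _|]; exact: h.
apply/seteqP; split => [p/= h|p/= [h0 h] i].
  by split=> [|i]; rewrite -?(coord_cons_rV0 p) -?coord_cons_rVS; exact: h.
by case: (unliftP ord0 i) => [j ->|->]; rewrite ?coord_cons_rV0 ?coord_cons_rVS.
Qed.

Section domains.
Context (R : realType) (d : nat).
Implicit Types (A : set 'rV[R]_d) (x y : 'rV[R]_d).

(* Near each boundary point, A is the part of space strictly above the graph of
   a Lipschitz function in some orthonormal coordinate system: z *m Q are the
   new coordinates of z, the i-th of which is the vertical one. Balls and Lipschitz
   constants are relative to the sup norm of row vectors, which is harmless
   since all norms are equivalent. *)
Definition lipschitz_boundary A :=
  forall x, closure A x -> ~ interior A x ->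
  exists (r : R) (Q : 'M[R]_d) (i : 'I_d) (g : 'rV[R]_d.-1 -> R),
    [/\ 0 < r, Q *m Q^T = 1%:M, lipschitz g &
        forall z, ball x r z ->
          (A z <-> g (col' i (z *m Q)) < (z *m Q) ord0 i)].

Definition lipschitz_domain A :=
  [/\ A !=set0, open A, connected A & lipschitz_boundary A].

Definition loop_in A (c : R -> 'rV[R]_d) :=
  [/\ {within `[0, 1], continuous c}, c @` `[0, 1] `<=` A & c 0 = c 1].

Definition null_homotopic_in A (c : R -> 'rV[R]_d) :=
  exists H : R * R -> 'rV[R]_d,
    [/\ {within `[0, 1] `*` `[0, 1], continuous H},
        H @` (`[0, 1] `*` `[0, 1]) `<=` A,
        forall t, t \in `[0, 1] -> H (t, 0) = c t /\ H (t, 1) = c 0 &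
        forall s, s \in `[0, 1] -> H (0, s) = c 0 /\ H (1, s) = c 0].

Definition path_connected A :=
  forall x y, A x -> A y -> exists c : R -> 'rV[R]_d,
    [/\ {within `[0, 1], continuous c}, c @` `[0, 1] `<=` A, c 0 = x & c 1 = y].

Definition simply_connected A :=
  path_connected A /\ forall c, loop_in A c -> null_homotopic_in A c.

End domains.

Section sobolev.
Context (R : realType) (d : nat).
Implicit Types (A D : set 'rV[R]_d) (f g u v phi psi : 'rV[R]_d -> R).

Let mu := lebesgue_rV R d.
Let e_ (i : 'I_d) : 'rV[R]_d := delta_mx ord0 i.

Fixpoint continuously_differentiable (k : nat) f : Prop :=
  continuous f /\
  if k is k'.+1 then
    forall i, (forall x, derivable f x (e_ i)) /\
              continuously_differentiable k' ('D_(e_ i) f)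
  else True.

(* C_c^oo(A), extended by zero outside A *)
Definition test_function A f :=
  (forall k, continuously_differentiable k f) /\
  exists K : set 'rV[R]_d,
    [/\ compact K, K `<=` A & forall x, ~ K x -> f x = 0].

Definition square_integrable A u :=
  measurable_fun A u /\ mu.-integrable A (fun x => (u x ^+ 2)%:E).

Definition is_weak_partial A (i : 'I_d) u g :=
  forall f, test_function A f ->
    \int[mu]_(x in A) (u x * 'D_(e_ i) f x) = - \int[mu]_(x in A) (g x * f x).

(* Elements of H^1(A) are given by everywhere defined representatives, of which
   only the values on A matter. *)
Definition H1 A u :=
  square_integrable A u /\
  forall i, exists2 g, square_integrable A g & is_weak_partial A i u g.

(* A square integrable weak partial derivative, unique up to a null set when
   u is in H^1(A); the zero function if there is none. *)
Definition weak_partial A (i : 'I_d) u : 'rV[R]_d -> R :=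
  xget (cst 0) [set g | square_integrable A g /\ is_weak_partial A i u g].

Definition weak_grad A u (x : 'rV[R]_d) : 'rV[R]_d :=
  \row_(i < d) weak_partial A i u x.

Definition dotrV (x y : 'rV[R]_d) : R := \sum_(i < d) x ord0 i * y ord0 i.

(* phi is a (nonzero) weak solution in H^1(Omega) of
   - Delta phi = lambda 1_D phi in Omega with zero Neumann data *)
Definition neumann_eigenpair (Omega : set 'rV[R]_d) D (lambda : R) phi :=
  [/\ H1 Omega phi,
      ~ {ae mu, forall x, Omega x -> phi x = 0} &
      forall psi, H1 Omega psi ->
        \int[mu]_(x in Omega) dotrV (weak_grad Omega phi x)
                                    (weak_grad Omega psi x) =
        lambda * \int[mu]_(x in D) (phi x * psi x)].

End sobolev.

(* Main.v *)
Require Import Defs.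
From HB Require Import structures.
From mathcomp Require Import all_boot all_order all_algebra.
From mathcomp Require Import all_classical all_reals all_analysis.
From mathcomp Require Import measurable_realfun.
From mathcomp Require Import ring lra.

Set Implicit Arguments.
Unset Strict Implicit.
Unset Printing Implicit Defensive.

Import Order.TTheory GRing.Theory Num.Theory.
Import numFieldNormedType.Exports.

Local Open Scope classical_set_scope.
Local Open Scope ring_scope.

(** The eigenfunctions are found in the space V of the functions u in H^1(Omega)
    with mean zero on D.  With a(u, v) the integral over Omega of the product of
    the gradients and b(u, v) the integral of u v over D, the problem restricted
    to V reads a(phi, v) = lambda b(phi, v), and phi has mean zero on D by
    construction.  Constants have no gradient and are b-orthogonal to V, so that
    the equation on V implies the equation against every function of H^1(Omega)
    (mean_zero_eigenpair).

    An abstract theorem (spectral_sequence) yields the sequence.  It asks for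
    three things.  V is complete for a.  The form b is compact relative to a: up
    to e a(u, u), the value b(u, u) is controlled by finitely many functionals.
    And b does not degenerate under finitely many orthogonality conditions, so
    that the construction never stops.  Each eigenvector maximises b / a on the
    b-orthogonal complement of its predecessors; a maximiser exists since a
    maximising sequence on which the functionals converge is a Cauchy sequence.

    All the estimates come from one source: if u has a square integrable weak
    gradient, then its increments are, for almost every point, integrals of the
    gradient along segments (weak_partial_increment), and so the increments by a
    fixed vector h are bounded in L2 by |h| times the gradient, over any set that
    can be translated by h inside Omega (segment_increment_le).  Averaged over
    the vectors that join two points of a cube of side l, this is the Poincare
    inequality of the cube, with a constant of order l^2 (cell_poincare).

    Compactness follows at once, because the closure of D is a compact part of
    Omega: cover it by a grid of small cubes of Omega, and take for functionals
    the integrals over the cubes (grid_estimate).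

    Completeness needs the Poincare inequality on Omega for functions with mean
    zero on D (poincare).  A set S is called controlled if the L2 norm of u on S
    is bounded by the gradient on Omega and the L2 norm on one fixed cube.  The
    translate of a controlled set is controlled, as long as the translation
    stays inside Omega.  By connectedness every point of Omega has a controlled
    neighbourhood; near a boundary point, Omega lies above a Lipschitz graph, so
    that a vertical translation moves a neighbourhood in Omega into a compact
    part (boundary_controlled); by compactness of the closure, Omega itself is
    controlled.  Weak derivatives being stable under L2 limits, the
    Riesz-Fischer theorem (sqint_complete) then gives the completeness of V.

    Finally, b does not degenerate since D carries arbitrarily many bumps with
    disjoint supports (disjoint_bumps), some combination of which satisfies any
    finite number of linear conditions. *)

(** * Eigenvectors of a compact form *)

Section forms.
Context (R : realType) (E : lmodType R).
Implicit Types (V : set E) (a b c : E -> E -> R) (u v w : E).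

Definition subspace V :=
  [/\ V 0, forall u v, V u -> V v -> V (u + v) &
      forall (k : R) u, V u -> V (k *: u)].

Lemma subspaceB V u v : subspace V -> V u -> V v -> V (u - v).
Proof.
by move=> [_ VD VZ] Vu Vv; apply: VD => //; rewrite -scaleN1r; exact: VZ.
Qed.

(** The axioms are only required on V: the forms below are integrals, which are
    bilinear only on functions that are integrable enough. *)
Definition psd_form V a :=
  [/\ forall u v, V u -> V v -> a u v = a v u,
      forall u v w, V u -> V v -> V w -> a (u + v) w = a u w + a v w,
      forall (k : R) u v, V u -> V v -> a (k *: u) v = k * a u v &
      forall u, V u -> 0 <= a u u].

Lemma psd_form_sub V W a : W `<=` V -> psd_form V a -> psd_form W a.
Proof.
move=> WV [aC aD aZ a0]; split.
- by move=> u v /WV ? /WV ?; exact: aC.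
- by move=> u v w /WV ? /WV ? /WV ?; exact: aD.
- by move=> k u v /WV ? /WV ?; exact: aZ.
- by move=> u /WV ?; exact: a0.
Qed.

Lemma formDZ V a k u v : subspace V -> psd_form V a -> V u -> V v ->
  a (u + k *: v) (u + k *: v) = a u u + k * a u v *+ 2 + k ^+ 2 * a v v.
Proof.
move=> [V0 VD VZ] [aC aD aZ a0] Vu Vv.
have Vkv := VZ k v Vv; have Vs := VD _ _ Vu Vkv.
rewrite aD// aZ// (aC u) // (aC v)// aD// aD// aZ// aZ// (aC v u)//.
by ring.
Qed.

Lemma formB V a u v : subspace V -> psd_form V a -> V u -> V v ->
  a (u - v) (u - v) = a u u - a u v *+ 2 + a v v.
Proof.
move=> sV fa Vu Vv; rewrite -scaleN1r (formDZ _ sV fa)//; by ring.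
Qed.

Lemma form0l V a v : subspace V -> psd_form V a -> V v -> a 0 v = 0.
Proof.
by move=> [V0 _ _] [_ _ aZ _] Vv; rewrite -(scale0r 0) aZ// mul0r.
Qed.

Lemma formBl V a u v w : subspace V -> psd_form V a -> V u -> V v -> V w ->
  a (u - v) w = a u w - a v w.
Proof.
move=> [_ _ VZ] [_ aD aZ _] Vu Vv Vw.
by rewrite aD// -scaleN1r ?aZ ?mulN1r//; exact: VZ.
Qed.

Lemma form_parallelogram V a u v : subspace V -> psd_form V a -> V u -> V v ->
  a (u - v) (u - v) <= 2 * a u u + 2 * a v v.
Proof.
move=> sV fa Vu Vv.
have VD : V (u + v) by case: sV => _ + _; exact.
have [_ _ _ /(_ _ VD)] := fa.
rewrite (formB sV fa)// -[v in u + v]scale1r (formDZ _ sV fa)//.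
lra.
Qed.

Lemma form_isotropic V a u v : subspace V -> psd_form V a -> V u -> V v ->
  a u u = 0 -> a u v = 0.
Proof.
move=> sV fa Vu Vv au0.
have H k : 0 <= a v v + k * a v u *+ 2.
  have [_ VD VZ] := sV; have := formDZ k sV fa Vv Vu.
  rewrite au0 mulr0 addr0 => <-; case: fa => _ _ _; apply.
  exact/VD/VZ.
have [aC _ _ a0] := fa; rewrite (aC u v)//; apply/eqP.
apply/negPn/negP => avu.
have := H (- (a v v + 1) / (a v u *+ 2)).
rewrite -mulrnAr mulfVK ?mulrn_eq0//; lra.
Qed.

Lemma form_cauchy_schwarz V a u v : subspace V -> psd_form V a -> V u -> V v ->
  a u v ^+ 2 <= a u u * a v v.
Proof.
move=> sV fa Vu Vv; have [aC _ _ a0] := fa.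
have := a0 _ Vv; rewrite le_eqVlt => /predU1P[av0|av].
  by rewrite aC// (form_isotropic sV fa Vv Vu)// -av0 mulr0 expr0n.
have Vw : V (u + (- a u v / a v v) *: v).
  by have [_ VD VZ] := sV; exact/VD/VZ.
have := a0 _ Vw; rewrite (formDZ _ sV fa)// => h.
have : 0 <= (a u u * a v v - a u v ^+ 2) / a v v.
  apply: le_trans h _; rewrite le_eqVlt; apply/orP; left; apply/eqP.
  by field; rewrite gt_eqF.
by rewrite pmulr_lge0 ?invr_gt0// subr_ge0.
Qed.

Lemma subspace_sum V n (c : 'I_n -> R) (w : 'I_n -> E) : subspace V ->
  (forall j, V (w j)) -> V (\sum_(j < n) c j *: w j).
Proof.
by move=> [V0 VD VZ] Vw; elim/big_ind : _ => // j _; exact: VZ.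
Qed.

Lemma form_suml V a n (c : 'I_n -> R) (w : 'I_n -> E) v : subspace V -> psd_form V a ->
  (forall j, V (w j)) -> V v ->
  a (\sum_(j < n) c j *: w j) v = \sum_(j < n) c j * a (w j) v.
Proof.
move=> sV fa Vw Vv; have [_ aD aZ _] := fa; have [V0 VD VZ] := sV.
suff [] : V (\sum_(j < n) c j *: w j) /\
    a (\sum_(j < n) c j *: w j) v = \sum_(j < n) c j * a (w j) v by [].
elim/big_rec2 : _ => [|j y x _ [Vx <-]]; first by split=> //; exact: form0l fa _.
have Vj : V (c j *: w j) by exact: VZ.
by split; [exact: VD|rewrite aD// aZ].
Qed.

(** A dimension count: the matrix of the conditions has more rows than columns,
    hence a nonzero kernel vector.  The form is then positive on the combination
    because its value is a sum of squares. *)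
Lemma orthogonal_combination V a (s : seq E) (w : 'I_(size s).+1 -> E) :
  subspace V -> psd_form V a -> (forall f, f \in s -> V f) -> (forall j, V (w j)) ->
  (forall j, 0 < a (w j) (w j)) -> (forall j k, j != k -> a (w j) (w k) = 0) ->
  exists c : 'I_(size s).+1 -> R, let v := \sum_j c j *: w j in
    (forall f, f \in s -> a v f = 0) /\ 0 < a v v.
Proof.
move=> sV fa Vs Vw w0 orth; have [aS _ _ _] := fa.
pose M : 'M[R]_((size s).+1, size s) := \matrix_(j, l) a (w j) (tnth (in_tuple s) l).
have [j kj] : exists j, row j (kermx M) != 0.
  apply/existsP; rewrite -negb_forall; apply/negP => /forallP k0.
  have : kermx M != 0.
    by rewrite -mxrank_eq0 mxrank_ker -lt0n subn_gt0 ltnS rank_leq_col.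
  by case/negP; apply/eqP/row_matrixP => i; rewrite row0; apply/eqP.
pose c (i : 'I_(size s).+1) : R := row j (kermx M) ord0 i.
exists c => /=; split=> [f fs|].
  rewrite (form_suml _ sV fa)//; last exact: Vs.
  have /sub_kermxP /rowP : (row j (kermx M) <= kermx M)%MS by exact: row_sub.
  move=> /(_ (Ordinal (etrans (index_mem f s) fs))).
  rewrite [in X in X -> _]mxE [X in _ = X -> _]mxE => E0; rewrite -[RHS]E0.
  apply: eq_bigr => i _; congr (_ * _).
  by rewrite mxE (tnth_nth f)/= nth_index.
have Vv := subspace_sum c sV Vw.
rewrite (form_suml _ sV fa)//.
have E0 i : a (w i) (\sum_(j < (size s).+1) c j *: w j) = c i * a (w i) (w i).
  rewrite aS// (form_suml _ sV fa)// (bigD1 i)//= big1 ?addr0// => k ki.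
  by rewrite orth// mulr0.
rewrite [ltRHS](_ : _ = \sum_(i < (size s).+1) c i ^+ 2 * a (w i) (w i)); last first.
  by apply: eq_bigr => i _; rewrite expr2 -mulrA; congr (_ * _); exact: E0.
rewrite lt_neqAle sumr_ge0 ?andbT; last first.
  by move=> i _; rewrite mulr_ge0 ?sqr_ge0// ltW.
apply: contra kj => /eqP /esym /eqP.
rewrite psumr_eq0; last by move=> i _; rewrite mulr_ge0 ?sqr_ge0// ltW.
move=> /allP h; apply/eqP/rowP => i; rewrite [RHS]mxE.
have := h i (mem_index_enum i); rewrite /= mulf_eq0 [X in _ || X]gt_eqF// orbF.
by rewrite sqrf_eq0 => /eqP.
Qed.

(** Completeness for sequences with a geometric rate.  The maximising sequences
    below have one, and with it the completeness of a concrete space can be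
    proved without extracting subsequences. *)
Definition geom_complete V a := forall (u : nat -> E) (C : R),
  (forall n, V (u n)) ->
  (forall n m, (n <= m)%N -> a (u n - u m) (u n - u m) <= C * 4^-1 ^+ n) ->
  exists (v : E) (C' : R), V v /\ forall n, a (u n - v) (u n - v) <= C' * 4^-1 ^+ n.

(** Relative compactness in a quantitative form, which is what a grid of small
    cubes provides for Sobolev functions. *)
Definition form_compact V a b := forall e : R, 0 < e ->
  exists (N : nat) (l : 'I_N -> E -> R) (K : R),
    [/\ forall i u v, V u -> V v -> l i (u - v) = l i u - l i v,
        forall i u, V u -> l i u ^+ 2 <= K * a u u &
        forall u, V u -> b u u <= e * a u u + \sum_(i < N) l i u ^+ 2].

Lemma bounded_cluster_rV (N : nat) (x : nat -> 'I_N -> R) (K : R) :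
  (forall n i, `|x n i| <= K) ->
  exists p : 'I_N -> R, forall (e : R) n, 0 < e ->
    exists2 m, (n <= m)%N & forall i, `|x m i - p i| < e.
Proof.
move=> xK; pose y n : 'rV[R]_N := \row_i x n i.
pose A := [set v : 'rV[R]_N | forall i, v ord0 i \in `[- K, K]].
have cA : compact A.
  apply: (@rV_compact _ _ (fun=> `[- K, K]%classic)) => _.
  exact: segment_compact.
have : (y @ \oo) A.
  by exists 0%N => // n _ i; rewrite mxE in_itv/= -ler_norml.
move=> /cA[p [_ clp]]; exists (fun i => p ord0 i) => e n e0.
have /(_ (y @` [set m | (n <= m)%N]) (ball p e)) := clp.
case.
- by exists n => // m; exists m.
- exact: nbhsx_ballx.
- move=> _ [[m nm <-] pe]; exists m => // i.
  case: pe => _ /(_ ord0 i); rewrite /ball/= mxE => ?.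
  by rewrite distrC.
Qed.

Lemma geom_le_small (A d : R) : 0 < d -> exists n, A * 4^-1 ^+ n < d.
Proof.
move=> d0.
have : (fun n => A * 4^-1 ^+ n) @ \oo --> (A * 0 : R).
  by apply: cvgMr; apply: cvg_expr; rewrite ger0_norm ?invr_ge0// invf_lt1// ltr1n.
rewrite mulr0 => /cvgrPdist_lt/(_ _ d0)[n _ /(_ n (leqnn n))] /=.
rewrite sub0r normrN => h; exists n; exact: le_lt_trans (ler_norm _) h.
Qed.

Lemma geom_le0 (x A : R) : (forall n, x <= A * 4^-1 ^+ n) -> x <= 0.
Proof.
move=> h; rewrite leNgt; apply/negP => /(geom_le_small A)[n].
by rewrite ltNge h.
Qed.

(** With M the supremum of b / a, the form M a - b is positive and tends to 0
    along a maximising sequence.  If moreover the functionals of form_compact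
    converge along the sequence, compactness with e = M / 2 turns this into the
    Cauchy property for a. *)
Lemma rayleigh_maximizer V a b (C : R) : subspace V ->
  psd_form V a -> psd_form V b -> geom_complete V a ->
  (forall u, V u -> b u u <= C * a u u) -> form_compact V a b ->
  (exists2 v, V v & 0 < b v v) ->
  exists f, [/\ V f, a f f = 1, 0 < b f f &
                forall w, V w -> b w w <= b f f * a w w].
Proof.
move=> sV fa fb cpl bC cpt [v0 Vv0 bv0].
have [V0 VD VZ] := sV.
have [aC aD aZ a_ge0] := fa; have [bC' bD bZ b_ge0] := fb.
have aqZ k u : V u -> a (k *: u) (k *: u) = k ^+ 2 * a u u.
  move=> Vu; have Vku := VZ k u Vu.
  by rewrite aZ// (aC _ _ Vu Vku) aZ// mulrA.
have bqZ k u : V u -> b (k *: u) (k *: u) = k ^+ 2 * b u u.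
  move=> Vu; have Vku := VZ k u Vu.
  by rewrite bZ// (bC' _ _ Vu Vku) bZ// mulrA.
have unit_a u : V u -> 0 < a u u ->
    a ((Num.sqrt (a u u))^-1 *: u) ((Num.sqrt (a u u))^-1 *: u) = 1.
  by move=> Vu au; rewrite aqZ// exprVn sqr_sqrtr ?ltW// mulVf// gt_eqF.
have unit_b u : V u -> 0 < a u u ->
    b ((Num.sqrt (a u u))^-1 *: u) ((Num.sqrt (a u u))^-1 *: u)
    = b u u / a u u.
  by move=> Vu au; rewrite bqZ// exprVn sqr_sqrtr ?ltW// mulrC.
have C0 : 0 < C.
  rewrite ltNge; apply/negP => C0; have := bC v0 Vv0.
  by apply/negP; rewrite -ltNge (le_lt_trans _ bv0)// mulr_le0_ge0// a_ge0.
have av0 : 0 < a v0 v0.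
  by have := lt_le_trans bv0 (bC _ Vv0); rewrite pmulr_rgt0.
pose S := [set b u u | u in [set u | V u /\ a u u <= 1]].
have Sub : has_ubound S.
  exists C => _ [u [Vu au] <-]; apply: le_trans (bC _ Vu) _.
  by rewrite -[leRHS]mulr1 ler_pM2l.
have supS : has_sup S.
  split=> //; exists (b 0 0); exists 0 => //; split=> //.
  by rewrite (form0l sV fa).
pose M := sup S.
have bM w : V w -> b w w <= M * a w w.
  move=> Vw; have := a_ge0 _ Vw; rewrite le_eqVlt => /predU1P[aw0|aw].
    by rewrite -aw0 mulr0; have := bC _ Vw; rewrite -aw0 mulr0.
  rewrite -ler_pdivrMr// -unit_b//; apply: ub_le_sup => //.
  exists ((Num.sqrt (a w w))^-1 *: w) => //; split; first exact: VZ.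
  by rewrite unit_a.
have M0 : 0 < M.
  by have := lt_le_trans bv0 (bM _ Vv0); rewrite pmulr_lgt0.
pose c u v := M * a u v - b u v.
have fc : psd_form V c.
  split => [u v Vu Vv|u v w Vu Vv Vw|k u v Vu Vv|u Vu]; rewrite /c.
  - by rewrite aC// bC'.
  - by rewrite aD// bD//; ring.
  - by rewrite aZ// bZ//; ring.
  - by rewrite subr_ge0 bM.
have M20 : 0 < M / 2 by rewrite divr_gt0.
(* e = M / 2, so that M / 2 a is bounded by M a - b plus the functionals *)
have [N [l [K [lB lK bl]]]] := cpt _ M20.
have pos4 n : 0 < 4^-1 ^+ n :> R by rewrite exprn_gt0// invr_gt0.
(* the factor min(1, M / 2) keeps b bounded below along the sequence *)
have /boolp.choice[z zP] : forall n, exists u,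
    [/\ V u, a u u <= 1 & M - 4^-1 ^+ n * Num.min 1 (M / 2) < b u u].
  move=> n.
  have e0 : 0 < 4^-1 ^+ n * Num.min 1 (M / 2).
    by rewrite mulr_gt0// lt_min ltr01.
  have [_ [u [Vu au] <-] ub] := sup_adherent e0 supS.
  by exists u.
have K0 : 0 <= `|K| + 1 by rewrite addr_ge0.
have [|p pP] := @bounded_cluster_rV N (fun n i => l i (z n)) (`|K| + 1).
  move=> n i; have [Vz az _] := zP n.
  have h : l i (z n) ^+ 2 <= `|K|.
    apply: le_trans (lK _ _ Vz) _; apply: le_trans (ler_norm _) _.
    rewrite normrM -[leRHS]mulr1 ler_wpM2l// ger0_norm// a_ge0//.
  rewrite -(@ler_pXn2r _ 2)// ?nnegrE// real_normK ?num_real//.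
  by have := normr_ge0 K; nra.
have /boolp.choice[k kP] : forall n, exists m,
    (n <= m)%N /\ forall i, `|l i (z m) - p i| < 2^-1 ^+ n.
  move=> n; have e0 : (0 : R) < 2^-1 ^+ n by rewrite exprn_gt0// invr_gt0.
  by have [m nm h] := pP _ n e0; exists m.
pose u n := z (k n).
have Vu n : V (u n) by have [] := zP (k n).
have au n : a (u n) (u n) <= 1 by have [] := zP (k n).
have geo n m : (n <= m)%N -> 4^-1 ^+ m <= 4^-1 ^+ n :> R.
  by move=> nm; apply: ler_wiXn2l => //; rewrite ?invr_ge0// invf_le1// ler1n.
have geo2 n m : (n <= m)%N -> 2^-1 ^+ m <= 2^-1 ^+ n :> R.
  by move=> nm; apply: ler_wiXn2l => //; rewrite ?invr_ge0// invf_le1// ler1n.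
have bu n : M - 4^-1 ^+ n * Num.min 1 (M / 2) <= b (u n) (u n).
  have [_ _ /ltW h] := zP (k n); apply: le_trans h.
  rewrite lerD2l lerN2 ler_wpM2r//; last by apply: geo; have [] := kP n.
  by rewrite le_min ler01 ltW.
have cu n : c (u n) (u n) <= 4^-1 ^+ n.
  have h1 : M * a (u n) (u n) <= M by rewrite -[leRHS]mulr1 ler_pM2l.
  have h2 : 4^-1 ^+ n * Num.min 1 (M / 2) <= 4^-1 ^+ n.
    by rewrite -[leRHS]mulr1 ler_pM2l// ge_min lexx.
  by have := bu n; rewrite /c; lra.
have caud n m : (n <= m)%N ->
    a (u n - u m) (u n - u m) <= (2 / M * (4 + 4 * N%:R)) * 4^-1 ^+ n.
  move=> nm; have Vnm : V (u n - u m) by exact: subspaceB.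
  have h1 := bl _ Vnm.
  have h2 := form_parallelogram sV fc (Vu n) (Vu m).
  have h3 : \sum_(i < N) l i (u n - u m) ^+ 2 <= 4 * N%:R * 4^-1 ^+ n.
    have -> : 4 * N%:R * 4^-1 ^+ n = \sum_(i < N) 4 * 4^-1 ^+ n :> R.
      by rewrite sumr_const card_ord -mulr_natr; ring.
    apply: ler_sum => i _.
    rewrite lB// (_ : l i (u n) - l i (u m) =
      (l i (u n) - p i) - (l i (u m) - p i)); last by ring.
    rewrite (_ : 4 * 4^-1 ^+ n = (2 * 2^-1 ^+ n) ^+ 2); last first.
      have -> : 4^-1 = 2^-1 ^+ 2 :> R by field.
      by rewrite exprAC (exprMn _ 2 (2^-1 ^+ n)); ring.
    rewrite -real_normK ?num_real// lerXn2r ?nnegrE//.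
    rewrite (le_trans (ler_normB _ _))// mulrDl mul1r lerD//.
      by apply: ltW; have [] := kP n.
    by apply: le_trans (geo2 _ _ nm); apply: ltW; have [] := kP m.
  have h4 := cu n; have h5 := le_trans (cu m) (geo _ _ nm).
  have : M / 2 * a (u n - u m) (u n - u m) <= (4 + 4 * N%:R) * 4^-1 ^+ n.
    by move: h2; rewrite {1}/c; lra.
  rewrite mulrC -ler_pdivlMr// => /le_trans; apply.
  by rewrite le_eqVlt; apply/orP; left; apply/eqP; field; rewrite gt_eqF.
have [v [C1 [Vv vP]]] := cpl _ _ Vu caud.
have cv0 : c v v = 0.
  apply/eqP; rewrite eq_le; apply/andP; split; last by case: fc => _ _ _; apply.
  apply: (@geom_le0 _ (2 + 2 * M * C1)) => n.
  have Vd : V (u n - v) by exact: subspaceB.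
  have := form_parallelogram sV fc (Vu n) Vd.
  rewrite subKr => /le_trans; apply.
  have h1 : c (u n - v) (u n - v) <= M * (C1 * 4^-1 ^+ n).
    apply: le_trans (_ : M * a (u n - v) (u n - v) <= _).
      by rewrite /c gerBl b_ge0.
    by rewrite ler_pM2l.
  by have := cu n; lra.
have bv : 0 < b v v.
  have [|n Hn] := @geom_le_small (2 * M * C1) (M / 8); first by rewrite divr_gt0.
  have Vd : V (v - u n) by exact: subspaceB.
  have := form_parallelogram sV fb Vv Vd; rewrite subKr => h.
  have h1 : b (v - u n) (v - u n) <= M * (C1 * 4^-1 ^+ n).
    apply: le_trans (bM _ Vd) _; rewrite ler_pM2l//.
    suff -> : a (v - u n) (v - u n) = a (u n - v) (u n - v) by exact: vP.
    rewrite (formB sV fa Vv (Vu n)) (formB sV fa (Vu n) Vv) (aC v (u n))//.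
    by ring.
  have h2 := bu n.
  have h3 : 4^-1 ^+ n * Num.min 1 (M / 2) <= M / 2.
    have q1 : 4^-1 ^+ n <= 1 :> R by exact: (geo 0%N).
    have mM : Num.min 1 (M / 2) <= M / 2 by rewrite ge_min lexx orbT.
    by have := pos4 n; nra.
  by move: Hn h1 h; lra.
have av : 0 < a v v.
  by have := lt_le_trans bv (bM _ Vv); rewrite pmulr_rgt0.
have bMv : b v v / a v v = M.
  apply: (mulIf (lt0r_neq0 av)); rewrite divfK ?gt_eqF//.
  by move: cv0; rewrite /c; lra.
exists ((Num.sqrt (a v v))^-1 *: v); split; first exact: VZ.
- exact: unit_a.
- by rewrite unit_b// bMv.
- by move=> w Vw; rewrite unit_b// bMv; exact: bM.
Qed.

Section spectral.
Context (V : set E) (a b : E -> E -> R) (C : R).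
Hypotheses (sV : subspace V) (fa : psd_form V a) (fb : psd_form V b).
Hypotheses (cpl : geom_complete V a) (cpt : form_compact V a b).
Hypothesis bC : forall u, V u -> b u u <= C * a u u.
Hypothesis inf : forall s : seq E, (forall f, f \in s -> V f) ->
  exists v, [/\ V v, forall f, f \in s -> b v f = 0 & 0 < b v v].

(** The last clause holds against all of V and not only against the vectors
    orthogonal to s, as the next steps need in order to project on f. *)
Definition next_eigen (s : seq E) (f : E) :=
  [/\ V f /\ a f f = 1, 0 < b f f, forall g, g \in s -> b f g = 0,
      forall w, V w -> (forall g, g \in s -> b w g = 0) ->
        b w w <= b f f * a w w &
      forall v, V v -> b f v = b f f * a f v].

Fixpoint eigen_chain (s : seq E) : Prop :=
  if s is f :: s' then next_eigen s' f /\ eigen_chain s' else True.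

Lemma eigen_chainP s f : eigen_chain s -> f \in s ->
  [/\ V f, 0 < b f f & forall v, V v -> b f v = b f f * a f v].
Proof.
elim: s => //= g s IHs [[[Vg _] bg _ _ Eg] cs]; rewrite in_cons.
by case/predU1P => [->|fs]; [split|exact: IHs].
Qed.

(** Gram-Schmidt: each b-projection on an element of the chain changes v by a
    vector on which phi vanishes. *)
Lemma chain_projection s (phi : E -> R) : eigen_chain s ->
  (forall u v, V u -> V v -> phi (u - v) = phi u - phi v) ->
  (forall (k : R) u, V u -> phi (k *: u) = k * phi u) ->
  (forall f, f \in s -> phi f = 0) ->
  forall v, V v -> exists w,
    [/\ V w, forall f, f \in s -> b w f = 0 & phi v = phi w].
Proof.
move=> + phiB phiZ; have [_ _ VZ] := sV; have [bS bD bZ _] := fb.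
elim: s => [_ _ v Vv|g s IHs [[[Vg _] bg gs _ _] cs] phi0 v Vv]; first by exists v.
have [f fs|w [Vw ws phiw]] := IHs cs _ v Vv.
  by apply: phi0; rewrite in_cons fs orbT.
have Vk := VZ (b w g / b g g) g Vg.
exists (w - (b w g / b g g) *: g); split; first exact: subspaceB.
- move=> f; rewrite in_cons => /predU1P[->|fs].
    by rewrite (formBl sV fb)// bZ// divfK ?subrr// gt_eqF.
  have [Vf _ _] := eigen_chainP cs fs.
  by rewrite (formBl sV fb)// bZ// (gs _ fs) mulr0 subr0 ws.
- by rewrite phiB// phiZ// (phi0 g (mem_head _ _)) mulr0 subr0.
Qed.

(** Maximise b / a on the b-orthogonal complement W of s.  For a maximiser f the
    form (b f f) a - b is positive on W and vanishes at f, so that f is in its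
    kernel; this is the eigenvalue equation on W, and both sides vanish on s. *)
Lemma next_eigen_exists s : eigen_chain s -> exists f, next_eigen s f.
Proof.
move=> cs.
pose W := [set v | V v /\ forall f, f \in s -> b v f = 0].
have sV' := sV; have [V0 VD VZ] := sV'.
have [aS aD aZ a0] := fa; have [bS bD bZ b0] := fb.
have chV f : f \in s -> V f by move=> /(eigen_chainP cs)[].
have WV : W `<=` V by move=> ? [].
have sW : subspace W.
  split; first by split=> // f fs; rewrite (form0l sV fb)//; exact: chV.
  - move=> u v [Vu uP] [Vv vP]; split; first exact: VD.
    by move=> f fs; rewrite bD// ?uP ?vP ?addr0//; exact: chV.
  - move=> k u [Vu uP]; split; first exact: VZ.
    by move=> f fs; rewrite bZ// ?uP ?mulr0//; exact: chV.
have cplW : geom_complete W a.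
  move=> u K Wu uP; have [v [K' [Vv vP]]] := cpl (fun n => (Wu n).1) uP.
  exists v, K'; split=> //; split=> // f fs; have Vf := chV _ fs.
  (* b f is a multiple of a f, which is continuous for a *)
  have [_ _ Ef] := eigen_chainP cs fs.
  suff avf : a f v = 0 by rewrite bS// Ef// avf mulr0.
  apply/eqP; rewrite -sqrf_eq0 eq_le sqr_ge0 andbT.
  apply: (@geom_le0 _ (K' * a f f)) => n; have [Vun /(_ f fs)] := Wu n.
  have [_ bff _] := eigen_chainP cs fs.
  rewrite bS// Ef// => /eqP; rewrite mulf_eq0 gt_eqF//= => /eqP un.
  have := form_cauchy_schwarz sV fa (subspaceB sV Vun Vv) Vf.
  rewrite (formBl sV fa)// (aS (u n))// (aS v)// un sub0r sqrrN => /le_trans; apply.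
  by rewrite mulrAC; apply: ler_wpM2r; [exact: a0|exact: vP].
have cptW : form_compact W a b.
  move=> e e0; have [N [l [K [lB lK lb]]]] := cpt e0; exists N, l, K; split.
  - by move=> i u v /WV Vu /WV Vv; exact: lB.
  - by move=> i u /WV; exact: lK.
  - by move=> u /WV; exact: lb.
have [v [Vv vs bv]] := inf chV.
have bCW u : W u -> b u u <= C * a u u by move=> /WV; exact: bC.
have [|f [[Vf fs] af bf fmax]] := rayleigh_maximizer sW (psd_form_sub WV fa)
  (psd_form_sub WV fb) cplW bCW cptW; first by exists v.
exists f; split => //.
  by move=> w Vw ws; exact: fmax.
pose c u v := b f f * a u v - b u v.
have fc : psd_form W c.
  split => [u w /WV Vu /WV Vw|u w z /WV Vu /WV Vw /WV Vz|k u w /WV Vu /WV Vw|u Wu]; rewrite /c.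
  - by rewrite aS// bS.
  - by rewrite aD// bD//; ring.
  - by rewrite aZ// bZ//; ring.
  - by rewrite subr_ge0 fmax.
have cf w : V w -> (forall g, g \in s -> b w g = 0) -> c f w = 0.
  move=> Vw ws; apply: (form_isotropic sW fc) => //.
  by rewrite /c af mulr1 subrr.
move=> w Vw.
have [|||z [Vz zs]] := @chain_projection s (c f) cs _ _ _ w Vw.
- move=> x y Vx Vy; rewrite /c.
  rewrite (aS f)// ?(bS f)// ?(formBl sV fa)// ?(formBl sV fb)//.
  by rewrite (aS x f)// (aS y f)// (bS x f)// (bS y f)//; ring.
  all: try exact: subspaceB.
- move=> k x Vx; have Vkx := VZ k x Vx.
  by rewrite /c (aS f)// (bS f)// aZ// bZ// (aS f)// (bS f)//; ring.
- move=> g gs; have [Vg bg Eg] := eigen_chainP cs gs.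
  rewrite /c (fs _ gs) subr0.
  have : b g g * a g f = 0 by rewrite -Eg// bS// fs.
  by move/eqP; rewrite mulf_eq0 gt_eqF//= aS// => /eqP ->; rewrite mulr0.
- by rewrite (cf _ Vz zs) => /eqP; rewrite /c subr_eq0 => /eqP.
Qed.

Let next s : E := xget 0 [set f | next_eigen s f].

Fixpoint eigen_list n : seq E :=
  if n is n'.+1 then next (eigen_list n') :: eigen_list n' else [::].

Lemma eigen_list_chain n : eigen_chain (eigen_list n).
Proof.
elim: n => //= n IHn; split=> //; rewrite /next; case: xgetP => [//|h].
by have [f /h] := next_eigen_exists IHn.
Qed.

Lemma mem_eigen_list j k : (j < k)%N -> next (eigen_list j) \in eigen_list k.
Proof.
elim: k => // k IHk; rewrite ltnS leq_eqVlt => /predU1P[->|jk] /=.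
  exact: mem_head.
by rewrite in_cons IHk// orbT.
Qed.

(** The eigenvalues 1 / b f f tend to infinity: otherwise infinitely many
    eigenvectors would stay at mutual a-distance sqrt 2 with mutual b-distances
    bounded below, while two of them can be chosen that the finitely many
    functionals of form_compact hardly tell apart. *)
Theorem spectral_sequence : exists (lambda : nat -> R) (f : nat -> E),
  [/\ forall k, 0 < lambda k, lambda k @[k --> \oo] --> +oo,
      forall k, V (f k) /\ 0 < b (f k) (f k),
      forall k v, V v -> a (f k) v = lambda k * b (f k) v &
      forall k l, k <> l -> b (f k) (f l) = 0].
Proof.
pose f k := next (eigen_list k).
have fP k : next_eigen (eigen_list k) (f k) by case: (eigen_list_chain k.+1).
have Vf k : V (f k) by case: (fP k) => -[].
have af k : a (f k) (f k) = 1 by case: (fP k) => -[].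
have bf k : 0 < b (f k) (f k) by case: (fP k).
have Ef k v : V v -> b (f k) v = b (f k) (f k) * a (f k) v.
  by case: (fP k) => _ _ _ _; apply.
have [bS bD bZ b0] := fb; have [aS aD aZ a0] := fa.
have orth k l : k <> l -> b (f k) (f l) = 0.
  move=> /eqP; rewrite neq_lt => /orP[kl|lk].
    by rewrite bS//; have [_ _ h _ _] := fP l; apply: h; exact: mem_eigen_list.
  by have [_ _ h _ _] := fP k; apply: h; exact: mem_eigen_list.
have aorth k l : k <> l -> a (f k) (f l) = 0.
  move=> kl; have /eqP := orth _ _ kl; rewrite Ef// mulf_eq0 gt_eqF//=.
  by move/eqP.
have mono k l : (k <= l)%N -> b (f l) (f l) <= b (f k) (f k).
  rewrite leq_eqVlt => /predU1P[->//|kl].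
  have [_ _ _ h _] := fP k; rewrite -[leRHS]mulr1 -(af l); apply: h => // g.
  elim: k kl => // k IHk kl; rewrite in_cons => /predU1P[->|gk].
    by apply: orth => e; move: kl; rewrite -e ltnNge leqnSn.
  by apply: IHk => //; exact: ltnW.
have lim0 (e : R) : 0 < e -> exists k, b (f k) (f k) < e.
  move=> e0; apply/not_existsP => h.
  have {}h k : e <= b (f k) (f k) by rewrite leNgt; apply/negP; exact: h.
  have e20 : 0 < e / 2 by rewrite divr_gt0.
  have [N [l [K [lB lK lb]]]] := cpt e20.
  have [|p pP] := @bounded_cluster_rV N (fun n i => l i (f n)) (`|K| + 1).
    move=> n i.
    have hl : l i (f n) ^+ 2 <= `|K|.
      by apply: le_trans (lK _ _ (Vf n)) _; rewrite af mulr1 ler_norm.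
    rewrite -(@ler_pXn2r _ 2)// ?nnegrE ?addr_ge0// real_normK ?num_real//.
    by have := normr_ge0 K; nra.
  pose d := Num.min 1 (e / (8 * (N%:R + 1))).
  have N1 : 0 < N%:R + 1 :> R by rewrite ltr_wpDl.
  have d0 : 0 < d by rewrite lt_min ltr01 divr_gt0// mulr_gt0.
  (* two eigenvectors with nearly the same values for all the functionals *)
  have [k _ kP] := pP _ 0%N d0; have [m km mP] := pP _ k.+1 d0.
  have nkm : k <> m by move=> e'; move: km; rewrite e' ltnn.
  have Vd : V (f k - f m) by exact: subspaceB.
  have := lb _ Vd; rewrite (formB sV fb)// (formB sV fa)// !af (orth k m)// (aorth k m)//.
  have : \sum_(i < N) l i (f k - f m) ^+ 2 <= \sum_(i < N) (4 * d).
    apply: ler_sum => i _; rewrite lB//.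
    rewrite (_ : l i (f k) - l i (f m) = (l i (f k) - p i) - (l i (f m) - p i)); last by ring.
    have := kP i; have := mP i; rewrite !ltr_norml => /andP[? ?] /andP[? ?].
    have : d <= 1 by rewrite ge_min lexx.
    nra.
  rewrite sumr_const card_ord -mulr_natr.
  have : d * (8 * (N%:R + 1)) <= e.
    by rewrite -ler_pdivlMr ?mulr_gt0// ge_min lexx orbT.
  by have := h k; have := h m; nra.
exists (fun k => (b (f k) (f k))^-1), f; split => //.
- by move=> k; rewrite invr_gt0.
- apply/cvgryPge => A; have A0 : 0 < (`|A| + 1)^-1 by rewrite invr_gt0 ltr_wpDl.
  have [k kA] := lim0 _ A0; exists k => // n /= kn.
  apply: le_trans (ler_norm A) _; apply: le_trans (_ : `|A| + 1 <= _).
    by rewrite lerDl.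
  rewrite -[leLHS]invrK lef_pV2 ?posrE//.
  by apply: ltW; apply: le_lt_trans kA; exact: mono.
- by move=> k v Vv; rewrite (Ef k v Vv) mulKf// gt_eqF.
Qed.

End spectral.
End forms.

(** * Borel sets and translations of Lebesgue measure *)

Section topology_rV.
Context (R : realType) (d : nat).
Implicit Types (x y z h : 'rV[R]_d) (U A : set 'rV[R]_d).
Implicit Types (a b : 'rV[R]_d).

Lemma ball_rVE x (r : R) z : 0 < r ->
  ball x r z <-> forall i, `|x ord0 i - z ord0 i| < r.
Proof.
move=> r0; split=> [[_ h] i|h]; first exact: (h ord0 i).
by split=> // i j; rewrite (ord1 i); exact: h.
Qed.

Lemma ball_rV_gt0 x (r : R) z : ball x r z -> 0 < r.
Proof. by case. Qed.

Definition obox a b : set 'rV[R]_d :=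
  [set x | forall i, a ord0 i < x ord0 i < b ord0 i].

Definition cbox a b : set 'rV[R]_d :=
  [set x | forall i, a ord0 i <= x ord0 i <= b ord0 i].

Lemma obox_sub_cbox a b : obox a b `<=` cbox a b.
Proof. by move=> x h i; have /andP[? ?] := h i; rewrite !ltW. Qed.

Lemma coord_rV_continuous i : continuous (@coord_rV R d i : 'rV[R]_d -> R).
Proof. exact: coord_continuous. Qed.

Lemma compact_cbox a b : compact (cbox a b).
Proof.
rewrite (_ : cbox a b = [set x | forall i, `[a ord0 i, b ord0 i]%classic (x ord0 i)]).
  by apply: (@rV_compact _ _ (fun i => `[a ord0 i, b ord0 i]%classic)) => i; exact: segment_compact.
by apply/seteqP; split => x h i; have := h i; rewrite /= in_itv.
Qed.

Lemma measurable_coords (A : 'I_d -> set (measurableTypeR R)) :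
  (forall i, measurable (A i)) ->
  measurable [set x : 'rV[R]_d | forall i, A i (coord_rV i x)].
Proof.
move=> mA; rewrite (_ : [set x | _] = \bigcap_(i in [set: 'I_d])
    (coord_rV i @^-1` A i)).
  apply: fin_bigcap_measurable => // i _.
  by rewrite -[X in measurable X]setTI; exact: (measurable_coord_rV i measurableT).
by apply/seteqP; split => x /= h; move=> i; [move=> _|]; exact: h.
Qed.

Lemma measurable_obox a b : measurable (obox a b).
Proof.
rewrite (_ : obox a b = [set x | forall i, [set` `]a ord0 i, b ord0 i[] (coord_rV i x)]).
  by apply: (@measurable_coords (fun i => [set` `]a ord0 i, b ord0 i[])) => i; exact: measurable_itv.
by apply/seteqP; split => x h i; have := h i; rewrite /= in_itv.
Qed.

Lemma lebesgue_oboxE a b : lebesgue_rV R d (obox a b) =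
  (\prod_(i < d) lebesgue_measure (`]a ord0 i, b ord0 i[%classic : set (measurableTypeR R)))%E.
Proof.
rewrite (_ : obox a b = [set x | forall i, [set` `]a ord0 i, b ord0 i[] (coord_rV i x)]).
  by rewrite (@lebesgue_rV_box R d (fun i => [set` `]a ord0 i, b ord0 i[])).
by apply/seteqP; split => x h i; have := h i; rewrite /= in_itv.
Qed.

Lemma lebesgue_obox a b : (forall i, a ord0 i <= b ord0 i) ->
  lebesgue_rV R d (obox a b) = (\prod_(i < d) (b ord0 i - a ord0 i))%:E.
Proof.
move=> ab; rewrite lebesgue_oboxE -prodEFin; apply: eq_bigr => i _.
rewrite lebesgue_measure_itv/= lte_fin; case: ltP => h; first by rewrite -EFinB.
have -> : a ord0 i = b ord0 i by apply/eqP; rewrite eq_le ab.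
by rewrite subrr.
Qed.

Definition rV_max a b : 'rV[R]_d := \row_i Num.max (a ord0 i) (b ord0 i).
Definition rV_min a b : 'rV[R]_d := \row_i Num.min (a ord0 i) (b ord0 i).

Lemma obox_setI a b a' b' :
  obox a b `&` obox a' b' = obox (rV_max a a') (rV_min b b').
Proof.
apply/seteqP; split => x /=.
  by move=> [h h'] i; have := h i; have := h' i; rewrite !mxE gt_max lt_min => /andP[-> ->] /andP[-> ->].
move=> h; split => i; have := h i; rewrite !mxE gt_max lt_min.
  by move=> /andP[/andP[-> _] /andP[-> _]].
by move=> /andP[/andP[_ ->] /andP[_ ->]].
Qed.

Lemma cbox_setI_sub a b a' b' : cbox (rV_max a a') (rV_min b b') `<=` cbox a b.
Proof.
move=> x h i; have := h i; rewrite !mxE ge_max le_min.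
by move=> /andP[/andP[-> _] /andP[-> _]].
Qed.

Definition oboxes : set (set 'rV[R]_d) := [set obox ab.1 ab.2 | ab in setT].

Lemma oboxes_setI : setI_closed oboxes.
Proof.
move=> _ _ [[a b] _ <-] [[a' b'] _ <-] /=.
by exists (rV_max a a', rV_min b b') => //=; rewrite obox_setI.
Qed.

Lemma ball_obox x (r : R) : 0 < r ->
  ball x r = obox (x - const_mx r) (x + const_mx r).
Proof.
move=> r0; apply/seteqP; split => z.
  by move=> /(ball_rVE _ _ r0) h i; have := h i; rewrite !mxE ltr_norml; lra.
by move=> h; apply/ball_rVE => // i; have := h i; rewrite !mxE ltr_norml; lra.
Qed.

Lemma measurable_ball_rV x (r : R) : measurable (ball x r).
Proof.
have [r0|r0] := ltP 0 r; first by rewrite ball_obox//; exact: measurable_obox.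
rewrite (_ : ball x r = set0)//; apply/seteqP; split => // z /ball_rV_gt0.
by rewrite ltNge r0.
Qed.

(** Rational centres and radii are enough, so that every open cover by balls
    has a countable subcover. *)
Lemma lindelof_rV U (rad : 'rV[R]_d -> R) : U !=set0 ->
  (forall x, U x -> 0 < rad x) ->
  exists s : nat -> 'rV[R]_d,
    (forall k, U (s k)) /\ U `<=` \bigcup_k ball (s k) (rad (s k)).
Proof.
move=> [x0 Ux0] rad0.
pose B (qn : 'rV[rat]_d * nat) :=
  ball (map_mx ratr qn.1 : 'rV[R]_d) (qn.2.+1%:R^-1 : R).
pose P qn x := U x /\ B qn `<=` ball x (rad x).
pose s k := if unpickle k is Some qn then xget x0 [set x | P qn x] else x0.
(* s k is a centre in U whose ball contains the k-th rational ball, if any *)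
exists s; split=> [k|y Uy].
  rewrite /s; case: unpickle => // qn; case: xgetP => [x _ []//|_]; exact: Ux0.
have r0 := rad0 _ Uy.
have [n [t [tE t0 tr]]] : exists n (t : R), [/\ n.+1%:R^-1 = t, 0 < t & t < rad y / 2].
  have [n] := @ltr_add_invr R 0 (rad y / 2) (divr_gt0 r0 (ltr0Sn R 1)).
  by rewrite add0r => ?; exists n, n.+1%:R^-1; rewrite invr_gt0.
have /fin_all_exists[q qP] : forall i : 'I_d, exists q : rat,
    y ord0 i - t < ratr q < y ord0 i + t.
  move=> i; have [|q] := @rat_in_itvoo R (y ord0 i - t) (y ord0 i + t); first lra.
  by rewrite in_itv/=; exists q.
pose qn : 'rV[rat]_d * nat := (\row_i q i, n).
have qy i : `|(ratr (q i) : R) - y ord0 i| < t.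
  by have /andP[? ?] := qP i; rewrite ltr_norml; apply/andP; split; lra.
have Pqn : exists x, P qn x.
  exists y; split=> //; rewrite /B/= tE => z /ball_rVE => /(_ t0) h.
  apply/ball_rVE => // i.
  have := h i; have := qy i; rewrite !mxE !ltr_norml => /andP[? ?] /andP[? ?].
  by apply/andP; split; lra.
exists (pickle qn) => //; rewrite /s pickleK; case: xgetP => [x _ [_]|h].
  by apply; rewrite /B/= tE; apply/ball_rVE => // i; have := qy i; rewrite !mxE.
by case: Pqn => x /h.
Qed.

Lemma open_bigcup_ball U : open U -> U !=set0 ->
  exists (s : nat -> 'rV[R]_d) (r : nat -> R),
    (forall k, 0 < r k) /\ U = \bigcup_k ball (s k) (r k).
Proof.
move=> oU U0.
have /choice[rad radP] : forall x, exists r : R, U x -> 0 < r /\ ball x r `<=` U.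
  move=> x; have [Ux|nUx] := pselect (U x); last by exists 0.
  have /nbhs_ballP[r /= r0 h] : nbhs x U by apply: open_nbhs_nbhs.
  by exists r.
have [x Ux|s [Us sU]] := @lindelof_rV U rad U0; first by case: (radP _ Ux).
exists s, (fun k => rad (s k)); split=> [k|]; first by have [] := radP _ (Us k).
apply/seteqP; split => // x [k _].
by have [_] := radP _ (Us k); apply.
Qed.

Lemma open_measurable_rV U : open U -> measurable U.
Proof.
move=> oU; have [->//|/set0P U0] := eqVneq U set0.
have [s [r [_ ->]]] := open_bigcup_ball oU U0.
by apply: bigcup_measurable => k _; exact: measurable_ball_rV.
Qed.

Lemma closed_measurable_rV A : closed A -> measurable A.
Proof.
move=> cA; rewrite -[A]setCK; apply: measurableC; apply: open_measurable_rV.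
exact: closed_openC.
Qed.

Lemma continuous_measurable_fun_rV (f : 'rV[R]_d -> R) :
  continuous f -> measurable_fun setT f.
Proof.
move=> /continuousP cf; apply: (measurability _ (RGenOpens.measurableE R)).
move=> _ [_ [a [b ->] <-]]; rewrite setTI; apply: open_measurable_rV.
exact/cf/interval_open.
Qed.

(** By the Lindelof property, countably many of the balls are enough. *)
Lemma ae_local_rV (mu : {measure set 'rV[R]_d -> \bar R}) U (P : 'rV[R]_d -> Prop) :
  (forall x, U x -> exists2 r : R, 0 < r & {ae mu, forall z, ball x r z -> P z}) ->
  {ae mu, forall z, U z -> P z}.
Proof.
move=> h; have [->|U0] := eqVneq U set0; first by apply: aeW.
have /choice[rad radP] : forall x, exists r : R, U x ->
    0 < r /\ {ae mu, forall z, ball x r z -> P z}.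
  move=> x; have [Ux|nUx] := pselect (U x); last by exists 0.
  by have [r r0 hr] := h _ Ux; exists r.
have [|x Ux|s [Us sU]] := @lindelof_rV U rad; [exact/set0P|by case: (radP _ Ux)|].
have H k : {ae mu, forall z, ball (s k) (rad (s k)) z -> P z}.
  by have [] := radP _ (Us k).
apply: negligibleS (negligible_bigcup H).
move=> z /= /not_implyP[Uz nPz]; have [k _ skz] := sU _ Uz.
by exists k => //= /(_ skz).
Qed.

(** Measures that agree on boxes agree on all measurable sets; this is how the
    translation invariance of Lebesgue measure passes from the factors to the
    product, and how a function is tested by its integrals over boxes. *)
Lemma measurable_rV_oboxes : @measurable _ 'rV[R]_d = <<s oboxes >>.
Proof.
apply/seteqP; split; last first.
  apply: smallest_sub; first exact: sigma_algebra_measurable.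
  by move=> _ [[a b] _ <-]; exact: measurable_obox.
have sO := @smallest_sigma_algebra _ setT oboxes.
have opn U : open U -> <<s oboxes >> U.
  move=> oU; have [->|/set0P U0] := eqVneq U set0; first by case: sO.
  have [s [r [r0 ->]]] := open_bigcup_ball oU U0.
  case: sO => _ _; apply => k; rewrite ball_obox//.
  by apply: sub_sigma_algebra; eexists (_, _).
apply: smallest_sub => //.
rewrite -bigcup_seq => _ [i _ [B mB <-]]; rewrite setTI.
pose P := [set B : set (measurableTypeR R) | <<s oboxes >> (@coord_rV R d i @^-1` B)].
suff : measurable `<=` P by exact.
rewrite RGenOpens.measurableE; apply: smallest_sub.
  split; rewrite /P /=; first by rewrite preimage_set0; case: sO.
  - by move=> C hC; rewrite setTD -preimage_setC; case: sO => _ + _; rewrite -setTD; apply.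
  - by move=> F hF; rewrite preimage_bigcup; case: sO => _ _; apply.
move=> _ [p [q ->]]; apply: opn.
by have /continuousP := @coord_rV_continuous i; apply; exact: interval_open.
Qed.

(** The extraction of a finite subcover, as an induction principle. *)
Lemma compact_ball_ind (K : set 'rV[R]_d) (P : set 'rV[R]_d -> Prop) :
  compact K -> P set0 -> (forall S T, P S -> P T -> P (S `|` T)) ->
  (forall S T, S `<=` T -> P T -> P S) ->
  (forall x, K x -> exists2 r : R, 0 < r & P (ball x r)) -> P K.
Proof.
move=> cK P0 PU PS PB.
have /boolp.choice[rad radP] : forall x, exists r : R, K x -> 0 < r /\ P (ball x r).
  move=> x; have [Kx|nKx] := pselect (K x); last by exists 0.
  by have [r r0 Pr] := PB x Kx; exists r.
have := cK; rewrite compact_cover.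
move=> /(_ 'rV[R]_d K (fun x => interior (ball x (rad x)))).
case.
- by move=> x Kx; exact: open_interior.
- by move=> x Kx; exists x => //; have [r0 _] := radP _ Kx; exact: nbhsx_ballx.
move=> D DK KD; apply: (PS _ _ KD).
have := bigcup_seq (finmap.enum_fset D) (fun x => interior (ball x (rad x))).
rewrite coverE => ->; rewrite big_seq; elim/big_ind : _ => // x xD.
by apply: PS (@interior_subset _ _) _; case: (radP x) => //; exact/set_mem/DK.
Qed.

(** A Lebesgue number of the cover of K by balls contained in U. *)
Lemma compact_margin (K U : set 'rV[R]_d) : compact K -> open U -> K `<=` U ->
  exists2 e : R, 0 < e & forall x, K x -> ball x e `<=` U.
Proof.
move=> cK oU KU.
pose P S := exists2 e : R, 0 < e & forall x, S x -> ball x e `<=` U.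
apply: (compact_ball_ind (P := P)) cK _ _ _ _.
- by exists 1.
- move=> S T [e e0 Se] [e' e'0 Te']; exists (Num.min e e'); first by rewrite lt_min e0.
  by move=> x [/Se|/Te'] h; apply: subset_trans h; apply: le_ball; rewrite ge_min lexx ?orbT.
- by move=> S T ST [e e0 Te]; exists e => // x /ST; exact: Te.
move=> x Kx; have /nbhs_ballP[r /= r0 h] : nbhs x U.
  by apply: open_nbhs_nbhs; split => //; exact: KU.
have r20 : 0 < r / 2 by rewrite divr_gt0.
exists (r / 2) => //; exists (r / 2) => // y xy; apply: subset_trans h => z yz.
by rewrite [r]splitr; exact: ball_triangle xy yz.
Qed.

End topology_rV.

Section translation.
Context (R : realType) (d : nat).
Notation mu := (lebesgue_rV R d).
Implicit Types (h : 'rV[R]_d).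

Lemma measurable_shift h : measurable_fun setT (fun x : 'rV[R]_d => x + h).
Proof.
apply: measurable_fun_rV => i.
rewrite (_ : _ \o _ = fun x => (coord_rV i x + h ord0 i)%R); last first.
  by apply/funext => x /=; rewrite /coord_rV !mxE.
by apply: measurable_funD => //; exact: measurable_coord_rV.
Qed.

Let big_box k : set 'rV[R]_d := obox (const_mx (- k%:R)) (const_mx k%:R).

Let big_box_cover : \bigcup_k big_box k = setT.
Proof.
apply/seteqP; split => // x _.
exists (Num.truncn (\sum_(i < d) `|x ord0 i|)).+1 => // i.
rewrite !mxE -ltr_norml; apply: le_lt_trans (truncnS_gt _).
by rewrite (bigD1 i)//= lerDl sumr_ge0.
Qed.

Let big_box_finite k : (mu (big_box k) < +oo)%E.
Proof.
rewrite /big_box lebesgue_obox ?ltry// => i; rewrite !mxE.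
by apply: le_trans (ler0n _ _); rewrite oppr_le0.
Qed.

Lemma lebesgue_rV_shift h (A : set 'rV[R]_d) : measurable A ->
  mu ((fun x => x + h) @^-1` A) = mu A.
Proof.
move=> mA.
have mh : measurable_fun setT (fun x : 'rV[R]_d => x + h) by exact: measurable_shift.
apply/esym; apply: (@measure_unique _ _ _ (@oboxes R d) big_box (@measurable_rV_oboxes R d)
  (@oboxes_setI R d) _ big_box_cover mu (pushforward mu (fun x => x + h))) => //.
- by move=> k; exists (const_mx (- k%:R), const_mx k%:R).
- move=> _ [[a b] _ <-]; rewrite /= /pushforward.
  have -> : (fun x => x + h) @^-1` obox a b = obox (a - h) (b - h).
    by apply/seteqP; split => x hx i; have := hx i; rewrite !mxE ltrBlDr ltrBrDr.
  rewrite !lebesgue_oboxE; apply: eq_bigr => i _.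
  by rewrite !lebesgue_measure_itv/= !mxE !lte_fin ltrD2r -!EFinB (_ : b ord0 i - _ - _ = b ord0 i - a ord0 i)//; ring.
Qed.

Lemma ge0_integral_shift h (A : set 'rV[R]_d) (f : 'rV[R]_d -> \bar R) :
  measurable A -> measurable_fun A f -> (forall x, A x -> 0 <= f x)%E ->
  (\int[mu]_(x in (fun x => x + h)%R @^-1` A) f (x + h)%R = \int[mu]_(x in A) f x)%E.
Proof.
move=> mA mf f0.
rewrite -(@ge0_integral_pushforward _ _ _ _ R _ (measurable_shift h) mu A f)//.
  apply: eq_measure_integral => [|? B mB _]; first exact: measurable_shift.
  rewrite /= /pushforward.
  exact: lebesgue_rV_shift.
by move=> x /set_mem; exact: f0.
Qed.

Lemma integrable_shift h (f : 'rV[R]_d -> \bar R) :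
  mu.-integrable setT f -> mu.-integrable setT (fun x => f (x + h)).
Proof.
move=> /integrableP[mf foo]; apply/integrableP; split.
  exact: (measurableT_comp mf (measurable_shift h)).
rewrite -(preimage_setT (fun x => x + h)) (@ge0_integral_shift h setT (fun x => `|f x|%E))//.
exact: measurableT_comp.
Qed.

Lemma ge0_integral_shiftT h (f : 'rV[R]_d -> \bar R) :
  measurable_fun setT f -> (forall x, 0 <= f x)%E ->
  (\int[mu]_x f (x + h)%R = \int[mu]_x f x)%E.
Proof.
move=> mf f0; have := @ge0_integral_shift h setT f measurableT mf (fun x _ => f0 x).
by rewrite preimage_setT.
Qed.

Lemma integral_shiftT h (f : 'rV[R]_d -> \bar R) : measurable_fun setT f ->
  (\int[mu]_x f (x + h)%R = \int[mu]_x f x)%E.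
Proof.
move=> mf; rewrite integralE [RHS]integralE; congr (_ - _)%E.
  apply: etrans (ge0_integral_shiftT h (measurable_funepos mf) (funepos_ge0 _)).
  by apply: eq_integral => x _; rewrite ?funeposE ?funenegE.
apply: etrans (ge0_integral_shiftT h (measurable_funeneg mf) (funeneg_ge0 _)).
by apply: eq_integral => x _; rewrite ?funeposE ?funenegE.
Qed.

Lemma Rintegral_shift h (f : 'rV[R]_d -> R) : measurable_fun setT f ->
  \int[mu]_x f (x + h) = \int[mu]_x f x.
Proof.
move=> mf; rewrite /Rintegral; congr fine.
by apply: (integral_shiftT h (f := EFin \o f)); exact/measurable_EFinP.
Qed.

End translation.

(** * Smooth bump functions *)

Section flat.
Context {R : realType}.
Implicit Types (p : {poly R}) (x y : R).

Lemma expR_dominates_pow n : exists C : R, forall y, 0 <= y ->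
  y ^+ n * expR (- y) <= C.
Proof.
case: n => [|n].
  exists 1 => y y0; rewrite expr0 mul1r.
  by rewrite -[leRHS](expR0) ler_expR oppr_le0.
exists (n.+1`!%:R) => y y0.
rewrite expRN ler_pdivrMr ?expR_gt0// mulrC -ler_pdivrMr ?ltr0n ?fact_gt0//.
by apply: le_trans (expR_ge1Dxn n y0); rewrite lerDr.
Qed.

Lemma expR_dominates_poly p : exists C : R, forall y, 0 <= y ->
  `|p.[y]| * expR (- y) <= C.
Proof.
have /boolp.choice[C hC] := @expR_dominates_pow.
exists (\sum_(i < size p) `|p`_i| * C i) => y y0.
rewrite horner_coef; apply: le_trans (_ : \sum_(i < size p) `|p`_i * y ^+ i| * expR (- y) <= _).
  by rewrite -mulr_suml ler_wpM2r ?expR_ge0//; exact: ler_norm_sum.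
apply: ler_sum => i _; rewrite normrM -mulrA ler_wpM2l//.
by rewrite ger0_norm ?exprn_ge0//; exact: hC.
Qed.

(** The family of the functions p(1/x) exp(-1/x), extended by zero, is stable
    under differentiation; the member p = 1 is the classical flat function. *)
Definition flat p x : R := if 0 < x then p.[x^-1] * expR (- x^-1) else 0.

Definition flat_der p : {poly R} := 'X^2 * (p - p^`()).

Lemma flat_le0 p x : x <= 0 -> flat p x = 0.
Proof. by rewrite /flat leNgt => /negbTE ->. Qed.

Lemma is_derive_flat p x : is_derive x 1 (flat p) (flat (flat_der p) x).
Proof.
have [x0|x0|<-] := ltgtP 0 x.
- have e : \forall z \near x, p.[z^-1] * expR (- z^-1) = flat p z.
    have : \forall z \near x, 0 < z by exact: lt_nbhsr.
    by apply: filterS => z z0; rewrite /flat z0.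
  apply: near_eq_is_derive e _.
  have dV : is_derive x 1 (fun z : R => z^-1) (- x ^- 2).
    have := @is_deriveV R (fun z : R => z) x 1 1 (lt0r_neq0 x0) (is_derive_id _ _).
    by move=> h; apply: is_derive_eq h _; rewrite /GRing.scale/= mulr1.
  have dp : is_derive x 1 (fun z : R => p.[z^-1]) ((- x ^- 2) * p^`().[x^-1]).
    have := @is_derive1_comp R (horner p) (fun z : R => z^-1) x (p^`().[x^-1]) (- x ^- 2).
    by move=> h; apply: is_derive_eq (h _ dV) _ => //; rewrite mulrC.
  have de : is_derive x 1 (fun z : R => expR (- z^-1)) (x ^- 2 * expR (- x^-1)).
    have dNV : is_derive x 1 (fun z : R => - z^-1) (x ^- 2).
      by apply: is_derive_eq (is_deriveN dV) _; rewrite opprK.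
    have := @is_derive1_comp R expR (fun z : R => - z^-1) x (expR (- x^-1)) (x ^- 2).
    by move=> h; apply: is_derive_eq (h _ dNV) _ => //; rewrite mulrC.
  apply: is_derive_eq (is_deriveM dp de) _.
  rewrite /flat x0 /flat_der hornerM hornerXn hornerD hornerN /GRing.scale/= exprVn; ring.
- have e : \forall z \near x, cst 0 z = flat p z.
    have : \forall z \near x, z < 0 by exact: lt_nbhsl.
    by apply: filterS => z z0; rewrite flat_le0// ltW.
  by rewrite flat_le0 ?ltW//; apply: near_eq_is_derive e _; exact: is_derive_cst.
rewrite flat_le0//.
have [C hC] := expR_dominates_poly ('X^2 * p).
have C0 : 0 <= C.
  by apply: le_trans (hC 0 (lexx _)); rewrite mulr_ge0 ?expR_ge0.
have cvg0 : (fun h => h^-1 *: (flat p (h *: 1 + 0) - flat p 0)) @ 0^' --> (0 : R).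
  apply/cvgrPdist_le => e e0.
  have : \forall h \near 0^', `|h : R| < e / (C + 1).
    apply: dnbhs0_lt; rewrite divr_gt0//; lra.
  apply: filterS => h he.
  rewrite sub0r normrN [flat p 0]flat_le0// subr0 addr0 /GRing.scale/= mulr1.
  have [h0|h0] := leP h 0; first by rewrite flat_le0// mulr0 normr0 ltW.
  rewrite /flat h0 normrM normrM (ger0_norm (expR_ge0 _)).
  have h0' : 0 <= h^-1 by rewrite invr_ge0 ltW.
  rewrite (ger0_norm h0'); have := hC _ h0'.
  rewrite hornerM hornerXn normrM ger0_norm ?exprn_ge0// => hh.
  have -> : h^-1 * (`|p.[h^-1]| * expR (- h^-1)) =
    h * (h^-1 ^+ 2 * `|p.[h^-1]| * expR (- h^-1)).
    by field; rewrite gt_eqF.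
  apply: le_trans (_ : h * (C + 1) <= e); first by rewrite ler_pM2l//; lra.
  rewrite -ler_pdivlMr; last lra.
  by apply: ltW; apply: le_lt_trans he; exact: ler_norm.
have dd : derivable (flat p) 0 1 by apply/cvg_ex; exists 0.
apply: DeriveDef => //.
by apply: cvg_lim cvg0.
Qed.

End flat.

Section smooth_functions.
Context (R : realType) (d : nat).
Implicit Types (f g : 'rV[R]_d -> R) (x : 'rV[R]_d) (i j : 'I_d).
Local Notation e_ i := (delta_mx ord0 i : 'rV[R]_d).
Local Notation cd := (@continuously_differentiable R d).

Lemma cd_continuous k f : cd k f -> continuous f.
Proof. by case: k => [|k] []. Qed.

Lemma cd_weaken k f : cd k.+1 f -> cd k f.
Proof.
elim: k f => [f [cf _]//|k IHk f [cf hf]]; split=> // i.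
by have [df cdf] := hf i; split=> //; exact: IHk.
Qed.

Lemma cd_cst k (c : R) : cd k (fun=> c).
Proof.
elim: k c => [|k IHk] c; first by split=> //; exact: cst_continuous.
split=> [|i]; first exact: cst_continuous.
split=> [x|]; first exact: derivable_cst.
have -> : 'D_(e_ i) (fun=> c) = (fun=> 0) :> ('rV[R]_d -> R).
  by apply/funext => x; exact: derive_cst.
exact: IHk.
Qed.

Lemma cdD k f g : cd k f -> cd k g -> cd k (fun x => f x + g x).
Proof.
elim: k f g => [f g [cf _] [cg _]|k IHk f g [cf hf] [cg hg]].
  by split=> // x; exact: (cvgD (cf x) (cg x)).
split=> [x|i]; first exact: (cvgD (cf x) (cg x)).
have [df cdf] := hf i; have [dg cdg] := hg i.
split=> [x|]; first by apply: derivableD; [exact: df|exact: dg].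
rewrite (_ : 'D_(e_ i) _ = fun x => 'D_(e_ i) f x + 'D_(e_ i) g x); first exact: IHk.
by apply/funext => x; rewrite -deriveD.
Qed.

Lemma cdM k f g : cd k f -> cd k g -> cd k (fun x => f x * g x).
Proof.
elim: k f g => [f g [cf _] [cg _]|k IHk f g cdf' cdg'].
  by split=> // x; exact: (cvgM (cf x) (cg x)).
have [cf hf] := cdf'; have [cg hg] := cdg'.
split=> [x|i]; first exact: (cvgM (cf x) (cg x)).
have [df cdf] := hf i; have [dg cdg] := hg i.
split=> [x|]; first by apply: derivableM; [exact: df|exact: dg].
rewrite (_ : 'D_(e_ i) _ = fun x => f x * 'D_(e_ i) g x + g x * 'D_(e_ i) f x).
  by apply: cdD; apply: IHk => //; exact: cd_weaken.
by apply/funext => x; exact: (deriveM (df x) (dg x)).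
Qed.

Lemma cd_prod k (I : Type) (r : seq I) (P : pred I) (F : I -> 'rV[R]_d -> R) :
  (forall l, P l -> cd k (F l)) -> cd k (fun x => \prod_(l <- r | P l) F l x).
Proof.
move=> cF; elim: r => [|i r IHr].
  by under eq_fun do rewrite big_nil; exact: cd_cst.
under eq_fun do rewrite big_cons.
by case: (boolP (P i)) => // Pi; apply: cdM => //; exact: cF.
Qed.

Lemma quotient_coord (phi : R -> R) i j x :
  (fun h : R => h^-1 *: ((phi \o @coord_rV R d i) (h *: e_ j + x) - (phi \o @coord_rV R d i) x)) =
  if i == j then (fun h : R => h^-1 *: (phi (h *: 1 + coord_rV i x) - phi (coord_rV i x)))
  else cst 0.
Proof.
apply/funext => h /=; rewrite /coord_rV !mxE eqxx/=.
case: (eqVneq i j) => [->|ij]; first by rewrite /GRing.scale/=.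
by rewrite mulr0 add0r subrr scaler0.
Qed.

Lemma is_derive_coord (phi : R -> R) (l : R) i j x :
  is_derive (coord_rV i x : R) 1 phi l ->
  is_derive x (e_ j) (phi \o @coord_rV R d i) (if i == j then l else 0).
Proof.
move=> [dphi <-].
have dd : derivable (phi \o @coord_rV R d i) x (e_ j).
  rewrite /derivable quotient_coord; case: (i == j); first exact: dphi.
  by apply/cvg_ex; exists 0; exact: cvg_cst.
apply: DeriveDef => //; rewrite /derive quotient_coord.
by case: (i == j) => //; exact: lim_cst.
Qed.

(** The induction step that makes the flat functions of a coordinate smooth: their
    derivatives are of the same kind. *)
Lemma cd_coordS k (phi psi : R -> R) i :
  (forall y : R, is_derive y 1 phi (psi y)) ->
  cd k (psi \o @coord_rV R d i) -> cd k.+1 (phi \o @coord_rV R d i).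
Proof.
move=> dphi cpsi.
have cphi : continuous phi.
  by move=> y; apply/differentiable_continuous/derivable1_diffP; case: (dphi y).
split=> [x|j].
  apply: continuous_comp; [exact: coord_rV_continuous|exact: cphi].
have dj x := is_derive_coord j (dphi (coord_rV i x)).
split=> [x|]; first by case: (dj x).
have [ij|ij] := eqVneq i j.
  rewrite (_ : 'D__ _ = psi \o @coord_rV R d i)//; apply/funext => x.
  by have [_ ->] := dj x; rewrite ij eqxx.
rewrite (_ : 'D__ _ = fun=> 0); first exact: cd_cst.
by apply/funext => x; have [_ ->] := dj x; rewrite (negbTE ij).
Qed.

Lemma is_derive_flat_affine (p : {poly R}) (c a y : R) :
  is_derive y 1 (fun z => flat p (c * (z - a))) (c * flat (flat_der p) (c * (y - a))).
Proof.
have da : is_derive y 1 (fun z : R => c * (z - a)) c.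
  have h := is_deriveZ c (is_deriveB (is_derive_id y (1:R)) (is_derive_cst a y (1:R))).
  by apply: is_derive_eq h _; rewrite subr0 /GRing.scale/= mulr1.
have := @is_derive1_comp R (flat p) (fun z : R => c * (z - a)) y _ c (is_derive_flat _ _) da.
by move=> h; apply: is_derive_eq h _; rewrite mulrC.
Qed.

Lemma cd_flat k (p : {poly R}) (c a : R) i :
  cd k ((fun y => flat p (c * (y - a))) \o @coord_rV R d i).
Proof.
apply: cd_weaken; elim: k p => [|k IHk] p.
  apply: (@cd_coordS 0 _ (fun y => c * flat (flat_der p) (c * (y - a)))).
    by move=> y; exact: is_derive_flat_affine.
  split=> // x; apply: continuous_comp; first exact: coord_rV_continuous.
  apply: cvgMr.
  have [h _] := is_derive_flat_affine (flat_der p) c a (coord_rV i x).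
  by move/derivable1_diffP/differentiable_continuous : h; exact.
apply: (@cd_coordS _ _ (fun y => c * flat (flat_der p) (c * (y - a)))).
  by move=> y; exact: is_derive_flat_affine.
exact: (cdM (cd_cst _ c) (IHk (flat_der p))).
Qed.

End smooth_functions.

Section bumps.
Context {R : realType}.
Implicit Types (a b c s y t : R) (n : nat).

(** The parameter n makes the bumps converge to the indicator of the interval from
    a to b. *)
Definition bump n a b y : R :=
  flat 1 (n.+1%:R * (y - a)) * flat 1 (- n.+1%:R * (y - b)).

Lemma flat1_ge0 y : 0 <= flat 1 y.
Proof.
by rewrite /flat; case: ifP => // _; rewrite hornerC mul1r expR_ge0.
Qed.

Lemma flat1_le1 y : flat 1 y <= 1.
Proof.
rewrite /flat; case: ifPn => // y0; rewrite hornerC mul1r -[leRHS](@expR0 R).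
by rewrite ler_expR oppr_le0 invr_ge0 ltW.
Qed.

Lemma flat1_gt0 y : 0 < y -> 0 < flat 1 y.
Proof. by move=> y0; rewrite /flat y0 hornerC mul1r expR_gt0. Qed.

Lemma bump_ge0 n a b y : 0 <= bump n a b y.
Proof. by rewrite mulr_ge0 ?flat1_ge0. Qed.

Lemma bump_le1 n a b y : bump n a b y <= 1.
Proof. by rewrite mulr_ile1 ?flat1_ge0 ?flat1_le1. Qed.

Lemma bump_gt0 n a b y : a < y < b -> 0 < bump n a b y.
Proof.
move=> /andP[ay yb]; rewrite mulr_gt0 ?flat1_gt0//.
  by rewrite mulr_gt0 ?subr_gt0.
by rewrite mulNr -mulrN opprB mulr_gt0 ?subr_gt0.
Qed.

Lemma bump_out n a b y : ~~ (a < y < b) -> bump n a b y = 0.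
Proof.
rewrite negb_and -!leNgt => /orP[ya|yb]; rewrite /bump.
  by rewrite flat_le0 ?mul0r// mulr_ge0_le0// subr_le0.
by rewrite [X in _ * X]flat_le0 ?mulr0// mulNr oppr_le0 mulr_ge0 ?subr_ge0.
Qed.

Lemma bump_cvg a b y : bump n a b y @[n --> \oo] --> (((a < y < b)%R : bool)%:R : R).
Proof.
have [/andP[ay yb]|h] := boolP (a < y < b); last first.
  by under eq_fun do rewrite bump_out//; exact: cvg_cst.
have E c : 0 < c -> flat 1 (n.+1%:R * c) @[n --> \oo] --> (1 : R).
  move=> c0.
  have -> : (fun n => flat 1 (n.+1%:R * c)) = (fun n => expR (- (harmonic n * c^-1))).
    apply/funext => n; rewrite /flat mulr_gt0//.
    by rewrite hornerC mul1r invfM.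
  rewrite -(@expR0 R); apply: continuous_cvg; first exact: continuous_expR.
  rewrite -oppr0; apply: cvgN; rewrite -(mul0r c^-1).
  by apply: cvgMl; exact: cvg_harmonic.
rewrite -[X in _ --> X](mulr1 1); apply: cvgM; first by apply: E; rewrite subr_gt0.
under eq_fun do rewrite mulNr -mulrN opprB.
by apply: E; rewrite subr_gt0.
Qed.

Lemma bump_continuous n a b : continuous (bump n a b).
Proof.
move=> y; apply: cvgM.
  have [h _] := is_derive_flat_affine 1 n.+1%:R a y.
  by move/derivable1_diffP/differentiable_continuous : h; exact.
have [h _] := is_derive_flat_affine 1 (- n.+1%:R) b y.
by move/derivable1_diffP/differentiable_continuous : h; exact.
Qed.

Lemma bump_shift n a b s y : bump n a b (y - s) = bump n (a + s) (b + s) y.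
Proof. by rewrite /bump !opprD !addrA !(addrAC y (- s)). Qed.

Lemma bump_reflect n a b y t : bump n a b (y - t) = bump n (y - b) (y - a) t.
Proof. by rewrite /bump mulrC !mulNr -!mulrN; congr (flat 1 _ * flat 1 _); congr (_ * _); lra. Qed.

Lemma measurable_bump n a b : measurable_fun setT (bump n a b).
Proof. apply: continuous_measurable_fun; exact: bump_continuous. Qed.

Lemma integrable_bump n a b (A : set R) : measurable A ->
  (@lebesgue_measure R).-integrable A (EFin \o bump n a b).
Proof.
move=> mA; apply: (@integrableS _ _ _ _ setT) => //.
apply: (@le_integrable _ (measurableTypeR R) R lebesgue_measure setT measurableT
  (EFin \o bump n a b) (EFin \o \1_(`[a, b]%classic))).
- by apply/measurable_EFinP; exact: measurable_bump.
- move=> y _ /=; rewrite lee_fin !ger0_norm ?bump_ge0// indicE.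
  case: (boolP (a < y < b)) => [/andP[ay yb]|h]; last by rewrite bump_out.
  by rewrite mem_set ?bump_le1//= in_itv/= !ltW.
- exact: integrable_indic_itv.
Qed.

Lemma lebesgue_measure_reflect y (A : set (measurableTypeR R)) : measurable A ->
  lebesgue_measure ((fun t => y - t) @^-1` A) = lebesgue_measure A.
Proof.
move=> mA.
have mh : measurable_fun setT (fun t : measurableTypeR R => (y - t : measurableTypeR R)).
  exact: (@measurable_funB _ _ _ setT (cst y) id).
apply/esym; apply: (@lebesgue_measure_unique R (pushforward lebesgue_measure
  (fun t : measurableTypeR R => (y - t : measurableTypeR R)))) => // _ [[a b]] _ <-.
rewrite /= /pushforward (_ : (fun t : R => y - t) @^-1` _ = `[y - b, y - a[%classic).
  rewrite !lebesgue_measure_itv/= !lte_fin ltrD2l ltrN2; case: ifPn => // _.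
  by rewrite -!EFinB; congr EFin; lra.
by apply/seteqP; split => x /=; rewrite !in_itv/=; lra.
Qed.

(** The integral of the translates of a bump over a segment.  Its derivative is a
    difference of two bumps, and this is what turns a weak derivative into
    increments. *)
Definition swept_bump n a b s y : R :=
  \int[lebesgue_measure]_(t in `[0, s[) bump n a b (y - t).

Lemma swept_bumpE n a b s y : 0 <= s -> swept_bump n a b s y =
  \int[lebesgue_measure]_(t in `]-oo, y]) bump n a b t -
  \int[lebesgue_measure]_(t in `]-oo, y - s]) bump n a b t.
Proof.
move=> s0; rewrite Rintegral_itvB; last 3 first.
- by apply: integrable_bump; exact: measurable_itv.
- by rewrite bnd_simp.
- by rewrite bnd_simp gerBl.
rewrite /swept_bump /Rintegral; congr fine.
have mh : measurable_fun setT (fun t : measurableTypeR R => (y - t : measurableTypeR R)).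
  exact: (@measurable_funB _ _ _ setT (cst y) id).
have := @ge0_integral_pushforward _ _ _ _ R _ mh lebesgue_measure
  `]y - s, y]%classic (EFin \o bump n a b).
rewrite (_ : _ @^-1` _ = `[0, s[%classic); last first.
  by apply/seteqP; split => x /=; rewrite !in_itv/=; lra.
move=> /= <-//; last 2 first.
- by apply/measurable_EFinP; apply: measurable_funTS; exact: measurable_bump.
- by move=> t _; rewrite lee_fin bump_ge0.
apply: eq_measure_integral => B mB _; rewrite /= /pushforward.
exact: lebesgue_measure_reflect.
Qed.

Lemma is_derive_swept_bump n a b s y : 0 <= s ->
  is_derive y (1 : R) (swept_bump n a b s) (bump n a b y - bump n (a + s) (b + s) y).
Proof.
move=> s0.
pose G z := \int[lebesgue_measure]_(t in `]-oo, z]) bump n a b t.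
have dG (z : R) : is_derive z (1 : R) G (bump n a b z).
  have z1 : z < z + 1 by rewrite ltrDl.
  have ib := integrable_bump n a b (measurable_itv `]-oo, z + 1]).
  have /= h := continuous_FTC1 z1 ib.
  have [dGz Gz] := h (ltNyr z) (@bump_continuous n a b z).
  by apply: (DeriveDef dGz); rewrite -derive1E.
have -> : swept_bump n a b s = G - (G \o (fun z => z - s)).
  by apply/funext => z; rewrite swept_bumpE.
have ds : is_derive y (1 : R) (fun z => z - s) 1.
  have h := is_deriveB (is_derive_id y (1:R)) (is_derive_cst s y (1:R)).
  by apply: is_derive_eq h _; rewrite subr0.
have dGs := @is_derive1_comp R G (fun z => z - s) y _ _ (dG (y - s)) ds.
by rewrite -bump_shift; apply: is_derive_eq (is_deriveB (dG y) dGs) _; rewrite mulr1.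
Qed.

Lemma swept_bump_out n a b s y : ~~ (a < y < b + s) -> swept_bump n a b s y = 0.
Proof.
move=> h; rewrite /swept_bump.
under eq_Rintegral => t.
  rewrite inE/= in_itv/= => /andP[t0 ts].
  rewrite bump_out; first over.
  by apply: contra h; lra.
by rewrite /Rintegral integral0.
Qed.

End bumps.

Section boxes.
Context (R : realType) (d : nat).
Implicit Types (a b x : 'rV[R]_d) (n : nat) (i : 'I_d).
Local Notation e_ i := (delta_mx ord0 i : 'rV[R]_d).

Definition box_bump n a b x : R := \prod_i bump n (a ord0 i) (b ord0 i) (coord_rV i x).

Lemma box_bump_ge0 n a b x : 0 <= box_bump n a b x.
Proof. by apply: prodr_ge0 => i _; exact: bump_ge0. Qed.

Lemma box_bump_le1 n a b x : box_bump n a b x <= 1.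
Proof. by apply: prodr_ile1 => i; rewrite bump_ge0 bump_le1. Qed.

Lemma box_bump_gt0 n a b x : obox a b x -> 0 < box_bump n a b x.
Proof. by move=> h; apply: prodr_gt0 => i _; apply: bump_gt0; exact: h. Qed.

Lemma box_bump_out n a b x : ~ obox a b x -> box_bump n a b x = 0.
Proof.
move=> /existsNP[i /negP h]; rewrite /box_bump (bigD1 i)//= bump_out//.
by rewrite mul0r.
Qed.

Lemma box_bump_cvg a b x :
  box_bump n a b x @[n --> \oo] --> (\1_(obox a b) x : R).
Proof.
have [h|h] := pselect (obox a b x); last first.
  under eq_fun do rewrite box_bump_out//.
  by rewrite indicE memNset//; exact: cvg_cst.
rewrite indicE mem_set//.
have -> : 1 = \prod_(i < d) (1 : R) by rewrite big1.
apply: cvg_big => [|i _]; first exact: mul_continuous.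
by have := @bump_cvg R (a ord0 i) (b ord0 i) (coord_rV i x); rewrite h.
Qed.

Lemma cd_bump k n (l r : R) i :
  continuously_differentiable k (bump n l r \o @coord_rV R d i).
Proof. exact: (cdM (cd_flat _ _ _ _ _) (cd_flat _ _ _ _ _)). Qed.

Lemma cd_box_bump k n a b : continuously_differentiable k (box_bump n a b).
Proof. by apply: cd_prod => i _; exact: cd_bump. Qed.

Lemma test_function_cbox (A : set 'rV[R]_d) a b f :
  (forall k, continuously_differentiable k f) -> cbox a b `<=` A ->
  (forall x, ~ cbox a b x -> f x = 0) -> test_function A f.
Proof. by move=> cf abA f0; split=> //; exists (cbox a b); split=> //; exact: compact_cbox. Qed.

Lemma test_box_bump (A : set 'rV[R]_d) n a b : cbox a b `<=` A ->
  test_function A (box_bump n a b).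
Proof.
move=> abA; apply: test_function_cbox abA _; first by move=> k; exact: cd_box_bump.
by move=> x nx; apply: box_bump_out => /obox_sub_cbox.
Qed.

(** The sweep of the bump of a box over a segment of length s parallel to the i-th
    axis; only one factor is affected. *)
Definition swept_box_bump n a b i s x : R :=
  swept_bump n (a ord0 i) (b ord0 i) s (coord_rV i x) *
  \prod_(j | j != i) bump n (a ord0 j) (b ord0 j) (coord_rV j x).

Lemma swept_box_bumpE n a b i s x : 0 <= s -> swept_box_bump n a b i s x =
  \int[lebesgue_measure]_(t in `[0, s[) box_bump n a b (x - t *: e_ i).
Proof.
move=> s0; rewrite /swept_box_bump /swept_bump -RintegralZr//; last first.
  rewrite (_ : EFin \o _ = EFin \o bump n (coord_rV i x - b ord0 i) (coord_rV i x - a ord0 i)).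
    by apply: integrable_bump; exact: measurable_itv.
  by apply/funext => t /=; rewrite bump_reflect.
apply: eq_Rintegral => t _; rewrite /box_bump [in RHS](bigD1 i)//=; congr (_ * _).
  by rewrite /coord_rV !mxE !eqxx mulr1.
apply: eq_bigr => j ji; congr bump.
by rewrite /coord_rV !mxE eqxx/= (negbTE ji) mulr0 subr0.
Qed.

Lemma swept_box_bump_cd k n a b i s : 0 <= s ->
  continuously_differentiable k (swept_box_bump n a b i s).
Proof.
move=> s0; apply: cdM; last by apply: cd_prod => j _; exact: cd_bump.
apply: cd_weaken; apply: (cd_coordS (fun y => is_derive_swept_bump _ _ _ _ s0)).
have c1 := cd_bump k n (a ord0 i) (b ord0 i) i.
have c2 := cd_bump k n (a ord0 i + s) (b ord0 i + s) i.
rewrite (_ : _ \o _ = fun x => bump n (a ord0 i) (b ord0 i) (coord_rV i x) +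
    -1 * bump n (a ord0 i + s) (b ord0 i + s) (coord_rV i x)).
  by apply: cdD => //; apply: cdM => //; exact: cd_cst.
by apply/funext => x /=; rewrite mulN1r.
Qed.

Lemma derive_swept_box_bump n a b i s x : 0 <= s ->
  'D_(e_ i) (swept_box_bump n a b i s) x =
  box_bump n a b x - box_bump n a b (x - s *: e_ i).
Proof.
move=> s0.
pose f := swept_bump n (a ord0 i) (b ord0 i) s \o @coord_rV R d i.
pose g x := \prod_(j | j != i) bump n (a ord0 j) (b ord0 j) (coord_rV j x).
have df := is_derive_coord i (is_derive_swept_bump n (a ord0 i) (b ord0 i) (coord_rV i x) s0).
rewrite eqxx in df.
have shift_g h : g (h *: e_ i + x) = g x.
  apply: eq_bigr => j ji; congr bump.
  by rewrite /coord_rV !mxE eqxx/= (negbTE ji) mulr0 add0r.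
have dg : is_derive x (e_ i) g 0.
  have E : (fun h : R => h^-1 *: (g (h *: e_ i + x) - g x)) = cst 0.
    by apply/funext => h /=; rewrite shift_g subrr scaler0.
  apply: DeriveDef; first by rewrite /derivable E; apply/cvg_ex; exists 0; exact: cvg_cst.
  by rewrite /derive E; exact: lim_cst.
have [_ ->] := is_deriveM df dg.
rewrite scaler0 add0r -bump_shift /GRing.scale/= mulrC mulrBl; congr (_ - _).
  by rewrite [RHS]/box_bump (bigD1 i).
rewrite [RHS]/box_bump (bigD1 i)//=; congr (_ * _).
  by rewrite /coord_rV !mxE !eqxx mulr1.
have := shift_g (- s); rewrite scaleNr addrC => <-.
by [].
Qed.

Lemma test_swept_box_bump (A : set 'rV[R]_d) n a b i s : 0 <= s ->
  cbox a (b + s *: e_ i) `<=` A -> test_function A (swept_box_bump n a b i s).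
Proof.
move=> s0 abA; apply: test_function_cbox abA _.
  by move=> k; exact: swept_box_bump_cd.
move=> x /existsNP[j /negP h]; rewrite /swept_box_bump.
have [ji|ji] := eqVneq j i.
  rewrite swept_bump_out ?mul0r//; apply: contra h; rewrite ji /coord_rV !mxE !eqxx mulr1.
  by move=> /andP[? ?]; rewrite !ltW.
rewrite (bigD1 j)//= bump_out ?mul0r ?mulr0//; apply: contra h.
rewrite /coord_rV !mxE eqxx/= (negbTE ji) mulr0 addr0.
by move=> /andP[? ?]; rewrite !ltW.
Qed.

End boxes.

(** * Square integrable functions and the fundamental lemma *)

Section square_integrable_functions.
Context d (T : measurableType d) (R : realType).
Variables (mu : {measure set T -> \bar R}) (A : set T).
Hypothesis mA : measurable A.
Implicit Types u v : T -> R.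

Definition sqint u :=
  measurable_fun A u /\ mu.-integrable A (fun x => (u x ^+ 2)%:E).

Definition dot u v : R := \int[mu]_(x in A) (u x * v x).

Lemma sqintP u : sqint u <->
  measurable_fun A u /\ (\int[mu]_(x in A) (u x ^+ 2)%:E < +oo)%E.
Proof.
have E : (\int[mu]_(x in A) (u x ^+ 2)%:E = \int[mu]_(x in A) `|(u x ^+ 2)%:E|)%E.
  by apply: eq_integral => x _; rewrite gee0_abs// lee_fin sqr_ge0.
split=> [[mu' /integrableP[_]]|[mu']]; first by rewrite -E.
rewrite E => h; split=> //; apply/integrableP; split=> //.
by apply/measurable_EFinP; exact: measurable_funX.
Qed.

Lemma sqintM u v : sqint u -> sqint v ->
  mu.-integrable A (fun x => (u x * v x)%:E).
Proof.
move=> [mu' iu] [mv iv]; have iuv := integrableD mA iu iv.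
apply: le_integrable iuv => //.
  by apply/measurable_EFinP; exact: measurable_funM.
move=> x _; rewrite /= lee_fin [leRHS]ger0_norm ?addr_ge0 ?sqr_ge0//.
rewrite ler_norml; apply/andP; split; nra.
Qed.

Lemma sqint0 : sqint (fun=> 0).
Proof.
split; first exact: measurable_cst.
under eq_fun do rewrite expr0n; exact: integrable0.
Qed.

Lemma sqintD u v : sqint u -> sqint v -> sqint (fun x => u x + v x).
Proof.
move=> su sv; have [mu' iu] := su; have [mv iv] := sv.
split; first exact: measurable_funD.
have h := integrableD mA (integrableD mA iu iv) (integrableZl mA 2 (sqintM su sv)).
apply: eq_integrable h => // x _ /=.
by rewrite -EFinM -!EFinD; congr EFin; ring.
Qed.

Lemma sqintZ (k : R) u : sqint u -> sqint (fun x => k * u x).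
Proof.
move=> [mu' iu]; split; first exact: measurable_funM.
apply: eq_integrable (integrableZl mA (k ^+ 2) iu) => // x _.
by rewrite exprMn.
Qed.

Lemma sqintB u v : sqint u -> sqint v -> sqint (fun x => u x - v x).
Proof.
move=> su sv; have := sqintD su (sqintZ (-1) sv).
by under eq_fun do rewrite mulN1r.
Qed.

Lemma subspace_sqint : subspace (sqint : set (T -> R)).
Proof.
split; first exact: sqint0.
- by move=> u v su sv; exact: sqintD.
- by move=> k u su; exact: sqintZ.
Qed.

Lemma dot_psd : psd_form (sqint : set (T -> R)) dot.
Proof.
split.
- by move=> u v su sv; apply: eq_Rintegral => x _; rewrite mulrC.
- move=> u v w su sv sw; rewrite /dot -RintegralD//; try exact: sqintM.
  by apply: eq_Rintegral => x _; rewrite mulrDl.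
- move=> k u v su sv; rewrite /dot -RintegralZl//; last exact: sqintM.
  by apply: eq_Rintegral => x _; rewrite mulrA.
- by move=> u su; apply: Rintegral_ge0 => x _; rewrite -expr2 sqr_ge0.
Qed.

Lemma dotC u v : dot u v = dot v u.
Proof. by apply: eq_Rintegral => x _; rewrite mulrC. Qed.

Lemma dot_EFin u : sqint u -> (dot u u)%:E = (\int[mu]_(x in A) (u x ^+ 2)%:E)%E.
Proof.
move=> [_ iu]; rewrite /dot /Rintegral fineK; last first.
  exact: (integrable_fin_num mA).
by apply: eq_integral => x _; rewrite expr2.
Qed.

Lemma dot_cauchy_schwarz u v : sqint u -> sqint v ->
  dot u v ^+ 2 <= dot u u * dot v v.
Proof. by move=> su sv; apply: (form_cauchy_schwarz subspace_sqint dot_psd). Qed.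

Lemma dotBl u v w : sqint u -> sqint v -> sqint w ->
  dot (fun x => u x - v x) w = dot u w - dot v w.
Proof. exact: (formBl subspace_sqint dot_psd). Qed.

Lemma sqint_cst (c : R) : (mu A < +oo)%E -> sqint (cst c).
Proof.
move=> finA; split; first exact: measurable_cst.
apply: (@measurable_bounded_integrable _ _ _ mu (fun=> c ^+ 2)) => //.
exact: bounded_cst.
Qed.

Lemma sqint_integrable u : (mu A < +oo)%E -> sqint u -> mu.-integrable A (EFin \o u).
Proof.
move=> finA su; apply: eq_integrable (sqintM su (sqint_cst 1 finA)) => // x _.
by rewrite /= mulr1.
Qed.

(** The bound |t| <= 2^-k + 2^k t^2 makes the increments absolutely summable. *)
Lemma bounded_increments_cvg (a : nat -> R) (G : R) :
  (forall N, \sum_(k < N) 2 ^+ k * (a k.+1 - a k) ^+ 2 <= G) -> cvgn a.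
Proof.
move=> aG.
have -> : a = (fun n => a 0%N + series (telescope a) n).
  by apply/funext => n; rewrite telescopeK/= addrC subrK.
apply: is_cvgD; first exact: is_cvg_cst.
apply: normed_cvg; apply: nondecreasing_is_cvgn.
  by apply: nondecreasing_series => n _ _ /=; exact: normr_ge0.
exists (2 + G) => _ [n _ <-].
have -> : [normed series (telescope a)] n = \sum_(k < n) `|telescope a k|.
  by rewrite -(big_mkord xpredT (fun k => `|telescope a k|)).
apply: le_trans (_ : \sum_(k < n) (2^-1 ^+ k + 2 ^+ k * (a k.+1 - a k) ^+ 2) <= _).
  apply: ler_sum => k _; rewrite /telescope exprVn.
  set t := 2 ^+ k; have t0 : 0 < t by rewrite exprn_gt0.
  rewrite -(@real_normK _ (a k.+1 - a k)) ?num_real//.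
  set x := `|_|; have x0 : 0 <= x by exact: normr_ge0.
  rewrite -subr_ge0 (_ : _ - _ = ((t * x - 1) ^+ 2 + t * x) / t); last first.
    by field; rewrite gt_eqF.
  apply: divr_ge0; last exact: ltW.
  by apply: addr_ge0; [exact: sqr_ge0|apply: mulr_ge0 => //; exact: ltW].
rewrite big_split/= lerD//; last exact: aG.
have -> : \sum_(k < n) 2^-1 ^+ k = 2 - 2 * 2^-1 ^+ n :> R.
  elim: n => [|n IHn]; first by rewrite big_ord0 expr0 mulr1 subrr.
  by rewrite big_ord_recr/= IHn exprS; field.
by rewrite gerBl mulr_ge0// exprn_ge0// invr_ge0.
Qed.

(** Riesz-Fischer.  Along a geometric Cauchy sequence the weighted sum of the
    squared increments is integrable, hence finite almost everywhere, where it
    forces pointwise convergence. *)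
Lemma sqint_complete (u : nat -> T -> R) (C : R) : (forall n, sqint (u n)) ->
  (forall n m, (n <= m)%N ->
    dot (fun x => u n x - u m x) (fun x => u n x - u m x) <= C * 4^-1 ^+ n) ->
  exists2 v, sqint v &
    forall n, dot (fun x => u n x - v x) (fun x => u n x - v x) <= C * 4^-1 ^+ n.
Proof.
move=> su uC.
pose f k x : \bar R := (2 ^+ k * (u k.+1 x - u k x) ^+ 2)%:E.
have f0 k x : A x -> (0 <= f k x)%E.
  by move=> _; rewrite /f lee_fin mulr_ge0 ?sqr_ge0 ?exprn_ge0.
have mu' n : measurable_fun A (u n) by case: (su n).
have mf k : measurable_fun A (f k).
  apply/measurable_EFinP; apply: measurable_funM => //.
  by apply: measurable_funX; exact: measurable_funB.
pose G x := (\sum_(k <oo) f k x)%E.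
have mG : measurable_fun A G.
  by apply: ge0_emeasurable_sum => // k x Ax _; exact: f0.
have G0 x : A x -> (0 <= G x)%E.
  by move=> Ax; apply: nneseries_ge0 => k _ _; exact: f0.
have C0 : 0 <= C.
  have := uC 0%N 0%N (leqnn _); rewrite expr0 mulr1; apply: le_trans.
  by apply: Rintegral_ge0 => x _; rewrite -expr2 sqr_ge0.
have intG : (\int[mu]_(x in A) G x <= (C * 2)%:E)%E.
  rewrite integral_nneseries//.
  apply: lime_le; first by apply: is_cvg_nneseries => k _ _; apply: integral_ge0 => x; exact: f0.
  apply: nearW => N.
  apply: le_trans (_ : (\sum_(0 <= k < N) (C * 2^-1 ^+ k)%:E <= _)%E).
    apply: lee_sum => k _.
    have -> : (\int[mu]_(x in A) f k x =
        (2 ^+ k * dot (fun x => u k x - u k.+1 x) (fun x => u k x - u k.+1 x))%:E)%E.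
      rewrite EFinM dot_EFin; last exact: sqintB.
      rewrite -ge0_integralZl//; first last.
      - by move=> x _; rewrite lee_fin sqr_ge0.
      - apply/measurable_EFinP.
        by apply: measurable_funX; exact: measurable_funB.
      apply: eq_integral => x _; rewrite /f -EFinM; congr (_ * _)%:E.
      by rewrite -sqrrN opprB.
    rewrite lee_fin; apply: le_trans (ler_wpM2l _ (uC k k.+1 (leqnSn k))) _.
      by rewrite exprn_ge0.
    rewrite mulrCA; apply: ler_wpM2l => //.
    by rewrite -exprMn (_ : 2 * 4^-1 = 2^-1 :> R)//; field.
  rewrite sumEFin lee_fin -mulr_sumr ler_wpM2l// big_mkord.
  have -> : \sum_(k < N) 2^-1 ^+ k = 2 - 2 * 2^-1 ^+ N :> R.
    elim: N => [|n IHn]; first by rewrite big_ord0 expr0 mulr1 subrr.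
    by rewrite big_ord_recr/= IHn exprS; field.
  by rewrite gerBl mulr_ge0// exprn_ge0// invr_ge0.
have iG : mu.-integrable A G.
  apply/integrableP; split=> //.
  rewrite (eq_integral G); last by move=> x /set_mem Ax; rewrite gee0_abs// G0.
  by apply: le_lt_trans intG _; rewrite ltry.
have aeG := integrable_ae mA iG.
(* w is u cut off where the weighted sum G is infinite *)
pose E := [set x | G x \is a fin_num].
have mE : measurable (A `&` E) by exact: emeasurable_fin_num.
pose w n x := u n x * \1_(A `&` E) x.
have wE n x : A x -> E x -> w n x = u n x.
  by move=> Ax Ex; rewrite /w indicE mem_set ?mulr1.
have mw n : measurable_fun A (w n).
  by apply: measurable_funM => //; exact: measurable_indic.
have cw x : cvgn (w^~ x).
  have [[Ax Ex]|nE] := pselect ((A `&` E) x); last first.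
    rewrite /w; under eq_fun do rewrite indicE memNset// mulr0.
    exact: is_cvg_cst.
  have -> : w^~ x = u^~ x by apply/funext => n; exact: wE.
  apply: (@bounded_increments_cvg _ (fine (G x))) => N.
  rewrite -lee_fin fineK// -sumEFin -(big_mkord xpredT (fun k => f k x)).
  by apply: nneseries_lim_ge => k _ _; exact: f0.
pose v x := limn (w^~ x).
have wv x : w^~ x @ \oo --> v x by exact: cw.
have mv : measurable_fun A v by apply: (measurable_fun_cvg mw) => x _; exact: wv.
have key n : (\int[mu]_(x in A) ((u n x - v x) ^+ 2)%:E <= (C * 4^-1 ^+ n)%:E)%E.
  pose g m x := ((u n x - w m x) ^+ 2)%:E.
  have mg m : measurable_fun A (g m).
    by apply/measurable_EFinP; apply: measurable_funX; exact: measurable_funB.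
  have g0 m x : A x -> (0 <= g m x)%E by move=> _; rewrite lee_fin sqr_ge0.
  have -> : (\int[mu]_(x in A) ((u n x - v x) ^+ 2)%:E =
             \int[mu]_(x in A) limn_einf (g^~ x))%E.
    apply: eq_integral => x _.
    have cg : (g^~ x) @ \oo --> ((u n x - v x) ^+ 2)%:E.
      apply: cvg_EFin; first exact: nearW.
      rewrite (_ : _ \o _ = fun m => (u n x - w m x) * (u n x - w m x)); last first.
        by apply/funext => m /=; rewrite expr2.
      rewrite expr2; have h : (fun m => u n x - w m x) @ \oo --> u n x - v x.
        by apply: cvgB; [exact: cvg_cst|exact: wv].
      exact: (cvgM h h).
    rewrite is_cvg_limn_einfE; last by apply/cvg_ex; exists ((u n x - v x) ^+ 2)%:E.
    by apply/esym/cvg_lim.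
  apply: le_trans (fatou mu mA mg g0) _.
  rewrite limn_einf_lim; apply: lime_le; first exact: is_cvg_einfs.
  exists n => // m /= nm.
  apply: le_trans (_ : (\int[mu]_(x in A) g m x <= _)%E).
    by apply: ereal_inf_lbound; exists m => //=.
  have -> : (\int[mu]_(x in A) g m x =
             \int[mu]_(x in A) ((u n x - u m x) ^+ 2)%:E)%E.
    apply: ae_eq_integral => //.
      by apply/measurable_EFinP; apply: measurable_funX; exact: measurable_funB.
    apply: filterS aeG => x h Ax; rewrite /g wE//; exact: h.
  rewrite -(dot_EFin (sqintB (su n) (su m))) lee_fin; exact: uC.
have sd n : sqint (fun x => u n x - v x).
  apply/sqintP; split; first exact: measurable_funB.
  by apply: le_lt_trans (key n) _; rewrite ltry.
exists v; last by move=> n; rewrite -lee_fin dot_EFin.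
have := sqintB (su 0%N) (sd 0%N).
by under eq_fun do rewrite subKr.
Qed.

End square_integrable_functions.

Lemma sqintS d (T : measurableType d) (R : realType) (mu : {measure set T -> \bar R})
    (Q S : set T) (v : T -> R) : measurable Q -> measurable S -> Q `<=` S ->
  sqint mu S v -> sqint mu Q v.
Proof.
move=> mQ mS QS [mv iv]; split; first exact: measurable_funS mv.
exact: integrableS iv.
Qed.

Section fundamental_lemma.
Context (R : realType) (d : nat).
Notation mu := (lebesgue_rV R d).
Implicit Types (U A : set 'rV[R]_d) (a b x : 'rV[R]_d) (w : 'rV[R]_d -> R).

(** The sets over which the integral of w vanishes form a Dynkin system that
    contains the boxes, hence all measurable sets. *)
Lemma ae_eq0_oboxes U w : open U -> mu.-integrable setT (EFin \o w) ->
  (forall a b, cbox a b `<=` U -> (\int[mu]_(x in obox a b) (w x)%:E = 0)%E) ->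
  {ae mu, forall x, U x -> w x = 0}.
Proof.
move=> oU iw w0; apply: ae_local_rV => x Ux.
have /nbhs_ballP[r /= r0 xrU] : nbhs x U by apply: open_nbhs_nbhs.
have r20 : 0 < r / 2 by rewrite divr_gt0.
exists (r / 2) => //; rewrite ball_obox//.
set a := x - _; set b := x + _.
have abU : cbox a b `<=` U.
  move=> z h; apply: xrU; apply/ball_rVE => // i.
  by have := h i; rewrite !mxE ltr_norml => /andP[? ?]; apply/andP; split; lra.
have mab : measurable (obox a b) by exact: measurable_obox.
have iwA A : measurable A -> mu.-integrable A (EFin \o w).
  by move=> mA; apply: integrableS iw.
have fin A : measurable A -> (\int[mu]_(x in A) (w x)%:E)%E \is a fin_num.
  by move=> mA; apply: integrable_fin_num => //; exact: iwA.
have w_ae : ae_eq mu (obox a b) (EFin \o w) (cst 0%E).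
  apply: integral_ae_eq => //; first exact: iwA.
  move=> E Eab mE; rewrite integral0.
  rewrite -(setIidr Eab); move: {Eab} E mE.
  suff H : forall E, <<s @oboxes R d >> E -> measurable E /\
      (\int[mu]_(x in obox a b `&` E) (w x)%:E = 0)%E.
    by move=> E; rewrite measurable_rV_oboxes => /H[].
  apply: (dynkin_induction (@measurable_rV_oboxes R d) (@oboxes_setI R d)).
  - by split => //; rewrite setIT w0.
  - move=> _ [[p q] _ <-] /=; split; first exact: measurable_obox.
    rewrite obox_setI; apply: w0; apply: subset_trans abU; exact: cbox_setI_sub.
  - move=> S mS [_ hS]; split; first exact: measurableC.
    have := @integral_setU _ _ _ mu (obox a b `&` S) (obox a b `&` ~` S) (EFin \o w).
    rewrite -setIUr setUv setIT w0// hS add0e => <- //.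
    + exact: measurableI.
    + by apply: measurableI => //; exact: measurableC.
    + by apply: measurable_int; exact: iwA.
    + by apply/disj_setPS => y [[_ Sy] [_ nSy]].
  - move=> F mF tF hF; split; first by apply: bigcup_measurable => k _.
    rewrite setI_bigcupr integral_bigcup//.
    + by rewrite eseries0// => k _ _; case: (hF k).
    + move/trivIsetP : tF => tF; apply/trivIsetP => i j _ _ ij.
      by rewrite setIACA setIid tF// setI0.
    + by move=> k; exact: measurableI.
    + by apply: iwA; apply: bigcup_measurable => k _; exact: measurableI.
by apply: filterS w_ae => z h zab; have [] := h zab.
Qed.

Lemma integrableMbounded w (f : 'rV[R]_d -> R) : mu.-integrable setT (EFin \o w) ->
  measurable_fun setT f -> (exists M : R, forall x, `|f x| <= M) ->
  mu.-integrable setT (fun x => (w x * f x)%:E).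
Proof.
move=> iw mf [M fM]; have := @integrableMl _ _ _ mu setT measurableT (EFin \o w) f iw mf.
have bf : [bounded f x | x in setT].
  exists M; split; first exact: num_real.
  by move=> M' MM' x _; apply: le_trans (fM x) _; exact: ltW.
by move=> /(_ bf) h; apply: eq_integrable h => // x _ /=; rewrite EFinM.
Qed.

Lemma measurable_box_bump n a b : measurable_fun setT (box_bump n a b).
Proof. by apply: continuous_measurable_fun_rV; exact: cd_continuous (cd_box_bump 0 n a b). Qed.

Lemma integral_obox_bump_lim w a b : mu.-integrable setT (EFin \o w) ->
  (\int[mu]_x (w x * box_bump n a b x)%:E @[n --> \oo] -->
   \int[mu]_(x in obox a b) (w x)%:E)%E.
Proof.
move=> iw; have mw : measurable_fun setT w by apply/measurable_EFinP; exact: (measurable_int mu).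
rewrite integral_mkcond.
suff [_ _] : [/\ mu.-integrable setT ((EFin \o w) \_ (obox a b)),
  (\int[mu]_x `|(w x * box_bump n a b x)%:E - ((EFin \o w) \_ (obox a b)) x| @[n --> \oo] --> 0)%E &
  (\int[mu]_x (w x * box_bump n a b x)%:E @[n --> \oo] --> \int[mu]_x ((EFin \o w) \_ (obox a b)) x)%E] by [].
apply: (@dominated_convergence _ _ R mu setT measurableT
  (fun n x => (w x * box_bump n a b x)%:E) ((EFin \o w) \_ (obox a b))
  (fun x => `|(w x)%:E|%E)).
- move=> n; apply/measurable_EFinP; apply: measurable_funM => //.
  exact: measurable_box_bump.
- apply/(measurable_restrictT _ _).1; first exact: measurable_obox.
  by apply: measurable_funTS; apply/measurable_EFinP.
- apply: aeW => x _; rewrite restrict_EFin; apply: cvg_EFin; first exact: nearW.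
  rewrite patchE (_ : (if x \in obox a b then w x else 0) = w x * \1_(obox a b) x).
    by apply: cvgMr; exact: box_bump_cvg.
  by rewrite indicE; case: ifPn; rewrite ?mulr1 ?mulr0.
- by move/integrable_abse : iw.
- apply: aeW => x n _; rewrite /= lee_fin normrM.
  by rewrite (ger0_norm (box_bump_ge0 _ _ _ _)) ler_piMr// box_bump_le1.
Qed.

(** The bumps of a box converge boundedly to its indicator, which reduces the
    fundamental lemma of the calculus of variations to boxes. *)
Lemma fundamental_lemma U w : open U -> mu.-integrable setT (EFin \o w) ->
  (forall n a b, cbox a b `<=` U -> \int[mu]_x (w x * box_bump n a b x) = 0) ->
  {ae mu, forall x, U x -> w x = 0}.
Proof.
move=> oU iw w0; apply: ae_eq0_oboxes => // a b abU.
have := integral_obox_bump_lim (a := a) (b := b) iw.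
rewrite (_ : (fun n => _) = cst 0%E); last first.
  apply/funext => n.
  have i : mu.-integrable setT (fun x => (w x * box_bump n a b x)%:E).
    apply: integrableMbounded => //; first exact: measurable_box_bump.
    by exists 1 => x; rewrite ger0_norm ?box_bump_ge0 ?box_bump_le1.
  by rewrite -[LHS]fineK ?(integrable_fin_num measurableT i)//; congr EFin; exact: w0.
by move=> h; apply/esym; apply: cvg_unique h; [exact: ereal_hausdorff|exact: cvg_cst].
Qed.

End fundamental_lemma.

(** * Weak partial derivatives *)

Section compact_support.
Context (R : realType) (d : nat).
Notation mu := (lebesgue_rV R d).
Local Notation e_ i := (delta_mx ord0 i : 'rV[R]_d).
Implicit Types (f g : 'rV[R]_d -> R) (K A B : set 'rV[R]_d).

Lemma norm_rV_le (x : 'rV[R]_d) (M : R) : 0 <= M ->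
  `|x| <= M <-> forall i, `|x ord0 i| <= M.
Proof.
move=> M0; rewrite [in X in X <-> _]/Num.norm/= mx_normrE; split.
  move=> /bigmax_leP[_ h] i; exact: (h (ord0, i)).
by move=> h; apply/bigmax_leP; split=> // -[a b] _ /=; rewrite (ord1 a).
Qed.

Definition centred_box (M : R) : set 'rV[R]_d := cbox (const_mx (- M)) (const_mx M).

Lemma centred_boxP M x : centred_box M x <-> forall i, `|x ord0 i| <= M.
Proof.
by split=> h i; have := h i; rewrite !mxE ler_norml.
Qed.

Lemma bounded_centred_box A : bounded_set A -> exists2 M : R, 0 < M & A `<=` centred_box M.
Proof.
move=> [M [_ AM]]; exists (`|M| + 1); first by rewrite ltr_wpDl.
move=> x Ax; apply/centred_boxP; apply/norm_rV_le; first by rewrite addr_ge0.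
apply: AM Ax; apply: le_lt_trans (ler_norm M) _; by rewrite ltrDl.
Qed.

Lemma measurable_cbox a b : measurable (cbox a b : set 'rV[R]_d).
Proof.
apply: closed_measurable_rV; apply: compact_closed; first exact: norm_hausdorff.
exact: compact_cbox.
Qed.

Lemma lebesgue_centred_box M : (mu (centred_box M) < +oo)%E.
Proof.
apply: (@le_lt_trans _ _ (mu (obox (const_mx (- (`|M| + 1))) (const_mx (`|M| + 1))))).
  apply: le_measure; rewrite ?inE; [exact: measurable_cbox|exact: measurable_obox|].
  move=> x h i; have := h i; rewrite !mxE => /andP[? ?]; have := ler_norm M.
  by move=> ?; apply/andP; split; lra.
rewrite lebesgue_obox ?ltry// => i; rewrite !mxE.
by have := normr_ge0 M; lra.
Qed.

Lemma bounded_measure_finite A : measurable A -> bounded_set A -> (mu A < +oo)%E.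
Proof.
move=> mA /bounded_centred_box[M _ AM].
apply: le_lt_trans (lebesgue_centred_box M); apply: le_measure => //; rewrite ?inE//.
exact: measurable_cbox.
Qed.

Lemma compact_support_bounded f K : continuous f -> compact K ->
  (forall x, ~ K x -> f x = 0) -> exists2 M : R, 0 <= M & forall x, `|f x| <= M.
Proof.
move=> cf cK f0.
have : compact (f @` K).
  by apply: continuous_compact => //; apply: continuous_subspaceT.
move=> /compact_bounded[M [_ hM]]; exists (`|M| + 1); first by rewrite addr_ge0.
move=> x; have [Kx|nKx] := pselect (K x); last by rewrite f0// normr0 addr_ge0.
apply: hM; last by exists x.
by apply: le_lt_trans (ler_norm M) _; rewrite ltrDl.
Qed.

Lemma compact_support_sqint f K A : measurable A -> continuous f -> compact K ->
  (forall x, ~ K x -> f x = 0) -> sqint mu A f.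
Proof.
move=> mA cf cK f0; have [M M0 fM] := compact_support_bounded cf cK f0.
have mf := continuous_measurable_fun_rV cf.
have [N N0 KN] := bounded_centred_box (compact_bounded cK).
split; first exact: measurable_funTS.
apply: (@integrableS _ _ _ mu setT) => //.
have mN := measurable_cbox (const_mx (- N)) (const_mx N).
have i1 : mu.-integrable (centred_box N) (EFin \o (fun x => f x ^+ 2)).
  apply: measurable_bounded_integrable => //; first exact: lebesgue_centred_box.
    by apply: measurable_funTS; exact: measurable_funX.
  exists (M ^+ 2); split; first exact: num_real.
  move=> y My x _; apply: le_trans (ltW My).
  by rewrite normrX lerXn2r ?nnegrE.
rewrite (_ : (fun x => _) = (EFin \o (fun x => f x ^+ 2)) \_ (centred_box N)).
  by apply/integrable_restrict => //; rewrite setTI.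
apply/funext => x; rewrite patchE; case: ifPn => // /negP xN.
rewrite f0 ?expr0n// => /KN h; apply: xN; exact/mem_set.
Qed.

Lemma compact_support_integrable f K A : measurable A -> continuous f -> compact K ->
  (forall x, ~ K x -> f x = 0) -> mu.-integrable A (EFin \o f).
Proof.
move=> mA cf cK f0.
have [N N0 KN] := bounded_centred_box (compact_bounded cK).
have mN := measurable_cbox (const_mx (- N)) (const_mx N).
have s1 : sqint mu setT (\1_(centred_box N) : 'rV[R]_d -> R).
  split; first exact: measurable_indic.
  rewrite (_ : (fun x => _) = (cst 1%E) \_ (centred_box N)).
    apply/integrable_restrict => //; rewrite setTI.
    apply: (@measurable_bounded_integrable _ _ _ mu (cst 1)) => //.
      exact: lebesgue_centred_box.
    exact: bounded_cst.
  apply/funext => x; rewrite patchE indicE; case: ifP => _; rewrite ?expr1n// expr0n//.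
apply: (@integrableS _ _ _ mu setT) => //.
have sf := compact_support_sqint measurableT cf cK f0.
apply: eq_integrable (sqintM measurableT sf s1) => // x _ /=.
rewrite indicE; case: (boolP (x \in _)); rewrite ?mulr1// mulr0 => /negP xN.
by rewrite f0// => /KN h; apply: xN; exact/mem_set.
Qed.

Lemma derive_compact_support f K v : compact K -> (forall x, ~ K x -> f x = 0) ->
  forall x, ~ K x -> 'D_v f x = 0.
Proof.
move=> cK f0 x nKx.
have oK : open (~` K).
  by apply: closed_openC; apply: compact_closed => //; exact: norm_hausdorff.
have e : \near x, f x = cst 0 x.
  have : nbhs x (~` K) by apply: open_nbhs_nbhs.
  by apply: filterS => y; exact: f0.
by rewrite (near_eq_derive _ e) derive_cst.
Qed.

Lemma quotient_line f (x v : 'rV[R]_d) (t : R) :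
  (fun h : R => h^-1 *: (f (h *: v + (x + t *: v)) - f (x + t *: v))) =
  (fun h : R => h^-1 *: (f (x + (h *: 1 + t) *: v) - f (x + t *: v))).
Proof.
apply/funext => h; congr (_ *: (f _ - _)).
have -> : h *: (1 : R) = h by rewrite /GRing.scale/= mulr1.
by rewrite scalerDl addrCA.
Qed.

Lemma is_derive_line f (x v : 'rV[R]_d) (t : R) : derivable f (x + t *: v) v ->
  is_derive t (1 : R) (fun s : R => f (x + s *: v)) ('D_v f (x + t *: v)).
Proof.
move=> df; have E := quotient_line f x v t.
have dd : derivable (fun s : R => f (x + s *: v)) t (1 : R).
  by rewrite /derivable; rewrite /derivable E in df.
by apply: (DeriveDef dd); rewrite /derive E.
Qed.

Lemma le_increment f (v : 'rV[R]_d) (M t : R) (x : 'rV[R]_d) : 0 < t ->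
  (forall y, derivable f y v) -> (forall y, `|'D_v f y| <= M) ->
  `|f (x + t *: v) - f x| <= M * t.
Proof.
move=> t0 df dfM.
have dl s := is_derive_line (df (x + s *: v)).
have [|c _] := @MVT R (fun s : R => f (x + s *: v)) (fun s : R => 'D_v f (x + s *: v)) 0 t t0.
  apply: continuous_subspaceT => s; apply/differentiable_continuous/derivable1_diffP.
  by case: (dl s).
rewrite scale0r addr0 subr0 => ->; rewrite normrM ler_pM//.
by rewrite ger0_norm// ltW.
Qed.

(** Translation invariance makes the integrals of the difference quotients
    vanish. *)
Lemma integral_derive0 f K i : continuous f -> (forall x, derivable f x (e_ i)) ->
  continuous ('D_(e_ i) f) -> compact K -> (forall x, ~ K x -> f x = 0) ->
  \int[mu]_x 'D_(e_ i) f x = 0.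
Proof.
move=> cf df cdf cK f0.
have df0 := derive_compact_support (e_ i) cK f0.
have [M M0 dfM] := compact_support_bounded cdf cK df0.
have [N N0 KN] := bounded_centred_box (compact_bounded cK).
pose q n x := n.+1%:R * (f (x + n.+1%:R^-1 *: e_ i) - f x).
have mf := continuous_measurable_fun_rV cf.
have intf : mu.-integrable setT (EFin \o f).
  exact: compact_support_integrable cf cK f0.
have intq n : \int[mu]_x q n x = 0.
  have i1 : mu.-integrable setT (EFin \o (fun x => f (x + n.+1%:R^-1 *: e_ i))).
    exact: (integrable_shift _ intf).
  rewrite RintegralZl//; last by apply: (integrableB measurableT i1 intf).
  by rewrite RintegralB// Rintegral_shift// subrr mulr0.
have mN := measurable_cbox (const_mx (- (N + 1))) (const_mx (N + 1)).
have mq n : measurable_fun setT (q n).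
  apply: measurable_funM => //; apply: measurable_funB => //.
  exact: (measurableT_comp mf (measurable_shift _)).
have qM n x : `|q n x| <= M * \1_(centred_box (N + 1)) x.
  have n0 : 0 < n.+1%:R^-1 :> R by rewrite invr_gt0.
  have [xN|xN] := pselect (centred_box (N + 1) x); last first.
    rewrite indicE memNset// mulr0 /q f0; last first.
      move=> /KN /centred_boxP h; apply: xN; apply/centred_boxP => j.
      have := h j; rewrite !mxE eqxx/= => hj.
      rewrite -[x ord0 j](addrK (n.+1%:R^-1 * (j == i)%:R)).
      apply: le_trans (ler_normB _ _) _; apply: lerD => //.
      rewrite normrM (ger0_norm (ltW n0)) (ger0_norm (ler0n _ _)).
      by case: (j == i); rewrite ?mulr1 ?mulr0// invf_le1// ler1n.
    rewrite f0 ?subrr ?mulr0 ?normr0// => /KN /centred_boxP h; apply: xN.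
    by apply/centred_boxP => j; apply: le_trans (h j) _; rewrite lerDl.
  rewrite indicE mem_set// mulr1 /q normrM ger0_norm//.
  have := le_increment x n0 df dfM.
  by rewrite ler_pdivlMr// mulrC.
have qcvg x : q n x @[n --> \oo] --> 'D_(e_ i) f x.
  have cv : (fun h : R => h^-1 *: (f (h *: e_ i + x) - f x)) @ 0^' --> 'D_(e_ i) f x by exact: df.
  have hn : (fun n => n.+1%:R^-1 : R) @ \oo --> (0 : R)^'.
    move=> P hP.
    have H : \forall n \near \oo, (@harmonic R n != 0 -> P (@harmonic R n)) := @cvg_harmonic R _ hP.
    suff : \forall n \near \oo, P (@harmonic R n) by [].
    by apply: filterS H => n; apply; apply: lt0r_neq0; exact: harmonic_gt0.
  have := cvg_comp _ _ hn cv.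
  apply: cvg_trans; apply: near_eq_cvg; apply: nearW => n /=.
  by rewrite /q invrK [x + _]addrC.
have [_ _ cvi] : [/\ mu.-integrable setT (fun x => ('D_(e_ i) f x)%:E),
  (\int[mu]_x `|(q n x)%:E - ('D_(e_ i) f x)%:E| @[n --> \oo] --> 0)%E &
  (\int[mu]_x (q n x)%:E @[n --> \oo] --> \int[mu]_x ('D_(e_ i) f x)%:E)%E].
  apply: (@dominated_convergence _ _ R mu setT measurableT (fun n x => (q n x)%:E)
    (fun x => ('D_(e_ i) f x)%:E) (fun x => (M * \1_(centred_box (N + 1)) x)%:E)).
  - by move=> n; exact/measurable_EFinP.
  - by apply/measurable_EFinP; exact: continuous_measurable_fun_rV.
  - by apply: aeW => x _; apply: cvg_EFin; [exact: nearW|exact: qcvg].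
  - rewrite (_ : (fun x => _) = (cst M%:E) \_ (centred_box (N + 1))).
      apply/integrable_restrict => //; rewrite setTI.
      apply: (@measurable_bounded_integrable _ _ _ mu (cst M)) => //.
        exact: lebesgue_centred_box.
      exact: bounded_cst.
    by apply/funext => x; rewrite patchE indicE; case: ifP => _; rewrite ?mulr1 ?mulr0.
  - by apply: aeW => x n _; rewrite /= lee_fin.
have cvi0 : (\int[mu]_x (q n x)%:E @[n --> \oo] --> 0)%E.
  rewrite (_ : (fun n => _) = cst 0%E); first exact: cvg_cst.
  apply/funext => n; rewrite -[LHS]fineK; first by congr EFin; exact: intq.
  apply: integrable_fin_num => //.
  have i1 : mu.-integrable setT (EFin \o (fun x => f (x + n.+1%:R^-1 *: e_ i))).
    exact: (integrable_shift _ intf).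
  exact: (integrableZl measurableT n.+1%:R (integrableB measurableT i1 intf)).
by rewrite /Rintegral (cvg_unique _ cvi cvi0).
Qed.

End compact_support.

Section weak_derivatives.
Context (R : realType) (d : nat) (A : set 'rV[R]_d).
Notation mu := (lebesgue_rV R d).
Local Notation e_ i := (delta_mx ord0 i : 'rV[R]_d).
Hypotheses (oA : open A) (finA : (mu A < +oo)%E).
Implicit Types (f u v g : 'rV[R]_d -> R) (i : 'I_d).

Let mA : measurable A. Proof. exact: open_measurable_rV. Qed.

Lemma test_functionP f : test_function A f ->
  continuous f /\ forall i, (forall x, derivable f x (e_ i)) /\ test_function A ('D_(e_ i) f).
Proof.
move=> [cf [K [cK KA f0]]]; split; first exact: cd_continuous (cf 0%N).
move=> i; split; first by have [_ /(_ i)[]] := cf 1%N.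
split; first by move=> k; have [_ /(_ i)[]] := cf k.+1.
by exists K; split=> //; exact: derive_compact_support.
Qed.

Lemma test_function_sqint f : test_function A f -> sqint mu A f.
Proof.
move=> tf; have [cf _] := test_functionP tf.
have [_ [K [cK _ f0]]] := tf.
exact: compact_support_sqint cf cK f0.
Qed.

Lemma test_function_out f : test_function A f -> forall x, ~ A x -> f x = 0.
Proof. by move=> [_ [K [_ KA f0]]] x nAx; apply: f0 => /KA. Qed.

Lemma weak_partialD i u v gu gv : sqint mu A u -> sqint mu A v ->
  sqint mu A gu -> sqint mu A gv ->
  is_weak_partial A i u gu -> is_weak_partial A i v gv ->
  is_weak_partial A i (fun x => u x + v x) (fun x => gu x + gv x).
Proof.
move=> su sv sgu sgv wu wv f tf; have [_ /(_ i)[_ tdf]] := test_functionP tf.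
have [_ aD _ _] := dot_psd mu mA.
have sdf := test_function_sqint tdf; have sf := test_function_sqint tf.
apply: (etrans (aD u v _ su sv sdf)).
apply: (etrans _ (congr1 -%R (esym (aD gu gv _ sgu sgv sf)))).
by rewrite opprD; congr (_ + _); [exact: wu|exact: wv].
Qed.

Lemma weak_partialZ i (k : R) u gu : sqint mu A u -> sqint mu A gu ->
  is_weak_partial A i u gu ->
  is_weak_partial A i (fun x => k * u x) (fun x => k * gu x).
Proof.
move=> su sgu wu f tf; have [_ /(_ i)[_ tdf]] := test_functionP tf.
have [_ _ aZ _] := dot_psd mu mA.
have sdf := test_function_sqint tdf; have sf := test_function_sqint tf.
apply: (etrans (aZ k u _ su sdf)).
apply: (etrans _ (congr1 -%R (esym (aZ k gu _ sgu sf)))).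
by rewrite -mulrN; congr (_ * _); exact: wu.
Qed.

(** Both sides of the defining identity, tested against a fixed function, are
    continuous for the L2 norm by the Cauchy-Schwarz inequality. *)
Lemma weak_partial_limit i (u g : nat -> 'rV[R]_d -> R) v h (C : R) :
  (forall n, sqint mu A (u n)) -> (forall n, sqint mu A (g n)) ->
  sqint mu A v -> sqint mu A h -> (forall n, is_weak_partial A i (u n) (g n)) ->
  (forall n, dot mu A (fun x => u n x - v x) (fun x => u n x - v x) <= C * 4^-1 ^+ n) ->
  (forall n, dot mu A (fun x => g n x - h x) (fun x => g n x - h x) <= C * 4^-1 ^+ n) ->
  is_weak_partial A i v h.
Proof.
move=> su sg sv sh w hu hg f tf; have [_ /(_ i)[_ tdf]] := test_functionP tf.
have sdf := test_function_sqint tdf; have sf := test_function_sqint tf.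
have [_ _ _ dot0] := dot_psd mu mA.
have d1 := dot0 _ sdf; have d2 := dot0 _ sf.
suff : (dot mu A v ('D_(e_ i) f) + dot mu A h f) ^+ 2 <= 0.
  move=> le0; apply/eqP; rewrite -subr_eq0 opprK -sqrf_eq0 eq_le le0.
  exact: sqr_ge0.
apply: (@geom_le0 _ _ (2 * C * (dot mu A ('D_(e_ i) f) ('D_(e_ i) f) + dot mu A f f))) => n.
have e1 := dotBl mA (su n) sv sdf; have e2 := dotBl mA (sg n) sh sf.
have e3 : dot mu A (u n) ('D_(e_ i) f) = - dot mu A (g n) f := w n f tf.
have c1 := dot_cauchy_schwarz mA (sqintB mA (su n) sv) sdf.
have c2 := dot_cauchy_schwarz mA (sqintB mA (sg n) sh) sf.
have {}c1 := le_trans c1 (ler_wpM2r d1 (hu n)).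
have {}c2 := le_trans c2 (ler_wpM2r d2 (hg n)).
set p := dot mu A (fun x => u n x - v x) ('D_(e_ i) f) in c1 e1.
set q := dot mu A (fun x => g n x - h x) f in c2 e2.
have -> : dot mu A v ('D_(e_ i) f) + dot mu A h f = - (p + q).
  by rewrite e1 e2 e3; ring.
rewrite sqrrN; have : 0 <= (p - q) ^+ 2 by exact: sqr_ge0.
move: c1 c2; move: (dot _ _ ('D__ f) ('D__ f)) (dot mu A f f) (4^-1 ^+ n) => x y z.
by clearbody p q; nra.
Qed.

Lemma sqint_patch_integrable u : sqint mu A u ->
  mu.-integrable setT (EFin \o (u \_ A)).
Proof.
move=> su; rewrite -restrict_EFin; apply/integrable_restrict => //.
by rewrite setTI; exact: sqint_integrable.
Qed.

Lemma Rintegral_patchM u f : \int[mu]_(x in A) (u x * f x) = \int[mu]_x ((u \_ A) x * f x).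
Proof.
rewrite Rintegral_mkcond; apply: eq_Rintegral => x _.
by rewrite !patchE; case: ifP => //; rewrite mul0r.
Qed.

Lemma weak_partial_unique i u g h : sqint mu A g -> sqint mu A h ->
  is_weak_partial A i u g -> is_weak_partial A i u h ->
  {ae mu, forall x, A x -> g x = h x}.
Proof.
move=> sg sh wg wh.
have sgh := sqintB mA sg sh.
have h0 : {ae mu, forall x, A x -> ((fun x => g x - h x) \_ A) x = 0}.
  apply: fundamental_lemma => //; first exact: sqint_patch_integrable.
  move=> n a b abA; have tf := test_box_bump n abA.
  rewrite -Rintegral_patchM; have sf := test_function_sqint tf.
  apply: (etrans (dotBl mA sg sh sf)).
  have e1 : dot mu A u _ = - dot mu A g _ := wg _ tf.
  have e2 : dot mu A u _ = - dot mu A h _ := wh _ tf.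
  by rewrite -[dot mu A g _]opprK -e1 e2 opprK subrr.
apply: filterS h0 => x hx Ax; have := hx Ax; rewrite patchE mem_set//.
by move/eqP; rewrite subr_eq0 => /eqP.
Qed.

Lemma Rintegral_test f : (forall x, ~ A x -> f x = 0) ->
  \int[mu]_(x in A) f x = \int[mu]_x f x.
Proof.
move=> f0; rewrite Rintegral_mkcond; apply: eq_Rintegral => x _.
by rewrite patchE; case: ifPn => // /negP h; rewrite f0// => /mem_set.
Qed.

(** Integration by parts: the derivative of a product with compact support has
    integral zero. *)
Lemma test_function_partial f i : test_function A f -> is_weak_partial A i f ('D_(e_ i) f).
Proof.
move=> tf g tg.
have [cf /(_ i)[df tdf]] := test_functionP tf; have [cdf _] := test_functionP tdf.
have [cg /(_ i)[dg tdg]] := test_functionP tg; have [cdg _] := test_functionP tdg.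
have [_ [K [cK KA f0]]] := tf.
have dfg x : 'D_(e_ i) (fun x => f x * g x) x = f x * 'D_(e_ i) g x + 'D_(e_ i) f x * g x.
  by rewrite [X in _ + X]mulrC; exact: (deriveM (df x) (dg x)).
have h : \int[mu]_x 'D_(e_ i) (fun x => f x * g x) x = 0.
  apply: (@integral_derive0 _ _ _ K).
  - by move=> x; exact: (cvgM (cf x) (cg x)).
  - by move=> x; exact: (derivableM (df x) (dg x)).
  - rewrite (_ : 'D_(e_ i) _ = fun x => f x * 'D_(e_ i) g x + 'D_(e_ i) f x * g x).
      by move=> x; exact: (cvgD (cvgM (cf x) (cdg x)) (cvgM (cdf x) (cg x))).
    by apply/funext.
  - exact: cK.
  - by move=> x nKx; rewrite f0// mul0r.
have sf := test_function_sqint tf; have sg := test_function_sqint tg.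
have sdf := test_function_sqint tdf; have sdg := test_function_sqint tdg.
apply/eqP; rewrite -subr_eq0 opprK -RintegralD//; try exact: sqintM.
rewrite Rintegral_test; first by rewrite -[X in _ == X]h; apply/eqP/eq_Rintegral => x _; rewrite dfg.
move=> x nAx; rewrite (test_function_out tf nAx) (test_function_out tg nAx).
by rewrite mul0r mulr0 addr0.
Qed.

Lemma cst_partial (c : R) i : is_weak_partial A i (cst c) (cst 0).
Proof.
move=> g tg.
have [cg /(_ i)[dg tdg]] := test_functionP tg; have [cdg _] := test_functionP tdg.
have [_ [K [cK KA f0]]] := tg.
have h : \int[mu]_x 'D_(e_ i) g x = 0 by apply: integral_derive0 cK f0.
rewrite [RHS](_ : _ = 0); last first.
  under eq_Rintegral do rewrite /= mul0r.
  by rewrite Rintegral_cst// mul0r oppr0.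
rewrite RintegralZl//; last by apply: sqint_integrable => //; exact: test_function_sqint.
rewrite Rintegral_test ?h ?mulr0// => x nAx.
exact: (test_function_out tdg).
Qed.

End weak_derivatives.

(** * Absolute continuity along the axes *)

Section increments.
Context (R : realType) (d : nat).
Notation mu := (lebesgue_rV R d).
Notation leb := (@lebesgue_measure R).
Notation rV := ('rV[R]_d).
Local Notation e_ i := (delta_mx ord0 i : 'rV[R]_d).

Lemma measurable_move (v : rV) :
  measurable_fun setT (fun p : rV * measurableTypeR R => p.1 + p.2 *: v).
Proof.
apply: measurable_fun_rV => i.
rewrite (_ : _ \o _ = fun p : rV * measurableTypeR R => coord_rV i p.1 + p.2 * v ord0 i); last first.
  by apply/funext => p; rewrite /= /coord_rV !mxE.
apply: measurable_funD; first exact: (measurableT_comp (measurable_coord_rV i) measurable_fst).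
by apply: measurable_funM => //; exact: measurable_snd.
Qed.

Definition segment_set (A : set rV) i (s : R) : set rV :=
  [set x | forall t, 0 <= t <= s -> A (x + t *: e_ i)].

Lemma open_segment_set (A : set rV) i s : open A -> open (segment_set A i s).
Proof.
move=> oA; rewrite openE => x Sx.
pose K := (fun t : R => x + t *: e_ i) @` `[0, s].
have cK : compact K.
  apply: continuous_compact; last exact: segment_compact.
  apply: continuous_subspaceT => t; apply: cvgD; first exact: cvg_cst.
  exact: scalel_continuous.
have KA : K `<=` A by move=> _ [t + <-]; rewrite /= in_itv/= => /Sx.
have [r r0 rA] := compact_margin cK oA KA.
apply/nbhs_ballP; exists r => // y xy t ts.
apply: (rA (x + t *: e_ i)); first by exists t.
apply/ball_rVE => // j; have /ball_rVE -/(_ r0) h := xy.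
by have := h j; rewrite !mxE opprD addrACA subrr addr0.
Qed.

Context (A : set rV) (i : 'I_d) (u g : rV -> R) (s : R).
Hypotheses (oA : open A) (finA : (mu A < +oo)%E) (s0 : 0 <= s).
Hypotheses (su : sqint mu A u) (sg : sqint mu A g) (wug : is_weak_partial A i u g).

Let mA : measurable A. Proof. exact: open_measurable_rV. Qed.
Let uA := u \_ A.
Let gA := g \_ A.
Let ind (t : R) : R := \1_(`[0, s[%classic) t.

Let iu : mu.-integrable setT (EFin \o uA). Proof. exact: sqint_patch_integrable. Qed.
Let ig : mu.-integrable setT (EFin \o gA). Proof. exact: sqint_patch_integrable. Qed.
Let mgA : measurable_fun setT gA.
Proof. by apply/measurable_EFinP; exact: (measurable_int mu). Qed.

Let mind : measurable_fun setT (ind : measurableTypeR R -> R).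
Proof. by apply: measurable_indic; exact: measurable_itv. Qed.

Let int_ind : (\int[leb]_t (ind t)%:E = s%:E)%E.
Proof.
rewrite /ind integral_indic//.
rewrite setIT; apply: (etrans (lebesgue_measure_itv _)); rewrite /= lte_fin; case: ltP => [_|s0']; first by rewrite sube0.
by congr EFin; apply/eqP; rewrite eq_le s0 s0'.
Qed.

Let ind0 t : 0 <= ind t. Proof. by rewrite /ind indicE; case: (_ \in _). Qed.

(** Multiplying by a bounded factor covers all the double integrals below. *)
Let integrable_double (k : rV * measurableTypeR R -> R) (G : measurableTypeR R -> rV -> rV) :
  measurable_fun setT k -> (forall p, `|k p| <= 1) ->
  measurable_fun setT (fun p : rV * measurableTypeR R => G p.2 p.1) ->
  (forall t, exists h, forall x, G t x = x + h) ->
  (mu \x leb)%E.-integrable setT (fun p => (gA (G p.2 p.1) * k p * ind p.2)%:E).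
Proof.
move=> mk k1 mG Gh.
have mF : measurable_fun setT (fun p : rV * measurableTypeR R => (gA (G p.2 p.1) * k p * ind p.2)%:E).
  apply/measurable_EFinP; apply: measurable_funM.
    by apply: measurable_funM => //; exact: (measurableT_comp mgA mG).
  exact: (measurableT_comp mind measurable_snd).
apply/(integrable21ltyP mu leb mF).
have /integrableP[_ igoo] := ig.
apply: (@le_lt_trans _ _ (\int[leb]_t ((ind t)%:E * \int[mu]_x `|(gA x)%:E|))%E).
  have mabs : measurable_fun setT (fun p : rV * measurableTypeR R =>
     `|(gA (G p.2 p.1) * k p * ind p.2)%:E|%E) by exact: measurableT_comp.
  apply: ge0_le_integral => //.
  - by move=> t _; exact: integral_ge0.
  - exact: (measurable_fun_fubini_tonelli_G (fun p => `|(gA (G p.2 p.1) * k p * ind p.2)%:E|%E)).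
  - by apply: emeasurable_funM => //; exact/measurable_EFinP.
  - move=> t _; rewrite -ge0_integralZl ?lee_fin//; last first.
      by apply: measurableT_comp => //; exact/measurable_EFinP.
    have [h hG] := Gh t.
    rewrite -[leRHS](integral_shiftT h); last first.
      apply: emeasurable_funM => //; apply: measurableT_comp => //; exact/measurable_EFinP.
    apply: ge0_le_integral => //.
    + exact: (measurableT_comp mabs (measurable_pair2 t)).
    + apply: emeasurable_funM => //; apply: measurableT_comp => //.
      by apply/measurable_EFinP; exact: (measurableT_comp mgA (measurable_shift h)).
    + move=> x _ /=; rewrite -EFinM lee_fin !normrM hG mulrC.
      rewrite (ger0_norm (ind0 t)) ler_wpM2l// -[leRHS]mulr1 ler_wpM2l//.
under eq_integral do rewrite muleC.
rewrite ge0_integralZl//; last 3 first.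
- exact/measurable_EFinP.
- by move=> t _; rewrite lee_fin.
- exact: integral_ge0.
rewrite int_ind; apply: lte_mul_pinfty; [exact: integral_ge0| |].
  by rewrite ge0_fin_numE// integral_ge0.
by rewrite ltry.
Qed.

Definition path_integral (x : rV) : R :=
  \int[leb]_(t in `[0, s[) gA (x + t *: e_ i).

Let J x := (\int[leb]_t (gA (x + t *: e_ i) * 1 * ind t)%:E)%E.

Let JE x : fine (J x) = path_integral x.
Proof.
rewrite /path_integral Rintegral_mkcond /Rintegral; congr fine.
apply: eq_integral => t _; rewrite patchE /ind indicE mulr1.
by case: ifPn => _; rewrite ?mulr1 ?mulr0.
Qed.

Let F2 (p : rV * measurableTypeR R) := (gA (p.1 + p.2 *: e_ i) * 1 * ind p.2)%:E.

Let iF2 : (mu \x leb)%E.-integrable setT F2.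
Proof.
apply: (@integrable_double (fun=> 1) (fun t x => x + t *: e_ i)) => //.
- by move=> p; rewrite normr1.
- exact: measurable_move.
- by move=> t; exists (t *: e_ i).
Qed.

Let iJ : mu.-integrable setT J.
Proof. exact: (integrable_fubini_F iF2). Qed.

Lemma path_integral_integrable : mu.-integrable setT (EFin \o path_integral).
Proof.
have mJ := measurable_int mu iJ.
apply: (le_integrable measurableT _ _ iJ).
  apply/measurable_EFinP; rewrite (_ : path_integral = fine \o J).
    exact: (measurableT_comp (fine_measurable _) mJ).
  by apply/funext => x /=; rewrite JE.
by move=> x _ /=; rewrite -JE; case: (J x) => [r| |]; rewrite /= ?normr0 ?leey.
Qed.

Let Jae (B : rV -> R) (x : rV) : leb.-integrable setT (fun t => F2 (x, t)) ->
  (\int[leb]_t (gA (x + t *: e_ i) * B x * ind t)%:E = (path_integral x * B x)%:E)%E.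
Proof.
move=> iF; rewrite -JE EFinM fineK; last exact: (integrable_fin_num measurableT iF).
rewrite muleC -integralZl//; apply: eq_integral => t _.
by rewrite /F2 /= -EFinM; congr EFin; ring.
Qed.

Let swept_integral n a b :
  \int[mu]_x (gA x * swept_box_bump n a b i s x) =
  \int[mu]_x (path_integral x * box_bump n a b x).
Proof.
set B := box_bump n a b.
have mB : measurable_fun setT B by exact: measurable_box_bump.
have B1 x : `|B x| <= 1 by rewrite ger0_norm ?box_bump_ge0 ?box_bump_le1.
pose F1 (p : rV * measurableTypeR R) := (gA p.1 * B (p.1 - p.2 *: e_ i) * ind p.2)%:E.
pose F3 (p : rV * measurableTypeR R) := (gA (p.1 + p.2 *: e_ i) * B p.1 * ind p.2)%:E.
have iF1 : (mu \x leb)%E.-integrable setT F1.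
  apply: (@integrable_double (fun p => B (p.1 - p.2 *: e_ i)) (fun t x => x)) => //.
  - have := measurableT_comp mB (measurable_move (- e_ i)).
    by apply: eq_measurable_fun => p _; rewrite /= scalerN.
  - exact: measurable_fst.
  - by move=> t; exists 0 => x; rewrite addr0.
have iF3 : (mu \x leb)%E.-integrable setT F3.
  apply: (@integrable_double (fun p => B p.1) (fun t x => x + t *: e_ i)) => //.
  - exact: (measurableT_comp mB measurable_fst).
  - exact: measurable_move.
  - by move=> t; exists (t *: e_ i).
rewrite /Rintegral; congr fine.
transitivity (\int[mu]_x \int[leb]_t F1 (x, t))%E.
  apply: eq_integral => x _; rewrite /F1/= swept_box_bumpE//.
  have ib : leb.-integrable setT (fun t => (B (x - t *: e_ i) * ind t)%:E).
    have mBt : measurable_fun setT (fun t : measurableTypeR R => B (x - t *: e_ i)).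
      have := measurableT_comp (measurableT_comp mB (measurable_move (- e_ i))) (measurable_pair1 x).
      by apply: eq_measurable_fun => t _; rewrite /= scalerN.
    apply: (@le_integrable _ (measurableTypeR R) R leb setT measurableT _
      (EFin \o \1_(`[0, s[%classic))).
    - by apply/measurable_EFinP; exact: measurable_funM.
    - move=> t _; rewrite /= lee_fin normrM.
      by rewrite -/(ind t) ler_piMl// (le_trans (B1 _)).
    - exact: integrable_indic_itv.
  have -> : (\int[leb]_t (gA x * B (x - t *: e_ i) * ind t)%:E =
     (gA x)%:E * \int[leb]_t (B (x - t *: e_ i) * ind t)%:E)%E.
    rewrite -integralZl//; apply: eq_integral => t _.
    by rewrite -EFinM mulrA.
  rewrite EFinM; congr (_ * _)%E.
  rewrite Rintegral_mkcond /Rintegral.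
  rewrite -[RHS]fineK; last exact: (integrable_fin_num measurableT ib).
  congr (fine _)%:E; apply: eq_integral => t _; rewrite patchE /ind indicE.
  by case: ifPn => _; rewrite ?mulr1 ?mulr0.
rewrite (Fubini iF1).
transitivity (\int[leb]_t \int[mu]_x F3 (x, t))%E.
  apply: eq_integral => t _; rewrite -[LHS](integral_shiftT (t *: e_ i)).
    by apply: eq_integral => x _; rewrite /F1 /F3 /= addrK.
  exact: (measurableT_comp (measurable_int _ iF1) (measurable_pair2 t)).
rewrite -(Fubini iF3).
have mP := measurable_int mu path_integral_integrable.
apply: ae_eq_integral => //.
- exact: (measurable_int mu (integrable_fubini_F iF3)).
- by apply/measurable_EFinP; apply: measurable_funM => //; exact/measurable_EFinP.
by apply: filterS (ae_integrable1 iF2) => x hx _; exact: Jae.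
Qed.

(** Tested against a bump, the integral of g along the segment becomes, by the
    Fubini theorem, g tested against a swept bump, whose partial derivative is the
    bump minus its translate.  The definition of the weak derivative turns this
    into the increment of u tested against the bump, and the fundamental lemma
    concludes. *)
Lemma weak_partial_increment : {ae mu, forall x, segment_set A i s x ->
  uA (x + s *: e_ i) - uA x = path_integral x}.
Proof.
pose W x := uA (x + s *: e_ i) - uA x - path_integral x.
have ius : mu.-integrable setT (EFin \o (fun x => uA (x + s *: e_ i))).
  exact: (integrable_shift _ iu).
have iP := path_integral_integrable.
have iW : mu.-integrable setT (EFin \o W).
  exact: (integrableB measurableT (integrableB measurableT ius iu) iP).
suff W0 : {ae mu, forall x, segment_set A i s x -> W x = 0}.
  by apply: filterS W0 => x h /h/eqP; rewrite subr_eq0 => /eqP.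
apply: fundamental_lemma => //; first exact: open_segment_set.
move=> n a b abS.
have mB : measurable_fun setT (box_bump n a b) by exact: measurable_box_bump.
have B1 : exists M : R, forall x, `|box_bump n a b x| <= M.
  by exists 1 => x; rewrite ger0_norm ?box_bump_ge0 ?box_bump_le1.
have [ab|/existsNP[j /negP]] := pselect (forall j, a ord0 j <= b ord0 j); last first.
  rewrite -ltNge => baj; under eq_Rintegral => x _.
    rewrite box_bump_out; last by move=> /(_ j) /andP[/lt_trans h /h]; rewrite ltNge ltW.
    rewrite mulr0; over.
  by rewrite Rintegral_cst// mul0r.
have test : test_function A (swept_box_bump n a b i s).
  apply: test_swept_box_bump => // y hy.
  pose t := Num.max 0 (y ord0 i - b ord0 i).
  have hi := hy i; rewrite !mxE !eqxx mulr1 in hi; have {hi}/andP[hi1 hi2] := hi.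
  have t0s : 0 <= t <= s by rewrite le_max lexx/= ge_max s0/=; lra.
  have -> : y = (y - t *: e_ i) + t *: e_ i by rewrite subrK.
  apply: abS => // j; have := hy j; rewrite !mxE eqxx/=.
  case: (eqVneq j i) => [->|ji]; last by rewrite !mulr0 addr0 subr0.
  move=> _; rewrite mulr1 /t; have abi := ab i.
  by case: (leP 0 (y ord0 i - b ord0 i)) => h; apply/andP; split; lra.
have iuB : mu.-integrable setT (fun x => (uA x * box_bump n a b x)%:E) by exact: integrableMbounded.
have iusB : mu.-integrable setT (fun x => (uA (x + s *: e_ i) * box_bump n a b x)%:E).
  exact: (integrableMbounded ius).
have iPB : mu.-integrable setT (fun x => (path_integral x * box_bump n a b x)%:E).
  exact: (integrableMbounded iP).
have iuBs : mu.-integrable setT (fun x => (uA x * box_bump n a b (x - s *: e_ i))%:E).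
  apply: integrableMbounded => //.
    exact: (measurableT_comp mB (measurable_shift (- (s *: e_ i)))).
  by exists 1 => x; rewrite ger0_norm ?box_bump_ge0 ?box_bump_le1.
have -> : \int[mu]_x (W x * box_bump n a b x) =
    \int[mu]_x (uA (x + s *: e_ i) * box_bump n a b x) -
    \int[mu]_x (uA x * box_bump n a b x) -
    \int[mu]_x (path_integral x * box_bump n a b x).
  rewrite -RintegralB// -RintegralB//.
    by apply: eq_Rintegral => x _; rewrite /W; ring.
  exact: (integrableB measurableT iusB iuB).
have -> : \int[mu]_x (uA (x + s *: e_ i) * box_bump n a b x) =
          \int[mu]_x (uA x * box_bump n a b (x - s *: e_ i)).
  have := Rintegral_shift (s *: e_ i) (f := fun x => uA x * box_bump n a b (x - s *: e_ i)).
  move=> <-; last by apply/measurable_EFinP; exact: (measurable_int mu).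
  by apply: eq_Rintegral => x _; rewrite addrK.
rewrite -swept_integral.
have := wug test; rewrite Rintegral_patchM [X in _ = - X]Rintegral_patchM -/uA -/gA => e.
rewrite -[X in _ - _ - X]opprK -e opprK.
rewrite -RintegralB//.
have -> : \int[mu]_x (uA x * box_bump n a b (x - s *: e_ i) - uA x * box_bump n a b x) =
          - \int[mu]_x (uA x * 'D_(e_ i) (swept_box_bump n a b i s) x).
  rewrite -mulN1r -RintegralZl//.
    by apply: eq_Rintegral => x _; rewrite derive_swept_box_bump//; ring.
  apply: eq_integrable (integrableB measurableT iuB iuBs) => // x _ /=.
  by rewrite derive_swept_box_bump// -EFinB; congr EFin; ring.
by rewrite addNr.
Qed.

Let path_integral_sqr (x : rV) : ((path_integral x ^+ 2)%:E <=
  s%:E * \int[leb]_t ((gA (x + t *: e_ i)) ^+ 2 * ind t)%:E)%E.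
Proof.
have mI : measurable (`[0%R, s[%classic : set (measurableTypeR R)) by exact: measurable_itv.
pose f (t : measurableTypeR R) := gA (x + t *: e_ i).
have mf : measurable_fun setT f.
  exact: (measurableT_comp mgA (measurableT_comp (measurable_move _) (measurable_pair1 x))).
have -> : (\int[leb]_t ((gA (x + t *: e_ i)) ^+ 2 * ind t)%:E =
           \int[leb]_(t in `[0%R, s[) (f t ^+ 2)%:E)%E.
  rewrite [RHS]integral_mkcond; apply: eq_integral => t _.
  by rewrite patchE /ind indicE; case: ifPn => _; rewrite ?mulr1 ?mulr0.
set K := (\int[leb]_(t in _) _)%E.
have K0 : (0 <= K)%E by apply: integral_ge0 => t _; rewrite lee_fin sqr_ge0.
have lI : leb `[0%R, s[%classic = s%:E.
  by rewrite -int_ind integral_indic// setIT.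
have [Koo|Kfin] := eqVneq K +oo%E.
  have [s00|s_neq0] := eqVneq s 0.
    rewrite s00 mul0e /path_integral s00.
    have -> : `[0, 0[%classic = set0 :> set R by rewrite set_itv_ge// bnd_simp ltxx.
    by rewrite Rintegral_set0 expr0n.
  by rewrite Koo gt0_muley ?leey// lte_fin lt_neqAle eq_sym s_neq0.
have sf : sqint leb `[0%R, s[%classic f.
  by apply/sqintP => //; split; [exact: measurable_funTS|rewrite ltey].
have s1 : sqint leb `[0%R, s[%classic (cst 1).
  split; first exact: measurable_cst.
  apply: (@measurable_bounded_integrable _ _ _ leb (fun=> 1 ^+ 2)) => //.
    by apply: (@le_lt_trans _ _ s%:E); rewrite ?ltry// -lI.
  exact: bounded_cst.
have := dot_cauchy_schwarz mI sf s1.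
have -> : dot leb `[0%R, s[%classic f (cst 1) = path_integral x.
  by apply: eq_Rintegral => t _; rewrite mulr1.
have -> : dot leb `[0%R, s[%classic (cst 1) (cst 1) = s.
  rewrite /dot; under eq_Rintegral do rewrite /= mulr1.
  by rewrite Rintegral_cst// mul1r; exact: (congr1 fine lI).
by move=> h; rewrite /K -dot_EFin// -EFinM lee_fin mulrC.
Qed.

(** Cauchy-Schwarz on each segment, then an exchange of integrals: at each time t
    the translate of S by t is contained in Q. *)
Lemma axis_increment_le (S Q : set rV) : measurable S -> measurable Q -> Q `<=` A ->
  (forall x t, S x -> 0 <= t <= s -> Q (x + t *: e_ i)) ->
  (\int[mu]_(x in S) ((u (x + s *: e_ i) - u x) ^+ 2)%:E <=
   (s ^+ 2)%:E * \int[mu]_(x in Q) (g x ^+ 2)%:E)%E.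
Proof.
move=> mS mQ QA SQ.
have SA x : S x -> A x.
  by move=> Sx; apply: QA; have := SQ x 0 Sx; rewrite lexx s0 scale0r addr0; apply.
have SsA x : S x -> A (x + s *: e_ i).
  by move=> Sx; apply: QA; apply: SQ => //; rewrite lexx s0.
have mgA2 : measurable_fun setT (fun x => (gA x ^+ 2)%:E).
  by apply/measurable_EFinP; exact: measurable_funX.
pose F (p : rV * measurableTypeR R) := ((gA (p.1 + p.2 *: e_ i)) ^+ 2 * ind p.2)%:E.
have mF : measurable_fun setT F.
  apply/measurable_EFinP; apply: measurable_funM.
    by apply: measurable_funX; exact: (measurableT_comp mgA (measurable_move _)).
  exact: (measurableT_comp mind measurable_snd).
have F0 p : (0 <= F p)%E by rewrite lee_fin mulr_ge0 ?sqr_ge0.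
pose K x := (\int[leb]_t F (x, t))%E.
have mK : measurable_fun setT K := measurable_fun_fubini_tonelli_F F mF F0.
have K0 x : (0 <= K x)%E by exact: integral_ge0.
have mu_shift : measurable_fun S (fun x : rV => u (x + s *: e_ i)).
  have mus : measurable_fun setT (fun x : rV => uA (x + s *: e_ i)).
    apply: (measurableT_comp (f := uA)); last exact: measurable_shift.
    by apply/measurable_EFinP; exact: (measurable_int mu).
  apply: (eq_measurable_fun (fun x : rV => uA (x + s *: e_ i))); last exact: measurable_funTS.
  by move=> x /set_mem Sx; rewrite /uA patchE mem_set//; exact: SsA.
have mu_ : measurable_fun S u by apply: measurable_funS (su.1).
have mlhs : measurable_fun S (fun x => ((u (x + s *: e_ i) - u x) ^+ 2)%:E).
  by apply/measurable_EFinP; apply: measurable_funX; exact: measurable_funB.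
apply: (@le_trans _ _ (\int[mu]_(x in S) (s%:E * K x))%E).
  apply: ae_ge0_le_integral => //.
  - by move=> x _; rewrite lee_fin sqr_ge0.
  - by move=> x _; rewrite mule_ge0 ?lee_fin.
  - by apply: measurable_funTS; exact: measurable_funeM.
  apply: filterS weak_partial_increment => x hx Sx.
  have {}hx : u (x + s *: e_ i) - u x = path_integral x.
    rewrite -hx; last by move=> t ts; apply: QA; exact: SQ.
    by rewrite /uA !patchE !mem_set//; [exact: SA|exact: SsA].
  rewrite hx; exact: path_integral_sqr.
rewrite ge0_integralZl//; last exact: measurable_funTS.
rewrite expr2 EFinM -muleA lee_wpmul2l ?lee_fin//.
pose G (p : rV * measurableTypeR R) := (F p * (\1_S p.1)%:E)%E.
have G0 p : (0 <= G p)%E by rewrite mule_ge0// lee_fin.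
have mG : measurable_fun setT G.
  apply: emeasurable_funM => //; apply/measurable_EFinP.
  have mS1 : measurable_fun setT (\1_S : rV -> R) by exact: measurable_indic.
  exact: (measurableT_comp mS1 measurable_fst).
have -> : (\int[mu]_(x in S) K x = \int[leb]_t \int[mu]_(x in S) F (x, t))%E.
  transitivity (\int[mu]_x \int[leb]_t G (x, t))%E.
    rewrite integral_mkcond; apply: eq_integral => x _; rewrite patchE.
    rewrite /G /K /= indicE; case: ifPn => _; first by under [RHS]eq_integral do rewrite mule1.
    by under [RHS]eq_integral do rewrite mule0; rewrite integral0.
  rewrite (fubini_tonelli G mG G0); apply: eq_integral => t _.
  rewrite [RHS]integral_mkcond; apply: eq_integral => x _; rewrite patchE.
  by rewrite /G /= indicE; case: ifPn => _; rewrite ?mule1 ?mule0.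
have mFt t : measurable_fun setT (fun x => F (x, t)).
  exact: (measurableT_comp mF (measurable_pair2 t)).
set N := (\int[mu]_(x in Q) _)%E.
have N0 : (0 <= N)%E by apply: integral_ge0 => x _; rewrite lee_fin sqr_ge0.
apply: (@le_trans _ _ (\int[leb]_t ((ind t)%:E * N))%E).
  apply: ge0_le_integral => //.
  - by move=> t _; exact: integral_ge0.
  - pose H t := (\int[mu]_x G (x, t))%E.
    have : measurable_fun setT H := measurable_fun_fubini_tonelli_G G mG G0.
    apply: eq_measurable_fun => t _; rewrite [RHS]integral_mkcond; apply: eq_integral => x _.
    by rewrite patchE /G /= indicE; case: ifPn => _; rewrite ?mule1 ?mule0.
  - by apply: emeasurable_funM => //; exact/measurable_EFinP.
  move=> t _; rewrite /ind indicE; have [/set_mem ts|ts] := boolP (t \in _); last first.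
    rewrite mul0e (eq_integral (cst 0%E)) ?integral0// => x _.
    by rewrite /F /= /ind indicE (negbTE ts) mulr0.
  rewrite mul1e; move: ts; rewrite /= in_itv/= => /andP[t0 ts].
  have mQt : measurable ((fun x => x + t *: e_ i) @^-1` Q).
    by rewrite -[X in measurable X]setTI; exact: measurable_shift.
  apply: (@le_trans _ _ (\int[mu]_(x in (fun x => x + t *: e_ i)%R @^-1` Q) F (x, t))%E).
    apply: ge0_subset_integral => //; first exact: measurable_funTS.
    by move=> x Sx; apply: SQ => //; rewrite t0 ltW.
  have -> : N = (\int[mu]_(x in Q) (gA x ^+ 2)%:E)%E.
    apply: eq_integral => x /set_mem Qx; rewrite /gA patchE mem_set//; exact: QA.
  rewrite -(ge0_integral_shift (t *: e_ i) mQ (f := fun x => (gA x ^+ 2)%:E)); last 2 first.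
  - exact: measurable_funTS.
  - by move=> x _; rewrite lee_fin sqr_ge0.
  apply: ge0_le_integral => //.
  - exact: measurable_funTS.
  - by apply: measurable_funTS; exact: (measurableT_comp mgA2 (measurable_shift _)).
  - move=> x _; rewrite lee_fin /= ler_piMr ?sqr_ge0// /ind indicE; by case: (_ \in _).
rewrite ge0_integralZr//; last 2 first.
- exact/measurable_EFinP.
- by move=> t _; rewrite lee_fin.
by rewrite int_ind.
Qed.

End increments.

(** * Increments in all directions *)

Lemma sqr_sum_le (R : realType) n (a : 'I_n -> R) :
  (\sum_(k < n) a k) ^+ 2 <= n%:R * \sum_(k < n) a k ^+ 2.
Proof.
elim: n a => [|n IHn] a; first by rewrite !big_ord0 expr0n mul0r.
rewrite !big_ord_recr/=.
have := IHn (fun k => a (widen_ord (leqnSn n) k)).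
set s := \sum_(k < n) a _; set q := \sum_(k < n) _ ^+ 2; set b := a ord_max => h.
have q0 : 0 <= q by apply: sumr_ge0 => k _; exact: sqr_ge0.
rewrite -natr1 mulrDl mul1r !mulrDr.
have [n0|n0] := posnP n.
  have -> : s = 0.
    apply: big1 => k _; suff : false by [].
    by rewrite -(ltn0 k) -n0 (ltn_ord k).
  have nR : 0 <= n%:R :> R by rewrite ler0n.
  move: nR; set m : R := n%:R => nR; rewrite add0r.
  have := mulr_ge0 nR q0; have := mulr_ge0 nR (sqr_ge0 b); lra.
have nR : 0 < n%:R :> R by rewrite ltr0n.
move: h nR; set m : R := n%:R => h nR.
have h2 : 2 * s * b <= q + m * b ^+ 2.
  rewrite -(ler_pM2l nR); have : 0 <= (s - m * b) ^+ 2 by exact: sqr_ge0.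
  nra.
nra.
Qed.

Section sqr_integral_bounds.
Local Open Scope ereal_scope.
Context d (T : measurableType d) (R : realType) (mu : {measure set T -> \bar R}).
Variables (S : set T) (mS : measurable S).
Implicit Types (u v : T -> R).

Lemma integral_sqr_ge0 u : 0 <= \int[mu]_(x in S) (u x ^+ 2)%:E.
Proof. by apply: integral_ge0 => x _; rewrite lee_fin sqr_ge0. Qed.

Lemma measurable_sqr u : measurable_fun S u -> measurable_fun S (fun x => (u x ^+ 2)%:E).
Proof. by move=> mu'; apply/measurable_EFinP; exact: measurable_funX. Qed.

Lemma integral_sqr_sum_le n (a : 'I_n -> T -> R) : (forall k, measurable_fun S (a k)) ->
  \int[mu]_(x in S) ((\sum_(k < n) a k x) ^+ 2)%:E <=
  n%:R%:E * \sum_(k < n) \int[mu]_(x in S) (a k x ^+ 2)%:E.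
Proof.
move=> ma; rewrite -ge0_integral_sum//; last 2 first.
- by move=> k; exact: measurable_sqr.
- by move=> k x _; rewrite lee_fin sqr_ge0.
rewrite -ge0_integralZl//; last 2 first.
- by apply: emeasurable_sum => k _; exact: measurable_sqr.
- by move=> x _; apply: sume_ge0 => k _; rewrite lee_fin sqr_ge0.
have msum : measurable_fun S (fun x => \sum_(k < n) (a k x ^+ 2)%:E).
  by apply: emeasurable_sum => k _; exact: measurable_sqr.
apply: ge0_le_integral => //.
- by move=> x _; rewrite lee_fin sqr_ge0.
- by apply: measurable_sqr; apply: measurable_sum.
- exact: measurable_funeM.
- by move=> x _; rewrite sumEFin -EFinM lee_fin sqr_sum_le.
Qed.

Lemma integral_sqrB_le u v : measurable_fun S u -> measurable_fun S v ->
  \int[mu]_(x in S) (u x ^+ 2)%:E <=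
  2%:E * (\int[mu]_(x in S) (v x ^+ 2)%:E + \int[mu]_(x in S) ((v x - u x) ^+ 2)%:E).
Proof.
move=> mu' mv; have mvu : measurable_fun S (fun x => v x - u x)%R by exact: measurable_funB.
rewrite -ge0_integralD//; last 4 first.
- by move=> x _; rewrite lee_fin sqr_ge0.
- exact: measurable_sqr.
- by move=> x _; rewrite lee_fin sqr_ge0.
- exact: measurable_sqr.
rewrite -ge0_integralZl//; last 2 first.
- by apply: emeasurable_funD; exact: measurable_sqr.
- by move=> x _; rewrite adde_ge0 ?lee_fin ?sqr_ge0.
apply: ge0_le_integral => //.
- by move=> x _; rewrite lee_fin sqr_ge0.
- exact: measurable_sqr.
- by apply: measurable_funeM; apply: emeasurable_funD; exact: measurable_sqr.
- move=> x _; rewrite -EFinD -EFinM lee_fin.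
  by have := sqr_ge0 (v x - (v x - u x))%R; have := sqr_ge0 (2 * v x - u x)%R; nra.
Qed.

End sqr_integral_bounds.

Section translations.
Context (R : realType) (d : nat).
Notation mu := (lebesgue_rV R d).
Notation rV := ('rV[R]_d).
Local Notation e_ i := (delta_mx ord0 i : 'rV[R]_d).

(** The gradient is an explicit family, because estimates are applied to sums and
    limits whose gradient is known and need not be the chosen representative. *)
Definition weak_pair (A : set rV) (u : rV -> R) (g : 'I_d -> rV -> R) :=
  [/\ sqint mu A u, forall i, sqint mu A (g i) & forall i, is_weak_partial A i u (g i)].

Definition energy (Q : set rV) (g : 'I_d -> rV -> R) : \bar R :=
  (\sum_(i < d) \int[mu]_(x in Q) (g i x ^+ 2)%:E)%E.

Lemma energy_ge0 Q g : (0 <= energy Q g)%E.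
Proof. by apply: sume_ge0 => i _; exact: integral_sqr_ge0. Qed.

Lemma energy_subset Q A g : measurable Q -> measurable A -> Q `<=` A ->
  (forall i, measurable_fun A (g i)) -> (energy Q g <= energy A g)%E.
Proof.
move=> mQ mA QA mg; apply: lee_sum => i _; apply: ge0_subset_integral => //.
- exact: measurable_sqr.
- by move=> x _; rewrite lee_fin sqr_ge0.
Qed.

Lemma measurable_shift_preimage h (Q : set rV) : measurable Q ->
  measurable ((fun x => x + h) @^-1` Q).
Proof. by move=> mQ; rewrite -[X in measurable X]setTI; exact: measurable_shift. Qed.

Lemma measurable_fun_shift (A S : set rV) (u : rV -> R) h : measurable A ->
  measurable_fun A u -> (forall x, S x -> A (x + h)) ->
  measurable_fun S (fun x => u (x + h)).
Proof.
move=> mA mu_ SA.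
have mus : measurable_fun setT (fun x : rV => (u \_ A) (x + h)).
  have m : measurable_fun setT (u \_ A) by apply/(measurable_restrictT _ _).1.
  exact: (measurableT_comp m (measurable_shift h)).
apply: (eq_measurable_fun (fun x : rV => (u \_ A) (x + h))); last exact: measurable_funTS.
by move=> x /set_mem Sx; rewrite patchE mem_set//; exact: SA.
Qed.

Lemma integral_shift_sqr (S : set rV) (w : rV -> R) h : measurable S ->
  measurable_fun ((fun x => x - h) @^-1` S) w ->
  (\int[mu]_(x in S) (w (x + h)%R ^+ 2)%:E =
   \int[mu]_(x in (fun x => x - h)%R @^-1` S) (w x ^+ 2)%:E)%E.
Proof.
move=> mS mw.
rewrite -(ge0_integral_shift h (A := (fun x => x - h) @^-1` S) (f := fun x => (w x ^+ 2)%:E)).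
- by congr (integral _ _ _); apply/seteqP; split => x /=; rewrite addrK.
- exact: measurable_shift_preimage.
- exact: measurable_sqr.
- by move=> x _; rewrite lee_fin sqr_ge0.
Qed.

Context (A : set rV) (u : rV -> R) (g : 'I_d -> rV -> R).
Hypotheses (oA : open A) (finA : (mu A < +oo)%E) (ug : weak_pair A u g).

Let mA : measurable A. Proof. exact: open_measurable_rV. Qed.
Let mu_ : measurable_fun A u. Proof. by case: ug => -[]. Qed.
Let mg i : measurable_fun A (g i). Proof. by case: ug => _ /(_ i)[]. Qed.

Lemma signed_axis_increment_le i s (S Q : set rV) : measurable S -> measurable Q ->
  Q `<=` A ->
  (forall x t, S x -> Num.min 0 s <= t <= Num.max 0 s -> Q (x + t *: e_ i)) ->
  (\int[mu]_(x in S) ((u (x + s *: e_ i) - u x) ^+ 2)%:E <=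
   (s ^+ 2)%:E * \int[mu]_(x in Q) (g i x ^+ 2)%:E)%E.
Proof.
move=> mS mQ QA SQ; have [su sg wg] := ug.
have [s0|s0] := leP 0 s.
  apply: (axis_increment_le oA finA s0 su (sg i) (wg i) mS mQ QA) => x t Sx ts.
  by apply: SQ; rewrite // min_l ?max_r.
have Ns0 : 0 <= - s by rewrite oppr_ge0 ltW.
pose S' : set rV := (fun x => x - s *: e_ i) @^-1` S.
have mS' : measurable S' by exact: measurable_shift_preimage.
have S'Q x t : S' x -> 0 <= t <= - s -> Q (x + t *: e_ i).
  move=> S'x ts; have -> : x + t *: e_ i = (x - s *: e_ i) + (s + t) *: e_ i.
    by rewrite scalerDl addrA subrK.
  apply: SQ => //.
  have -> : Num.min 0 s = s by rewrite min_r ?ltW.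
  have -> : Num.max 0 s = 0 by rewrite max_l ?ltW.
  lra.
have := axis_increment_le oA finA Ns0 su (sg i) (wg i) mS' mQ QA S'Q.
rewrite sqrrN; apply: le_trans.
rewrite -(integral_shift_sqr (w := fun x => u (x + (- s) *: e_ i) - u x) mS).
  rewrite le_eqVlt; apply/orP; left; apply/eqP; apply: eq_integral => x _.
  by rewrite scaleNr addrK -sqrrN opprB.
apply: measurable_funB.
  apply: (measurable_fun_shift mA mu_) => x S'x; apply: QA; apply: S'Q => //.
  by rewrite Ns0 lexx.
apply: measurable_funS mu_ => // x S'x; apply: QA.
by have := S'Q x 0 S'x; rewrite lexx Ns0 scale0r addr0; apply.
Qed.

(** Follow the edges of the box with opposite corners x and x + h, one axis after
    the other. *)
Lemma box_increment_le (h : rV) (M : R) (S Q : set rV) : measurable S -> measurable Q ->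
  Q `<=` A -> (forall i, `|h ord0 i| <= M) ->
  (forall x y : rV, S x -> (forall i, Num.min 0 (h ord0 i) <= y ord0 i <= Num.max 0 (h ord0 i)) ->
    Q (x + y)) ->
  (\int[mu]_(x in S) ((u (x + h) - u x) ^+ 2)%:E <=
   (d%:R * M ^+ 2)%:E * energy Q g)%E.
Proof.
move=> mS mQ QA hM SQ.
(* the corners of the staircase from 0 to h *)
pose p k : rV := \row_j (if (j < k)%N then h ord0 j else 0).
have pS (k : 'I_d) : p k.+1 = p k + h ord0 k *: e_ k.
  apply/rowP => j; rewrite !mxE eqxx/= ltnS leq_eqVlt.
  have [->|jk] := eqVneq j k; first by rewrite eqxx/= ltnn add0r mulr1.
  by rewrite (_ : (j == k :> nat) = false) ?mulr0 ?addr0//; exact/negbTE.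
have p0 : p 0%N = 0 by apply/rowP => j; rewrite !mxE.
have pd : p d = h by apply/rowP => j; rewrite mxE ltn_ord.
have SQp k x t (kd : (k < d)%N) : S x ->
    Num.min 0 (h ord0 (Ordinal kd)) <= t <= Num.max 0 (h ord0 (Ordinal kd)) ->
    Q (x + (p k + t *: e_ (Ordinal kd))).
  move=> Sx ts; apply: SQ => // j; rewrite !mxE eqxx/=.
  have [->|jk] := eqVneq j (Ordinal kd); first by rewrite /= ltnn add0r mulr1.
  rewrite mulr0 addr0; case: ifP => _; last by rewrite ge_min lexx le_max lexx.
  by rewrite ge_min le_max !lexx !orbT.
have SAp k x : (k <= d)%N -> S x -> A (x + p k).
  rewrite leq_eqVlt => /predU1P[->|kd] Sx.
    rewrite pd; apply: QA; apply: SQ => // j.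
    by rewrite ge_min le_max !lexx !orbT.
  have := SQp k x 0 kd Sx; rewrite scale0r addr0 => H; apply/QA/H.
  by rewrite ge_min le_max lexx.
have E x : u (x + h) - u x = \sum_(k < d) (u (x + p k.+1) - u (x + p k)).
  rewrite -(big_mkord xpredT (fun k => u (x + p k.+1) - u (x + p k))).
  by rewrite (telescope_sumr (fun k => u (x + p k)))// pd p0 addr0.
under eq_integral do rewrite E.
apply: le_trans (@integral_sqr_sum_le _ _ R mu S mS d
  (fun k x => u (x + p k.+1) - u (x + p k)) _) _.
  move=> k; apply: measurable_funB; apply: (measurable_fun_shift mA mu_) => x.
    by apply: SAp; exact: ltn_ord.
  by apply: SAp; exact/ltnW/ltn_ord.
rewrite EFinM -muleA; apply: lee_wpmul2l; first by rewrite lee_fin.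
rewrite /energy ge0_sume_distrr//; last by move=> i _; exact: integral_sqr_ge0.
apply: lee_sum => k _.
pose S' : set rV := (fun x => x - p k) @^-1` S.
have mS' : measurable S' by exact: measurable_shift_preimage.
pose w x := u (x + h ord0 k *: e_ k) - u x.
have S'Q x t : S' x -> Num.min 0 (h ord0 k) <= t <= Num.max 0 (h ord0 k) ->
    Q (x + t *: e_ k).
  move=> S'x ts; have := SQp k (x - p k) t (ltn_ord k) S'x.
  rewrite (_ : Ordinal _ = k); last exact: val_inj.
  by rewrite addrA subrK; exact.
have S'A x : S' x -> A x by move=> /(SAp k _ (ltnW (ltn_ord k))); rewrite subrK.
have -> : (\int[mu]_(x in S) ((u (x + p k.+1)%R - u (x + p k)%R) ^+ 2)%:E =
    \int[mu]_(x in S') (w x ^+ 2)%:E)%E.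
  rewrite -(integral_shift_sqr (w := w) mS).
    by apply: eq_integral => x _; rewrite /w pS addrA.
  apply: measurable_funB; last exact: measurable_funS mu_.
  apply: (measurable_fun_shift mA mu_) => x S'x; apply: QA; apply: S'Q => //.
  by rewrite ge_min le_max !lexx !orbT.
apply: le_trans (signed_axis_increment_le mS' mQ QA S'Q) _.
apply: lee_wpmul2r; first exact: integral_sqr_ge0.
by rewrite lee_fin -real_normK ?num_real// lerXn2r ?nnegrE// (le_trans _ (hM k)).
Qed.

(** Cut the segment into N pieces, each shorter than its distance e to the
    complement of A, so that the boxes spanned by the pieces stay in A.  One factor
    N comes from the Cauchy-Schwarz inequality and one from the number of pieces;
    they cancel with the factor 1 / N^2 in the estimate of each piece. *)
Lemma segment_increment_le (h : rV) (M e : R) (S : set rV) : measurable S -> 0 < e ->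
  (forall i, `|h ord0 i| <= M) ->
  (forall (x : rV) (t : R), S x -> 0 <= t <= 1 -> ball (x + t *: h) e `<=` A) ->
  (\int[mu]_(x in S) ((u (x + h) - u x) ^+ 2)%:E <=
   (d%:R * M ^+ 2)%:E * energy A g)%E.
Proof.
move=> mS e0 hM SA.
have [N [N0 NM]] : exists N, (0 < N)%N /\ M / N%:R < e.
  exists (Num.truncn (M / e)).+1; split => //.
  by rewrite ltr_pdivrMr// mulrC -ltr_pdivrMr//; exact: truncnS_gt.
have NR : 0 < N%:R :> R by rewrite ltr0n.
pose h' := N%:R^-1 *: h; pose q k : rV := k%:R *: h'.
have qE k : q k = (k%:R / N%:R) *: h by rewrite /q scalerA.
have qS k : q k.+1 = q k + h' by rewrite /q -natr1 scalerDl scale1r.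
have SAq k x : (k <= N)%N -> S x -> ball (x + q k) e `<=` A.
  move=> kN Sx; rewrite qE; apply: SA => //.
  by rewrite divr_ge0//= ler_pdivrMr// mul1r ler_nat.
have SAq0 k x : (k <= N)%N -> S x -> A (x + q k).
  by move=> kN Sx; apply: (SAq k x kN Sx); exact: ballxx.
have q0 : q 0%N = 0 by rewrite /q scale0r.
have qN : q N = h by rewrite qE divff ?scale1r// gt_eqF.
have E x : u (x + h) - u x = \sum_(k < N) (u (x + q k.+1) - u (x + q k)).
  rewrite -(big_mkord xpredT (fun k => u (x + q k.+1) - u (x + q k))).
  by rewrite (telescope_sumr (fun k => u (x + q k)))// qN q0 addr0.
under eq_integral do rewrite E.
apply: le_trans (@integral_sqr_sum_le _ _ R mu S mS N
  (fun k x => u (x + q k.+1) - u (x + q k)) _) _.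
  move=> k; apply: measurable_funB; apply: (measurable_fun_shift mA mu_) => x; apply: SAq0 => //.
  exact: ltnW.
have step k : (k < N)%N -> (\int[mu]_(x in S) ((u (x + q k.+1)%R - u (x + q k)%R) ^+ 2)%:E <=
    (d%:R * (M / N%:R) ^+ 2)%:E * energy A g)%E.
  move=> kN.
  pose S' : set rV := (fun x => x - q k) @^-1` S.
  have mS' : measurable S' by exact: measurable_shift_preimage.
  pose w x := u (x + h') - u x.
  have S'A x : S' x -> ball x e `<=` A by move=> /(SAq k _ (ltnW kN)); rewrite subrK.
  have h'M i : `|h' ord0 i| <= M / N%:R.
    by rewrite mxE normrM mulrC [X in _ * X]ger0_norm ?invr_ge0// ler_wpM2r// invr_ge0.
  have S'Q (x y : rV) : S' x -> (forall i, Num.min 0 (h' ord0 i) <= y ord0 i <= Num.max 0 (h' ord0 i)) ->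
      A (x + y).
    move=> S'x yh; apply: (S'A x S'x); apply/ball_rVE => // i.
    rewrite mxE opprD addrA subrr add0r normrN; apply: le_lt_trans NM.
    apply: le_trans (h'M i); have := yh i.
    case: (leP 0 (h' ord0 i)) => h0; move=> /andP[y1 y2].
      by rewrite ger0_norm// ger0_norm// (le_trans y1).
    by rewrite ler0_norm// ltr0_norm// lerN2.
  have -> : (\int[mu]_(x in S) ((u (x + q k.+1)%R - u (x + q k)%R) ^+ 2)%:E =
      \int[mu]_(x in S') (w x ^+ 2)%:E)%E.
    rewrite -(integral_shift_sqr (w := w) mS).
      by apply: eq_integral => x _; rewrite /w qS addrA.
    apply: measurable_funB; last first.
      by apply: measurable_funS mu_ => // x /S'A; apply; exact: ballxx.
    apply: (measurable_fun_shift mA mu_) => x S'x; apply: S'Q => // i.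
    by rewrite ge_min le_max !lexx !orbT.
  exact: box_increment_le mS' mA _ h'M S'Q.
apply: (@le_trans _ _ (N%:R%:E * \sum_(k < N) ((d%:R * (M / N%:R) ^+ 2)%:E * energy A g))%E).
  by apply: lee_wpmul2l; rewrite ?lee_fin//; apply: lee_sum => k _; exact: step.
rewrite -ge0_sume_distrl; last by move=> k _; rewrite lee_fin mulr_ge0// sqr_ge0.
rewrite sumEFin sumr_const card_ord muleA -EFinM -mulr_natl.
apply: lee_wpmul2r; first exact: energy_ge0.
rewrite lee_fin le_eqVlt; apply/orP; left; apply/eqP; field; rewrite gt_eqF//.
Qed.

End translations.

(** * Poincare inequality on cubes, and compactness *)

Section pairs.
Context d (T : measurableType d) (R : realType) (mu : {measure set T -> \bar R}).
Variables (Q : set T) (mQ : measurable Q) (m : R).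
Hypothesis muQ : mu Q = m%:E.

Let finQ : (mu Q < +oo)%E. Proof. by rewrite muQ ltry. Qed.

Lemma Rintegral_cst_mass (c : R) : \int[mu]_(x in Q) c = c * m.
Proof. by rewrite Rintegral_cst// muQ. Qed.

Let U1 (u : T -> R) := \int[mu]_(x in Q) u x.

(** The right-hand side is twice the square of the mass times the variance of u. *)
Lemma integral_pair_sqr u : sqint mu Q u ->
  (\int[mu]_(x in Q) \int[mu]_(y in Q) ((u y - u x) ^+ 2)%:E =
   (2 * (m * dot mu Q u u - U1 u ^+ 2))%:E)%E.
Proof.
move=> su; set U2 := dot mu Q u u.
have iu := sqint_integrable mQ finQ su.
have inner x : (\int[mu]_(y in Q) ((u y - u x) ^+ 2)%:E =
    (U2 - 2 * u x * U1 u + m * u x ^+ 2)%:E)%E.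
  have sc := sqint_cst mQ (u x) finQ.
  rewrite -(dot_EFin mQ (sqintB mQ su sc)); congr EFin.
  transitivity (dot mu Q u u - dot mu Q u (cst (u x)) *+ 2 + dot mu Q (cst (u x)) (cst (u x))).
    exact: (formB (subspace_sqint mu mQ) (dot_psd mu mQ) su sc).
  have -> : dot mu Q u (cst (u x)) = u x * U1 u.
    by rewrite /dot /U1 -RintegralZl//; apply: eq_Rintegral => y _; rewrite mulrC.
  have -> : dot mu Q (cst (u x)) (cst (u x)) = u x ^+ 2 * m.
    by rewrite expr2; apply: (etrans _ (Rintegral_cst_mass (u x * u x))).
  by rewrite -/U2 mulr2n; ring.
under eq_integral do rewrite inner.
have i1 : mu.-integrable Q (EFin \o (fun x => U2 - 2 * u x * U1 u)).
  apply: (@integrableB _ _ _ mu Q mQ (EFin \o cst U2) (EFin \o (fun x => 2 * u x * U1 u))).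
    exact: (sqint_integrable mQ finQ (sqint_cst mQ U2 finQ)).
  apply: eq_integrable (integrableZl mQ (2 * U1 u) iu) => // x _ /=.
  by rewrite -EFinM; congr EFin; ring.
have i2 : mu.-integrable Q (EFin \o (fun x => m * u x ^+ 2)).
  by apply: eq_integrable (integrableZl mQ m su.2) => // x _.
have i12 : mu.-integrable Q (EFin \o (fun x => U2 - 2 * u x * U1 u + m * u x ^+ 2)).
  by apply: eq_integrable (integrableD mQ i1 i2) => // x _.
rewrite -[LHS]fineK; last exact: (integrable_fin_num mQ i12).
congr EFin; rewrite -/(Rintegral _ _ _) RintegralD// RintegralB//; last 2 first.
- exact: (sqint_integrable mQ finQ (sqint_cst mQ U2 finQ)).
- apply: eq_integrable (integrableZl mQ (2 * U1 u) iu) => // x _ /=.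
  by rewrite -EFinM; congr EFin; ring.
have -> : \int[mu]_(x in Q) (2 * u x * U1 u) = 2 * U1 u * U1 u.
  by rewrite -[in RHS]RintegralZl//; apply: eq_Rintegral => x _; ring.
have -> : \int[mu]_(x in Q) (m * u x ^+ 2) = m * U2.
  by rewrite RintegralZl//; exact: su.2.
by rewrite Rintegral_cst_mass; ring.
Qed.

End pairs.

Section cells.
Context (R : realType) (d : nat).
Notation mu := (lebesgue_rV R d).
Notation rV := ('rV[R]_d).

Definition cell (a : rV) (l : R) : set rV :=
  [set x | forall i, a ord0 i <= x ord0 i < a ord0 i + l].

Let cellE a l : cell a l =
  [set x | forall i, [set` `[a ord0 i, (a ord0 i + l)%R[] (coord_rV i x)].
Proof. by apply/seteqP; split => x h i; have := h i; rewrite /= in_itv. Qed.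

Lemma measurable_cell a l : measurable (cell a l).
Proof.
rewrite cellE; apply: (@measurable_coords _ _ (fun i => [set` `[a ord0 i, (a ord0 i + l)%R[])).
by move=> i; exact: measurable_itv.
Qed.

Lemma lebesgue_cell a l : 0 <= l -> mu (cell a l) = (l ^+ d)%:E.
Proof.
move=> l0; rewrite cellE (@lebesgue_rV_box R d (fun i => [set` `[a ord0 i, (a ord0 i + l)%R[])); last first.
  by move=> i; exact: measurable_itv.
have -> : (l ^+ d)%:E = (\prod_(i < d) l%:E)%E by rewrite prodEFin prodr_const card_ord.
apply: eq_bigr => i _; rewrite lebesgue_measure_itv/= lte_fin ltrDl.
case: ltP => l0'; first by rewrite -EFinB addrAC subrr add0r.
by congr EFin; apply/eqP; rewrite eq_le l0 l0'.
Qed.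

Lemma measurable_add : measurable_fun setT (fun p : rV * rV => p.1 + p.2).
Proof.
apply: measurable_fun_rV => i.
rewrite (_ : _ \o _ = fun p => (coord_rV i p.1 + coord_rV i p.2)%R); last first.
  by apply/funext => p /=; rewrite /coord_rV !mxE.
by apply: measurable_funD; apply: (measurableT_comp (measurable_coord_rV i)).
Qed.

Lemma energy_fin Q (g : 'I_d -> rV -> R) : measurable Q -> (forall i, sqint mu Q (g i)) ->
  energy Q g = (\sum_(i < d) dot mu Q (g i) (g i))%:E.
Proof. by move=> mQ sg; rewrite -sumEFin; apply: eq_bigr => i _; rewrite dot_EFin. Qed.

Context (A : set rV) (u : rV -> R) (g : 'I_d -> rV -> R).
Hypotheses (oA : open A) (finA : (mu A < +oo)%E) (ug : weak_pair A u g).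

Let mA : measurable A. Proof. exact: open_measurable_rV. Qed.

(** The mean square of u(y) - u(x) over pairs of points of a cube is twice the
    variance of u; at a fixed distance y - x = h, it is bounded by the
    increment estimate. *)
Lemma cell_poincare a l : 0 < l -> cell a l `<=` A ->
  (\int[mu]_(x in cell a l) (u x ^+ 2)%:E <=
   ((l ^+ d)^-1 * (\int[mu]_(x in cell a l) u x) ^+ 2)%:E +
   (2 ^+ d * d%:R * l ^+ 2)%:E * energy (cell a l) g)%E.
Proof.
move=> l0 QA; have [su sg wg] := ug.
set Q := cell a l in QA *; have mQ : measurable Q by exact: measurable_cell.
have muQ : mu Q = (l ^+ d)%:E by rewrite lebesgue_cell// ltW.
have suQ : sqint mu Q u by exact: sqintS su.
have sgQ i : sqint mu Q (g i) by exact: sqintS (sg i).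
have ld : 0 < l ^+ d by rewrite exprn_gt0.
set U1 := \int[mu]_(x in Q) u x.
set E := energy Q g; have E0 : (0 <= E)%E by exact: energy_ge0.
pose uQ := u \_ Q; pose chi : rV -> R := \1_Q.
have muq : measurable_fun setT uQ by apply/(measurable_restrictT _ _).1 => //; case: suQ.
have mchi : measurable_fun setT chi by exact: measurable_indic.
pose G (p : rV * rV) := ((uQ (p.1 + p.2) - uQ p.1) ^+ 2 * (chi p.1 * chi (p.1 + p.2)))%:E.
have mG : measurable_fun setT G.
  apply/measurable_EFinP; apply: measurable_funM.
    apply: measurable_funX; apply: measurable_funB.
      exact: (measurableT_comp muq measurable_add).
    exact: (measurableT_comp muq measurable_fst).
  apply: measurable_funM; first exact: (measurableT_comp mchi measurable_fst).
  exact: (measurableT_comp mchi measurable_add).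
have chi0 x : 0 <= chi x by rewrite /chi indicE.
have G0 p : (0 <= G p)%E by rewrite lee_fin mulr_ge0 ?sqr_ge0// mulr_ge0.
have lhs : (\int[mu]_x \int[mu]_h G (x, h) =
    (2 * (l ^+ d * dot mu Q u u - U1 ^+ 2))%:E)%E.
  rewrite -(integral_pair_sqr mQ muQ suQ) [RHS]integral_mkcond.
  apply: eq_integral => x _; rewrite patchE; case: ifPn => xQ; last first.
    rewrite -[RHS](@integral0 _ _ _ mu setT); apply: eq_integral => h _.
    by rewrite /G /chi /= indicE (negbTE xQ) mul0r mulr0.
  rewrite [RHS]integral_mkcond.
  pose k y := ((uQ y - uQ x) ^+ 2 * chi y)%:E.
  have mk : measurable_fun setT k.
    apply/measurable_EFinP; apply: measurable_funM => //.
    by apply: measurable_funX; apply: measurable_funB => //; exact: measurable_cst.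
  transitivity (\int[mu]_h k (h + x)%R)%E.
    apply: eq_integral => h _; rewrite /G /k /= (addrC h).
    by rewrite [chi x]indicE xQ mul1r.
  rewrite ge0_integral_shiftT//; last by move=> y; rewrite lee_fin mulr_ge0 ?sqr_ge0.
  apply: eq_integral => y _; rewrite /k patchE /chi indicE /uQ !patchE xQ.
  by case: ifP => _; rewrite ?mulr1 ?mulr0.
(* the differences of two points of the cube *)
pose W : set rV := obox (const_mx (- l)) (const_mx l).
have mW : measurable W by exact: measurable_obox.
have rhs h : (\int[mu]_x G (x, h) <= (\1_W h)%:E * ((d%:R * l ^+ 2)%:E * E))%E.
  pose S : set rV := Q `&` ((fun x => x + h) @^-1` Q).
  have mS : measurable S by apply: measurableI => //; exact: measurable_shift_preimage.
  have -> : (\int[mu]_x G (x, h) = \int[mu]_(x in S) ((u (x + h)%R - u x) ^+ 2)%:E)%E.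
    rewrite [RHS]integral_mkcond; apply: eq_integral => x _.
    rewrite patchE in_setI /G /chi /uQ /= !patchE !indicE.
    have -> : (x \in (fun x => x + h) @^-1` Q) = (x + h \in Q).
      by apply/idP/idP => /set_mem ?; exact: mem_set.
    by case: (x \in Q); case: (x + h \in Q); rewrite ?mulr1 ?mulr0 ?mul0r.
  have [hW|hW] := pselect (W h); last first.
    have -> : S = set0.
      apply/seteqP; split => // x [Qx Qxh]; apply: hW => i.
      have := Qx i; have := Qxh i; rewrite /= !mxE; lra.
    by rewrite integral_set0 mule_ge0 ?lee_fin// mule_ge0// lee_fin mulr_ge0// sqr_ge0.
  rewrite indicE mem_set// mul1e.
  apply: (box_increment_le oA finA ug mS mQ QA).
    by move=> i; rewrite ltW// ltr_norml; have := hW i; rewrite !mxE.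
  move=> x y [Qx Qxh] yh i; have := yh i; have := Qx i; have := Qxh i.
  rewrite /= !mxE; case: (leP 0 (h ord0 i)) => _; lra.
have muW : mu W = (2 ^+ d * l ^+ d)%:E.
  rewrite /W lebesgue_obox; last by move=> i; rewrite !mxE; lra.
  under eq_bigr do rewrite !mxE opprK.
  rewrite prodr_const card_ord; congr EFin.
  rewrite -exprMn.
  by congr (_ ^+ _); ring.
have key : ((2 * (l ^+ d * dot mu Q u u - U1 ^+ 2))%:E <=
    (2 ^+ d * l ^+ d)%:E * ((d%:R * l ^+ 2)%:E * E))%E.
  rewrite -lhs (fubini_tonelli G mG G0).
  have C0 : (0 <= (d%:R * l ^+ 2)%:E * E)%E by rewrite mule_ge0// lee_fin mulr_ge0// sqr_ge0.
  apply: (@le_trans _ _ (\int[mu]_h ((\1_W h)%:E * ((d%:R * l ^+ 2)%:E * E)))%E).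
    apply: ge0_le_integral => //.
    - by move=> h _; exact: integral_ge0.
    - exact: measurable_fun_fubini_tonelli_G.
    - by apply: emeasurable_funM => //; apply/measurable_EFinP; exact: measurable_indic.
  rewrite ge0_integralZr//; last by apply/measurable_EFinP; exact: measurable_indic.
  apply: lee_wpmul2r => //; rewrite integral_indic// setIT.
  by rewrite -muW; exact: lexx.
move: key; rewrite -dot_EFin// /E energy_fin//.
set e := \sum_(i < d) _; rewrite -!EFinM -EFinD !lee_fin.
have e0 : 0 <= e by rewrite -lee_fin -energy_fin.
set U2 := dot mu Q u u; set D := 2 ^+ d * d%:R * l ^+ 2.
have -> : 2 ^+ d * l ^+ d * (d%:R * l ^+ 2 * e) = l ^+ d * (D * e) by rewrite /D; ring.
have De : 0 <= D * e by rewrite /D !mulr_ge0// ?exprn_ge0// ltW.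
move=> h; rewrite -(ler_pM2l ld) mulrDr mulVKf ?gt_eqF//.
have := mulr_ge0 (ltW ld) De; nra.
Qed.

End cells.

Section grid.
Context (R : realType) (d : nat).
Notation mu := (lebesgue_rV R d).
Notation rV := ('rV[R]_d).

Lemma cell_disjoint (M l : R) n (z z' : {ffun 'I_d -> 'I_n}) x : 0 < l ->
  cell (\row_i (- M + (z i)%:R * l)) l x -> cell (\row_i (- M + (z' i)%:R * l)) l x ->
  z = z'.
Proof.
move=> l0 zx z'x; apply/ffunP => i; apply/val_inj/eqP.
have := z'x i; have := zx i; rewrite !mxE => /andP[h1 h2] /andP[h3 h4].
have lt (p q : nat) : - M + p%:R * l <= x ord0 i -> x ord0 i < - M + q%:R * l + l -> (p <= q)%N.
  move=> hp hq; rewrite -ltnS -(ltr_nat R) -(ltr_pM2r l0) -natr1 mulrDl mul1r.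
  by have := le_lt_trans hp hq; rewrite -addrA ltrD2l.
by rewrite eqn_leq !lt.
Qed.

(** The Poincare inequality on the cells of a fine grid: its constant is of the
    order of the square of their side.  The cubes that meet D lie in A as soon as their side is less
    than the distance of K to the complement of A. *)
Lemma grid_estimate (A D K : set rV) (eps : R) : open A -> (mu A < +oo)%E ->
  measurable D -> D `<=` K -> compact K -> K `<=` A -> 0 < eps ->
  exists (N : nat) (Q : 'I_N -> set rV) (c : R),
    [/\ 0 <= c, forall i, measurable (Q i) /\ Q i `<=` A &
      forall u g, weak_pair A u g ->
      (\int[mu]_(x in D) (u x ^+ 2)%:E <=
       (\sum_(i < N) c * (\int[mu]_(x in Q i) u x) ^+ 2)%R%:E + eps%:E * energy A g)%E].
Proof.
move=> oA finA mD DK cK KA eps0; have mA := open_measurable_rV oA.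
have [e e0 Ke] := compact_margin cK oA KA.
have [M M0 KM] := bounded_centred_box (compact_bounded cK).
pose C : R := 2 ^+ d * d%:R.
have C0 : 0 <= C by rewrite mulr_ge0// exprn_ge0.
pose l := Num.min (e / 2) (Num.min 1 (eps / (C + 1))).
have C1 : 0 < C + 1 by rewrite ltr_wpDl.
have l0 : 0 < l by rewrite !lt_min ltr01 !divr_gt0.
have le : l < e by rewrite gt_min; apply/orP; left; lra.
have lC : C * l ^+ 2 <= eps.
  have l1 : l <= 1 by rewrite !ge_min lexx orbT.
  have : l <= eps / (C + 1) by rewrite !ge_min lexx !orbT.
  rewrite ler_pdivlMr// => h; nra.
pose n := (Num.truncn ((M + M) / l)).+1.
pose a (z : {ffun 'I_d -> 'I_n}) : rV := \row_i (- M + (z i)%:R * l).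
pose s := [seq z <- enum {ffun 'I_d -> 'I_n} | `[< cell (a z) l `<=` A >]].
pose Q (i : 'I_(size s)) := cell (a (tnth (in_tuple s) i)) l.
have sA z : z \in s -> cell (a z) l `<=` A by rewrite mem_filter => /andP[/asboolP].
exists (size s), Q, (l ^+ d)^-1; split.
- by rewrite invr_ge0 exprn_ge0// ltW.
- by move=> i; split; [exact: measurable_cell|apply: sA; exact: mem_tnth].
move=> u g ug; have [su sg wg] := ug.
pose U := \big[setU/set0]_(z <- s) cell (a z) l.
have mU : measurable U by apply: bigsetU_measurable => z _; exact: measurable_cell.
have UA : U `<=` A by rewrite /U -bigcup_seq; apply: bigcup_sub => z /=; exact: sA.
have DU : D `<=` U.
  move=> x Dx; have xM := (centred_boxP _ _).1 (KM _ (DK _ Dx)).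
  have xi i : (Num.truncn ((x ord0 i + M) / l) < n)%N.
    rewrite ltnS; apply: le_truncn; rewrite ler_pM2r ?invr_gt0// lerD2r.
    exact: le_trans (ler_norm _) (xM i).
  pose z := [ffun i => Ordinal (xi i)].
  have zx : cell (a z) l x.
    move=> i; rewrite !mxE ffunE /=.
    have x0 : 0 <= (x ord0 i + M) / l.
      apply: divr_ge0; last exact: ltW.
      by have := xM i; rewrite ler_norml => /andP[]; lra.
    have /andP[h1 h2] := truncn_itv x0.
    move: h1 h2; move: (Num.truncn _) => q; rewrite ler_pdivlMr// ltr_pdivrMr// -natr1 mulrDl mul1r => h1 h2.
    by apply/andP; split; lra.
  rewrite /U -bigcup_seq; exists z => //=; rewrite mem_filter mem_enum andbT.
  apply/asboolP => y zy; apply: (Ke x (DK _ Dx)); apply/ball_rVE => // i.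
  have := zy i; have := zx i; rewrite ltr_norml => /andP[? ?] /andP[? ?].
  by apply/andP; split; lra.
have us : uniq s by rewrite filter_uniq// enum_uniq.
have ts : trivIset [set` s] (fun z => cell (a z) l).
  by move=> z z' _ _ [x [zx z'x]]; exact: cell_disjoint zx z'x.
have intU (v : rV -> R) : measurable_fun A v -> (\int[mu]_(x in U) (v x ^+ 2)%:E =
    \sum_(z <- s) \int[mu]_(x in cell (a z) l) (v x ^+ 2)%:E)%E.
  move=> mv; apply: ge0_integral_bigsetU => //.
  - by move=> z; exact: measurable_cell.
  - by apply: measurable_sqr; exact: measurable_funS mv.
  - by move=> x _; rewrite lee_fin sqr_ge0.
apply: (@le_trans _ _ (\int[mu]_(x in U) (u x ^+ 2)%:E)%E).
  apply: ge0_subset_integral => //; last by move=> x _; rewrite lee_fin sqr_ge0.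
  by apply: measurable_sqr; exact: measurable_funS su.1.
rewrite intU; last exact: su.1.
apply: (@le_trans _ _ (\sum_(z <- s) (((l ^+ d)^-1 * (\int[mu]_(x in cell (a z) l) u x) ^+ 2)%:E +
   (C * l ^+ 2)%:E * energy (cell (a z) l) g))%E).
  rewrite big_seq [leRHS]big_seq; apply: lee_sum => z /sA zA.
  exact: (cell_poincare oA finA ug l0 zA).
rewrite big_split/= -sumEFin; apply: leeD.
  by rewrite (big_tnth _ _ s) le_eqVlt eqxx.
rewrite -ge0_sume_distrr; last by move=> z _; exact: energy_ge0.
apply: (@le_trans _ _ (eps%:E * \sum_(z <- s) energy (cell (a z) l) g)%E).
  by apply: lee_wpmul2r; [apply: sume_ge0 => z _; exact: energy_ge0|rewrite lee_fin].
apply: lee_wpmul2l; first by rewrite lee_fin ltW.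
rewrite exchange_big; apply: lee_sum => i _ /=; rewrite -intU; last exact: (sg i).1.
apply: ge0_subset_integral => //; first exact: measurable_sqr (sg i).1.
by move=> x _; rewrite lee_fin sqr_ge0.
Qed.

End grid.

(** * Poincare inequality on a bounded Lipschitz domain *)

(** The height of z above the graph of gam, in the coordinates given by Q. *)
Lemma lipschitz_graph (R : realType) (d : nat) (Q : 'M[R]_d) (i : 'I_d)
    (gam : 'rV[R]_d.-1 -> R) : lipschitz gam ->
  continuous (fun z : 'rV[R]_d => (z *m Q) ord0 i - gam (col' i (z *m Q))).
Proof.
move=> [M0 [_ hM]]; pose M := `|M0| + 1.
have M0M : M0 < M by rewrite (le_lt_trans (ler_norm _))// ltrDl.
have lipg x y : `|gam x - gam y| <= M * `|x - y| by exact: (hM M M0M (x, y)).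
pose q := \sum_(k < d) \sum_(j < d) `|Q k j|.
have q0 : 0 <= q by do 2! (apply: sumr_ge0 => ? _); exact: normr_ge0.
have zq (z : 'rV[R]_d) j : `|(z *m Q) ord0 j| <= q * `|z|.
  rewrite mxE; apply: le_trans (ler_norm_sum _ _ _) _.
  rewrite mulr_suml; apply: ler_sum => k _; rewrite normrM mulrC; apply: ler_pM => //.
    by rewrite (bigD1 j)//= lerDl sumr_ge0.
  exact: ((norm_rV_le z (normr_ge0 z)).1 (lexx _) k).
pose phi (z : 'rV[R]_d) := (z *m Q) ord0 i - gam (col' i (z *m Q)).
have lip z w : `|phi z - phi w| <= (q + M * q) * `|z - w|.
  rewrite (_ : phi z - phi w = (z *m Q - w *m Q) ord0 i -
     (gam (col' i (z *m Q)) - gam (col' i (w *m Q)))); last by rewrite /phi !mxE; ring.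
  apply: le_trans (ler_normB _ _) _; rewrite -mulmxBl mulrDl -mulrA; apply: lerD; first exact: zq.
  apply: le_trans (lipg _ _) _; apply: ler_wpM2l; first by rewrite addr_ge0.
  apply/norm_rV_le; first by rewrite mulr_ge0.
  move=> j; have := zq (z - w) (lift i j); rewrite mulmxBl !mxE.
  exact.
have L0 : 0 < q + M * q + 1 by rewrite ltr_wpDl// addr_ge0// mulr_ge0// addr_ge0.
move=> z; apply/(@cvgrPdist_lt _ _ _ _ (nbhs_filter z)) => e e0.
have d0 : 0 < e / (q + M * q + 1) by rewrite divr_gt0.
apply/nbhs_ballP; exists (e / (q + M * q + 1)) => //= w /(ball_rVE _ _ d0) zw.
apply: le_lt_trans (lip z w) _.
have : `|z - w| <= e / (q + M * q + 1).
  by apply/norm_rV_le; [exact: ltW|move=> j; rewrite !mxE ltW].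
have L1 : 0 <= q + M * q by rewrite addr_ge0// mulr_ge0// addr_ge0.
move=> /(ler_wpM2l L1) /le_lt_trans; apply.
by rewrite mulrA ltr_pdivrMr// mulrC [ltRHS]mulrDr mulr1 ltrDl.
Qed.

Section poincare.
Context (R : realType) (d : nat).
Notation mu := (lebesgue_rV R d).
Notation rV := ('rV[R]_d).
Variables (A B0 : set rV).
Hypotheses (oA : open A) (bA : bounded_set A) (mB0 : measurable B0) (B0A : B0 `<=` A).

Let mA : measurable A. Proof. exact: open_measurable_rV. Qed.
Let finA : (mu A < +oo)%E. Proof. exact: bounded_measure_finite. Qed.

Local Notation sq S u := (\int[mu]_(x in S) (u x ^+ 2)%:E)%E.

(** The larger set T spares all measurability conditions on S. *)
Definition controlled (S : set rV) := exists (T : set rV) (C : R),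
  [/\ measurable T, S `<=` T, T `<=` A, 0 <= C &
    forall u g, weak_pair A u g -> (sq T u <= C%:E * (sq B0 u + energy A g))%E].

Lemma controlledS S T : S `<=` T -> controlled T -> controlled S.
Proof. by move=> ST [U [C [mU TU UA C0 h]]]; exists U, C; split=> // x /ST/TU. Qed.

Lemma controlled0 : controlled set0.
Proof.
exists set0, 0; split=> // u g _; rewrite integral_set0 mul0e//.
Qed.

Lemma controlledU S T : controlled S -> controlled T -> controlled (S `|` T).
Proof.
move=> [S' [C [mS SS S'A C0 hS]]] [T' [C' [mT TT T'A C'0 hT]]].
exists (S' `|` T'), (C + C'); split=> //.
- exact: measurableU.
- exact: setUSS.
- by move=> x [/S'A|/T'A].
- exact: addr_ge0.
move=> u g ug; have [[mu_ _] _ _] := ug.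
rewrite EFinD ge0_muleDl//.
apply: le_trans (leeD (hS u g ug) (hT u g ug)).
have -> : S' `|` T' = S' `|` (T' `\` S') 
  by apply/seteqP; split=> x; have [] := pselect (S' x); rewrite /setU/setD/=; tauto.
rewrite ge0_integral_setU//.
- apply: leeD => //; apply: ge0_subset_integral => //; first exact: measurableD.
  + by apply: measurable_sqr; apply: measurable_funS mu_.
  + by move=> x _; rewrite lee_fin sqr_ge0.
- exact: measurableD.
- apply: measurable_sqr; apply: measurable_funS mu_ => //.
  by move=> x [/S'A//|[/T'A]].
- by move=> x _; rewrite lee_fin sqr_ge0.
- by apply/disj_set2P; rewrite setDIK.
Qed.

Lemma controlledB0 : controlled B0.
Proof.
exists B0, 1; split=> // u g _; rewrite mul1e leeDl//; exact: energy_ge0.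
Qed.

(** On S, u is its translate, controlled by the values on S', plus an increment. *)
Lemma controlled_shift (S S' : set rV) (h : rV) (C : R) : measurable S -> S `<=` A ->
  controlled S' -> (forall x, S x -> S' (x + h)) -> 0 <= C ->
  (forall u g, weak_pair A u g ->
    (\int[mu]_(x in S) ((u (x + h) - u x) ^+ 2)%:E <= C%:E * energy A g)%E) ->
  controlled S.
Proof.
move=> mS SA [T [C' [mT S'T TA C'0 hT]]] SS' C0 hS.
exists S, (2 * (C' + C)); split=> //; first by rewrite mulr_ge0// addr_ge0.
move=> u g ug; have [[mu_ _] _ _] := ug.
have SAh x : S x -> A (x + h) by move=> /SS'/S'T/TA.
have m1 : measurable_fun S u by exact: measurable_funS mu_.
have m2 : measurable_fun S (fun x => u (x + h)) by exact: (measurable_fun_shift mA mu_).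
apply: le_trans (integral_sqrB_le mu mS m1 m2) _.
rewrite EFinM -muleA; apply: lee_wpmul2l; first by rewrite lee_fin.
rewrite EFinD ge0_muleDl//; apply: leeD.
  apply: le_trans (hT u g ug); rewrite (integral_shift_sqr (w := u) mS).
    apply: ge0_subset_integral => //; first exact: measurable_shift_preimage.
    - by apply: measurable_sqr; exact: measurable_funS mu_.
    - by move=> x _; rewrite lee_fin sqr_ge0.
    - by move=> x /SS'/S'T; rewrite subrK.
  apply: measurable_funS mu_ => //.
  by move=> x /SAh; rewrite subrK.
apply: le_trans (hS u g ug) _; apply: lee_wpmul2l; first by rewrite lee_fin.
by rewrite leeDr// integral_sqr_ge0.
Qed.

Definition locally_controlled (x : rV) := exists2 r : R, 0 < r & controlled (ball x r).

(** Balls within a larger ball of A are translates of each other inside A. *)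
Lemma locally_controlled_ball x y (r : R) : 0 < r -> ball x (3 * r) `<=` A -> ball x r y ->
  locally_controlled y -> locally_controlled x.
Proof.
move=> r0 xA xy [s s0 ys].
pose t := Num.min r s; have t0 : 0 < t by rewrite lt_min r0.
have tr : t <= r by rewrite ge_min lexx.
have {}ys : controlled (ball y t).
  by apply: controlledS ys; apply: le_ball; rewrite ge_min lexx orbT.
exists t => //; have xyi := (ball_rVE _ _ r0).1 xy.
have mt := measurable_ball_rV x t.
apply: (controlled_shift (h := y - x) (C := d%:R * r ^+ 2) mt _ ys).
- by apply: subset_trans xA; apply: le_ball; lra.
- move=> z /(ball_rVE _ _ t0) xz; apply/(ball_rVE _ _ t0) => i.
  by have := xz i; rewrite !mxE (_ : y ord0 i - _ = x ord0 i - z ord0 i)//; ring.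
- by rewrite mulr_ge0// sqr_ge0.
move=> u g ug; apply: (segment_increment_le oA finA ug mt r0).
  by move=> i; rewrite !mxE distrC ltW.
move=> z k /(ball_rVE _ _ t0) xz k01; apply: subset_trans xA => w /(ball_rVE _ _ r0) zw.
apply/ball_rVE; first by rewrite mulr_gt0.
move=> i; have := zw i; have := xz i; have := xyi i; rewrite !mxE !ltr_norml.
move: (x ord0 i) (y ord0 i) (z ord0 i) (w ord0 i) => a b c e ab ac ew.
have /andP[k0 k1] := k01; apply/andP; split; nra.
Qed.

(** The points with a controlled neighbourhood form an open and closed subset. *)
Lemma connected_locally_controlled y0 : connected A -> A y0 -> locally_controlled y0 ->
  forall x, A x -> locally_controlled x.
Proof.
move=> cA Ay0 ly0.
have openball x : A x -> exists2 r : R, 0 < r & ball x (3 * r) `<=` A.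
  move=> Ax; have /nbhs_ballP[r /= r0 h] : nbhs x A by apply: open_nbhs_nbhs.
  by exists (r / 3); [rewrite divr_gt0|rewrite mulrC divfK].
pose W := [set x | A x /\ locally_controlled x].
suff : W = A by move=> WA x; rewrite -{1}WA => -[].
apply: cA.
- by exists y0.
- exists W; last by apply/seteqP; split=> x [? ?].
  rewrite openE => x [Ax lx]; have [r r0 rA] := openball x Ax.
  apply/nbhs_ballP; exists (r / 2) => /=; first by rewrite divr_gt0.
  move=> y xy; split; first by apply: rA; apply: le_ball xy; lra.
  apply: (@locally_controlled_ball y x (r / 2)) lx; first by rewrite divr_gt0.
    apply: subset_trans rA => z yz; apply: le_ball (ball_triangle xy yz); lra.
  exact: ball_sym.
exists (closure W); first exact: closed_closure.
apply/seteqP; split=> x; first by move=> [Ax lx]; split=> //; apply: subset_closure.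
move=> [Ax clx]; split=> //; have [r r0 rA] := openball x Ax.
have [y [[Ay ly] xy]] := clx _ (nbhsx_ballx x r r0).
exact: locally_controlled_ball r0 rA xy ly.
Qed.

Hypothesis lA : forall x, A x -> locally_controlled x.

Lemma compact_controlled K : compact K -> K `<=` A -> controlled K.
Proof.
move=> cK KA; apply: compact_ball_ind => //; first exact: controlled0.
- exact: controlledU.
- by move=> S T ST; exact: controlledS.
- by move=> x /KA; exact: lA.
Qed.

(** Near the boundary, moving away from the graph by a fixed amount leads into
    a compact subset of A.  The paths are not uniformly far from the boundary,
    but they are so on the part at height at least 1/n above the graph, with
    an estimate that does not depend on n. *)
Lemma boundary_controlled x : lipschitz_boundary A -> closure A x -> ~ A x ->
  exists2 r : R, 0 < r & controlled (A `&` ball x r).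
Proof.
move=> lip clx nAx.
have [r [Q [i [gam [r0 QQ lgam graph]]]]] : exists (r : R) (Q : 'M[R]_d) (i : 'I_d)
    (g : 'rV[R]_d.-1 -> R), [/\ 0 < r, Q *m Q^T = 1%:M, lipschitz g &
        forall z, ball x r z -> (A z <-> g (col' i (z *m Q)) < (z *m Q) ord0 i)].
  by apply: lip => // /interior_subset.
pose phi (z : rV) := (z *m Q) ord0 i - gam (col' i (z *m Q)).
have cphi : continuous phi by exact: lipschitz_graph.
have Aphi z : ball x r z -> A z <-> 0 < phi z by move=> /graph; rewrite subr_gt0.
(* the upward unit vector, in the original coordinates *)
pose e : rV := delta_mx ord0 i *m Q^T.
have phie (z : rV) (t : R) : phi (z + t *: e) = phi z + t.
  have -> : phi (z + t *: e) = (z *m Q + t *: delta_mx ord0 i) ord0 i -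
       gam (col' i (z *m Q + t *: delta_mx ord0 i)).
    by rewrite /phi mulmxDl -scalemxAl /e -mulmxA (mulmx1C QQ) mulmx1.
  have -> : col' i (z *m Q + t *: delta_mx ord0 i) = col' i (z *m Q).
    apply/rowP => j; rewrite !mxE eqxx/= (_ : (lift i j == i) = false) ?mulr0 ?addr0//.
    by apply/negbTE; rewrite eq_sym neq_lift.
  by rewrite /phi !mxE !eqxx mulr1; ring.
pose tau := r / 4 / (`|e| + 1).
have e1 : 0 < `|e| + 1 by rewrite ltr_wpDl.
have tau0 : 0 < tau by rewrite !divr_gt0.
have taue j : `|tau * e ord0 j| <= r / 4.
  rewrite normrM (gtr0_norm tau0) /tau -(mulrA (r / 4)) ler_piMr ?divr_ge0 ?(ltW r0)//.
  rewrite ler_pdivrMl// mulr1; apply: le_trans (_ : `|e| <= _); last by rewrite lerDl.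
  exact: ((norm_rV_le e (normr_ge0 e)).1 (lexx _) j).
pose r3 := 3 * r / 4.
(* the points near x at height at least c: a compact subset of A when 0 < c *)
pose K c := cbox (x - const_mx r3) (x + const_mx r3) `&` [set z | c <= phi z].
have KA c : 0 < c -> K c `<=` A.
  move=> c0 z [zK cz]; apply/Aphi; last exact: lt_le_trans cz.
  apply/ball_rVE => // j; have := zK j; rewrite /r3 !mxE ltr_norml => /andP[? ?].
  by apply/andP; split; lra.
have cK c : compact (K c).
  apply: (subclosed_compact _ (@compact_cbox R d (x - const_mx r3) (x + const_mx r3))); last first.
    exact: subIsetl.
  apply: closedI.
    by apply: compact_closed; [exact: norm_hausdorff|exact: compact_cbox].
  have -> : [set z | c <= phi z] = phi @^-1` [set y | c <= y] by [].
  by apply: closed_comp => //; exact: closed_ge.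
pose S := A `&` ball x (r / 2).
have r20 : 0 < r / 2 by rewrite divr_gt0.
exists (r / 2) => //; rewrite -/S.
have oS : open S by apply: openI => //; exact: ball_open.
have mS : measurable S by exact: open_measurable_rV.
have SA : S `<=` A by move=> z [].
have phiS z : S z -> 0 < phi z.
  by move=> [Az xz]; apply/Aphi => //; apply: le_ball xz; lra.
have move_in (z : rV) (t c : R) : ball x (r / 2) z -> 0 <= t <= 1 -> c <= phi z + t * tau ->
    K c (z + t *: (tau *: e)).
  move=> /(ball_rVE _ _ r20) xz /andP[t0 t1] cz; split; last by rewrite /= scalerA phie.
  move=> j; have := xz j; have := taue j; rewrite /r3 !mxE ltr_norml ler_norml.
  move: (tau * _) (x ord0 j) (z ord0 j) => a b y /andP[a1 a2] /andP[h1 h2].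
  by apply/andP; split; nra.
apply: (controlled_shift (h := tau *: e) (C := d%:R * (r / 4) ^+ 2) mS SA
  (compact_controlled (@cK tau) (KA _ tau0))).
- move=> z Sz; have := move_in z 1 tau Sz.2; rewrite scale1r; apply; first by rewrite ler01 lexx.
  by rewrite mul1r lerDr ltW// phiS.
- by rewrite mulr_ge0// sqr_ge0.
move=> u g ug; have [[mu_ _] _ _] := ug.
(* the part of S at height more than 1/(n+1), on which the paths stay in a compact set *)
pose Sn n := S `&` [set z | n.+1%:R^-1 < phi z].
have SnE : S = \bigcup_n Sn n.
  apply/seteqP; split=> z; last by move=> [n _ []].
  move=> Sz; have /phiS p0 := Sz.
  have [n _ /(_ n (leqnn n)) hn] := near_infty_natSinv_lt (PosNum p0).
  by exists n => //; split.
have mSn n : measurable (Sn n).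
  apply: open_measurable_rV; apply: openI => //.
  have -> : [set z | n.+1%:R^-1 < phi z] = phi @^-1` [set y | n.+1%:R^-1 < y] by [].
  by apply: open_comp => [z _|]; [exact: cphi|exact: open_gt].
pose w z := ((u (z + tau *: e) - u z) ^+ 2)%:E.
have mw n : measurable_fun (Sn n) w.
  apply: measurable_sqr; apply: measurable_funB.
    apply: (measurable_fun_shift mA mu_) => z [Sz _].
    have := move_in z 1 tau Sz.2; rewrite scale1r => H; apply: (KA _ tau0); apply: H.
      by rewrite ler01 lexx.
    by rewrite mul1r lerDr ltW// phiS.
  by apply: measurable_funS mu_ => // z [/SA].
have lim : (\int[mu]_(z in Sn n) w z)%E @[n --> \oo] --> (\int[mu]_(z in S) w z)%E.
  rewrite SnE; apply: ge0_nondecreasing_set_cvg_integral => //.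
    apply/nondecreasing_seqP => n; apply/subsetPset => z [Sz nz]; split => //=.
    by apply: le_lt_trans nz; rewrite lef_pV2 ?posrE// ler_nat.
  by move=> n z _; rewrite lee_fin sqr_ge0.
apply: (cvge_to_le lim); apply: nearW => n; have c0 : 0 < n.+1%:R^-1 :> R by rewrite invr_gt0.
have [eps eps0 Keps] := compact_margin (@cK n.+1%:R^-1) oA (KA _ c0).
apply: (segment_increment_le oA finA ug (mSn n) eps0).
  by move=> j; rewrite mxE; exact: taue.
move=> z t [Sz nz] t01; apply: Keps; apply: move_in => //; first exact: Sz.2.
apply: le_trans (ltW nz) _; rewrite lerDl mulr_ge0 ?(ltW tau0)//.
by case/andP: t01.
Qed.

Lemma all_controlled : lipschitz_boundary A -> controlled A.
Proof.
move=> lip.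
have cK : compact (closure A).
  apply: bounded_closed_compact; last exact: closed_closure.
  have [M M0 AM] := bounded_centred_box bA.
  have cM := @compact_cbox R d (const_mx (- M)) (const_mx M).
  apply: sub_boundedr (compact_bounded cM) => P h x clx; apply: h.
  suff : closure (centred_box M) x.
    rewrite -(closure_id _).1//.
    by apply: compact_closed => //; exact: norm_hausdorff.
  exact: closure_subset clx.
suff : controlled (A `&` closure A).
  by apply: controlledS => x Ax; split=> //; exact: subset_closure.
apply: (compact_ball_ind (P := fun S => controlled (A `&` S)) cK).
- by rewrite setI0; exact: controlled0.
- by move=> S T hS hT; rewrite setIUr; exact: controlledU.
- by move=> S T ST; apply: controlledS; exact: setIS.
move=> x clx; have [Ax|nAx] := pselect (A x); last exact: boundary_controlled.
have [r r0 h] := lA Ax; exists r => //; apply: controlledS h; exact: subIsetr.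
Qed.

End poincare.

Section poincare_inequality.
Context (R : realType) (d : nat).
Notation mu := (lebesgue_rV R d).
Notation rV := ('rV[R]_d).

Lemma weak_pairBc (A : set rV) u g (c : R) : open A -> (mu A < +oo)%E ->
  weak_pair A u g -> weak_pair A (fun x => u x - c) g.
Proof.
move=> oA finA [su sg wg]; have mA := open_measurable_rV oA.
have sc k : sqint mu A (cst k) := sqint_cst mA k finA.
split=> //; first exact: (sqintB mA su (sc c)).
move=> i; have := weak_partialD oA su (sc (- c)) (sg i) (sc 0) (wg i) (cst_partial oA finA (- c) i).
by under [X in is_weak_partial A i _ X -> _]eq_fun do rewrite /= addr0.
Qed.

(** Subtract from u its mean over a small cube B0 of A.  The inequality on B0
    controls the difference on B0, hence on A because A is controlled by B0.  The
    constant that was subtracted is controlled since u has mean zero on D. *)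
Lemma poincare (A D : set rV) : open A -> bounded_set A -> connected A ->
  lipschitz_boundary A -> A !=set0 -> D `<=` A -> measurable D -> (0 < mu D)%E ->
  exists2 C : R, 0 <= C & forall u g, weak_pair A u g -> \int[mu]_(x in D) u x = 0 ->
    (\int[mu]_(x in A) (u x ^+ 2)%:E <= C%:E * energy A g)%E.
Proof.
move=> oA bA conA lipA [y0 Ay0] DA mD D0.
have mA := open_measurable_rV oA; have finA := bounded_measure_finite mA bA.
have /nbhs_ballP[r /= r0 y0A] : nbhs y0 A by apply: open_nbhs_nbhs.
pose B0 := cell (y0 - const_mx (r / 2)) r.
have mB0 : measurable B0 by exact: measurable_cell.
have B0A : B0 `<=` A.
  move=> x hx; apply: y0A; apply/ball_rVE => // i; have := hx i.
  by rewrite !mxE ltr_norml => /andP[? ?]; apply/andP; split; lra.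
have r20 : 0 < r / 2 by rewrite divr_gt0.
have ly0 : locally_controlled A B0 y0.
  exists (r / 2) => //; apply: controlledS (controlledB0 mB0 B0A).
  move=> x /(ball_rVE _ _ r20) hx i; have := hx i.
  by rewrite !mxE ltr_norml => /andP[? ?]; apply/andP; split; lra.
have lA := connected_locally_controlled oA bA conA Ay0 ly0.
have [T [C1 [mT AT TA C10 hT]]] := all_controlled oA bA lA lipA.
have {T mT AT TA hT}hA : forall u g, weak_pair A u g ->
    (\int[mu]_(x in A) (u x ^+ 2)%:E <= C1%:E * (\int[mu]_(x in B0) (u x ^+ 2)%:E + energy A g))%E.
  have TAE : T = A by apply/seteqP.
  by move: hT; rewrite TAE.
pose C2 : R := 2 ^+ d * d%:R * r ^+ 2.
have C20 : 0 <= C2 by rewrite !mulr_ge0// ?exprn_ge0// ltW.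
pose C3 := C1 * (C2 + 1); have C30 : 0 <= C3 by rewrite mulr_ge0// addr_ge0.
pose mOm := fine (mu A); pose m := fine (mu D).
have mDfin : mu D \is a fin_num.
  by rewrite ge0_fin_numE// (le_lt_trans _ finA)// le_measure ?inE.
have m0 : 0 < m by rewrite fine_gt0// D0 -ge0_fin_numE.
have muD : mu D = m%:E by rewrite /m fineK.
have finD : (mu D < +oo)%E by rewrite muD ltry.
have muA : mu A = mOm%:E by rewrite /mOm fineK// ge0_fin_numE.
have mOm0 : 0 <= mOm by rewrite fine_ge0.
exists (2 * (C3 + C3 * mOm / m)); first by have := ltW m0 => ?; rewrite mulr_ge0// addr_ge0// divr_ge0// mulr_ge0.
move=> u g ug uD0; have [su sg wg] := ug.
pose c := (\int[mu]_(x in B0) u x) / r ^+ d.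
pose v x := u x - c.
have vg : weak_pair A v g by exact: weak_pairBc.
have [sv _ _] := vg.
have rd : 0 < r ^+ d by rewrite exprn_gt0.
have muB0 : mu B0 = (r ^+ d)%:E by rewrite lebesgue_cell// ltW.
have finB0 : (mu B0 < +oo)%E by rewrite muB0 ltry.
have vB0 : \int[mu]_(x in B0) v x = 0.
  rewrite RintegralB//; last 2 first.
  - by apply: (sqint_integrable mB0 finB0); exact: sqintS su.
  - exact: (sqint_integrable mB0 finB0 (sqint_cst mB0 c finB0)).
  by rewrite (Rintegral_cst_mass mB0 muB0) /c divfK ?subrr// gt_eqF.
have E0 := energy_ge0 A g.
have Efin := energy_fin mA sg; set e := \sum_(i < d) _ in Efin.
have e0 : 0 <= e by rewrite -lee_fin -Efin.
have h1 : (\int[mu]_(x in B0) (v x ^+ 2)%:E <= C2%:E * energy A g)%E.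
  apply: le_trans (cell_poincare oA finA vg r0 B0A) _.
  rewrite vB0 expr0n mulr0 add0e; apply: lee_wpmul2l; first by rewrite lee_fin.
  by apply: energy_subset => // i; have [] := sg i.
have h2 : dot mu A v v <= C3 * e.
  rewrite -lee_fin dot_EFin// EFinM -Efin; apply: le_trans (hA v g vg) _.
  rewrite /C3 EFinM -muleA; apply: lee_wpmul2l; first by rewrite lee_fin.
  by rewrite EFinD ge0_muleDl ?lee_fin// mul1e leeD2r.
have svD : sqint mu D v by exact: sqintS sv.
have h3 : c ^+ 2 * m <= C3 * e.
  have s1 := sqint_cst mD 1 finD.
  have := dot_cauchy_schwarz mD svD s1.
  have -> : dot mu D v (cst 1) = - c * m.
    transitivity (\int[mu]_(x in D) v x); first by apply: eq_Rintegral => x _; rewrite /= mulr1.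
    rewrite RintegralB//; last 2 first.
    - by apply: (sqint_integrable mD finD); exact: sqintS su.
    - exact: (sqint_integrable mD finD (sqint_cst mD c finD)).
    by rewrite uD0 (Rintegral_cst_mass mD muD) sub0r mulNr.
  have -> : dot mu D (cst 1) (cst 1) = m.
    by apply: (etrans (Rintegral_cst_mass mD muD (1 * 1))); rewrite !mul1r.
  have : dot mu D v v <= dot mu A v v.
    rewrite -lee_fin !dot_EFin//; apply: ge0_subset_integral => //.
      exact: measurable_sqr sv.1.
    by move=> x _; rewrite lee_fin sqr_ge0.
  move: h2; set x := dot mu A v v; set y := dot mu D v v => h2 yx h.
  rewrite -(ler_pM2r m0); nra.
rewrite Efin -EFinM.
apply: le_trans (integral_sqrB_le mu mA su.1 sv.1) _.
have -> : (\int[mu]_(x in A) ((v x - u x) ^+ 2)%:E = (c ^+ 2 * mOm)%:E)%E.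
  rewrite EFinM -muA -integral_cst//; apply: eq_integral => x _.
  by rewrite /v addrAC subrr add0r sqrrN.
rewrite -(dot_EFin mA sv) -EFinD -EFinM lee_fin -(mulrA 2) ler_pM2l// mulrDl; apply: lerD => //.
have -> : C3 * mOm / m * e = C3 * e * mOm / m by ring.
by rewrite ler_pdivlMr// mulrAC ler_wpM2r.
Qed.

End poincare_inequality.

(** * The Dirichlet form *)

Section sobolev_space.
Context (R : realType) (d : nat).
Notation mu := (lebesgue_rV R d).
Notation rV := ('rV[R]_d).
Local Notation e_ i := (delta_mx ord0 i : 'rV[R]_d).
Variable A : set rV.
Hypotheses (oA : open A) (finA : (mu A < +oo)%E).

Let mA : measurable A. Proof. exact: open_measurable_rV. Qed.

Lemma weak_pairD u v gu gv : weak_pair A u gu -> weak_pair A v gv ->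
  weak_pair A (fun x => u x + v x) (fun i x => gu i x + gv i x).
Proof.
move=> [su sgu wu] [sv sgv wv]; split=> [|i|i]; [exact: sqintD|exact: sqintD|].
exact: weak_partialD.
Qed.

Lemma weak_pairZ (k : R) u gu : weak_pair A u gu ->
  weak_pair A (fun x => k * u x) (fun i x => k * gu i x).
Proof.
move=> [su sgu wu]; split=> [|i|i]; [exact: sqintZ|exact: sqintZ|].
exact: weak_partialZ.
Qed.

Lemma weak_pairB u v gu gv : weak_pair A u gu -> weak_pair A v gv ->
  weak_pair A (fun x => u x - v x) (fun i x => gu i x - gv i x).
Proof.
move=> ug vg; have := weak_pairD ug (weak_pairZ (-1) vg).
rewrite (_ : (fun x => _ + _) = fun x => u x - v x); last first.
  by apply/funext => x; rewrite mulN1r.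
rewrite (_ : (fun i x => _ + _) = fun i x => gu i x - gv i x)//.
by apply/funext => i; apply/funext => x; rewrite mulN1r.
Qed.

Lemma weak_pair_cst (c : R) : weak_pair A (fun=> c) (fun _ => cst 0).
Proof.
split=> [|i|i]; [exact: sqint_cst|exact: sqint_cst|exact: cst_partial].
Qed.

Lemma weak_pair_test f : test_function A f -> weak_pair A f (fun i => 'D_(e_ i) f).
Proof.
move=> tf; split=> [|i|i].
- exact: test_function_sqint.
- by have [_ /(_ i)[_ tdf]] := test_functionP tf; exact: test_function_sqint.
- exact: test_function_partial.
Qed.

Lemma H1_weak_pair u g : weak_pair A u g -> H1 A u.
Proof. by move=> [su sg wg]; split=> // i; exists (g i); [exact: sg|exact: wg]. Qed.

Lemma weak_pair_weak_partial u : H1 A u -> weak_pair A u (fun i => weak_partial A i u).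
Proof.
move=> [su hu]; split=> // i; have [g sg wg] := hu i.
  by rewrite /weak_partial; case: xgetP => [h _ []//|]; move=> /(_ g); case.
by rewrite /weak_partial; case: xgetP => [h _ []//|]; move=> /(_ g); case.
Qed.

Lemma subspace_H1 : subspace (H1 A : set (rV -> R)).
Proof.
split; first exact: H1_weak_pair (weak_pair_cst 0).
- move=> u v /weak_pair_weak_partial ug /weak_pair_weak_partial vg.
  exact: H1_weak_pair (weak_pairD ug vg).
- by move=> k u /weak_pair_weak_partial ug; exact: H1_weak_pair (weak_pairZ k ug).
Qed.

Definition dirichlet (u v : rV -> R) : R :=
  \int[mu]_(x in A) dotrV (weak_grad A u x) (weak_grad A v x).

Lemma weak_pair_ae u g h i : weak_pair A u g -> weak_pair A u h ->
  {ae mu, forall x, A x -> g i x = h i x}.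
Proof. by move=> [_ sg wg] [_ sh wh]; exact: weak_partial_unique (wg i) (wh i). Qed.

Lemma dot_ae u v u' v' : sqint mu A u -> sqint mu A v -> sqint mu A u' -> sqint mu A v' ->
  {ae mu, forall x, A x -> u x = u' x} -> {ae mu, forall x, A x -> v x = v' x} ->
  dot mu A u v = dot mu A u' v'.
Proof.
move=> [mu_ _] [mv _] [mu' _] [mv' _] uu vv; rewrite /dot /Rintegral; congr fine.
apply: ae_eq_integral => //.
- by apply/measurable_EFinP; exact: measurable_funM.
- by apply/measurable_EFinP; exact: measurable_funM.
by apply: filterS2 uu vv => x hu hv Ax; rewrite hu// hv.
Qed.

(** Weak partial derivatives are unique up to null sets, so that the form can be
    computed with any choice of them. *)
Lemma dirichletE u v gu gv : weak_pair A u gu -> weak_pair A v gv ->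
  dirichlet u v = \sum_(i < d) dot mu A (gu i) (gv i).
Proof.
move=> ug vg.
have [hu hv] := (H1_weak_pair ug, H1_weak_pair vg).
have := weak_pair_weak_partial hv; have := weak_pair_weak_partial hu.
set pu := fun i => weak_partial A i u; set pv := fun i => weak_partial A i v => up vp.
have [[_ su _] [_ sv _]] := (ug, vg); have [[_ spu _] [_ spv _]] := (up, vp).
transitivity (\sum_(i < d) dot mu A (pu i) (pv i)); last first.
  apply: eq_bigr => i _.
  exact: (dot_ae (spu i) (spv i) (su i) (sv i) (weak_pair_ae i up ug) (weak_pair_ae i vp vg)).
rewrite /dirichlet /Rintegral.
have i1 i : mu.-integrable A (fun x => (pu i x * pv i x)%:E) by exact: sqintM.
under eq_integral => x _.
  rewrite /dotrV -sumEFin; under eq_bigr do rewrite !mxE.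
  over.
rewrite integral_sum//=.
have E i : (\int[mu]_(x in A) (pu i x * pv i x)%:E = (dot mu A (pu i) (pv i))%:E)%E.
  by rewrite /dot /Rintegral fineK//; exact: (integrable_fin_num mA (i1 i)).
by under eq_bigr do rewrite E; rewrite sumEFin.
Qed.

Lemma dirichlet_energy u g : weak_pair A u g -> (dirichlet u u)%:E = energy A g.
Proof. by move=> ug; rewrite (dirichletE ug ug) energy_fin//; case: ug. Qed.

Lemma dirichlet_psd : psd_form (H1 A : set (rV -> R)) dirichlet.
Proof.
have [dS dD dZ d0] := dot_psd mu mA.
split=> [u v|u v w|k u v|u].
- move=> /weak_pair_weak_partial ug /weak_pair_weak_partial vg.
  rewrite (dirichletE ug vg) (dirichletE vg ug).
  by apply: eq_bigr => i _; exact: dotC.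
- move=> /weak_pair_weak_partial ug /weak_pair_weak_partial vg /weak_pair_weak_partial wg.
  rewrite (dirichletE ug wg) (dirichletE vg wg) (dirichletE (weak_pairD ug vg) wg) -big_split.
  have [[[_ su _] [_ sv _]] [_ sw _]] := (ug, vg, wg).
  by apply: eq_bigr => i _; apply: dD; [exact: su|exact: sv|exact: sw].
- move=> /weak_pair_weak_partial ug /weak_pair_weak_partial vg.
  rewrite (dirichletE ug vg) (dirichletE (weak_pairZ k ug) vg) mulr_sumr.
  have [[_ su _] [_ sv _]] := (ug, vg).
  by apply: eq_bigr => i _; apply: dZ; [exact: su|exact: sv].
move=> /weak_pair_weak_partial ug; rewrite (dirichletE ug ug).
by apply: sumr_ge0 => i _; have [_ su _] := ug; apply: d0; exact: su.
Qed.

End sobolev_space.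

(** * Bumps with disjoint supports *)

Section bumps.
Context (R : realType) (d : nat).
Notation mu := (lebesgue_rV R d).
Notation rV := ('rV[R]_d).

Lemma lebesgue_obox_gt0 (a b : rV) : (forall i, a ord0 i < b ord0 i) -> (0 < mu (obox a b))%E.
Proof.
move=> ab; rewrite lebesgue_obox; last by move=> i; exact: ltW.
by rewrite lte_fin; apply: prodr_gt0 => i _; rewrite subr_gt0.
Qed.

Lemma open_lebesgue_gt0 (D : set rV) : open D -> D !=set0 -> (0 < mu D)%E.
Proof.
move=> oD [x Dx]; have /nbhs_ballP[r /= r0 xD] : nbhs x D by apply: open_nbhs_nbhs.
apply: (@lt_le_trans _ _ (mu (ball x r))).
  by rewrite ball_obox//; apply: lebesgue_obox_gt0 => i; rewrite !mxE; lra.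
by apply: le_measure => //; rewrite inE; [exact: measurable_ball_rV|exact: open_measurable_rV].
Qed.

Lemma dot_gt0 (D S : set rV) u : measurable D -> measurable S -> S `<=` D -> (0 < mu S)%E ->
  sqint mu D u -> (forall x, S x -> u x != 0) -> 0 < dot mu D u u.
Proof.
move=> mD mS SD S0 su u0; have [_ _ _ /(_ u su) ] := dot_psd mu mD.
rewrite le_eqVlt => /predU1P[e|//]; exfalso.
have : ae_eq mu D (fun x => (u x ^+ 2)%:E) (cst 0%E).
  apply/(ae_eq_integral_abs mu mD); first exact: measurable_sqr su.1.
  rewrite [RHS](_ : _ = (dot mu D u u)%:E); last by rewrite -e.
  rewrite dot_EFin//; apply: eq_integral => x _.
  by rewrite gee0_abs// lee_fin sqr_ge0.
move=> [N [mN N0 hN]].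
have SN : S `<=` N.
  move=> x Sx; apply: hN => /= /(_ (SD x Sx)) /eqP.
  by rewrite eqe sqrf_eq0; apply/negP/u0.
have : (mu S <= mu N)%E by apply: le_measure; rewrite ?inE.
by rewrite N0 leNgt S0.
Qed.

(** Slice a small cube across one axis; each slice carries a bump. *)
Lemma disjoint_bumps n (D : set rV) : (0 < d)%N -> open D -> (mu D < +oo)%E -> D !=set0 ->
  exists w : 'I_n -> rV -> R,
    [/\ forall j, test_function D (w j), forall j, 0 < dot mu D (w j) (w j) &
        forall j k, j != k -> dot mu D (w j) (w k) = 0].
Proof.
move=> d0 oD finD [x0 Dx0].
have /nbhs_ballP[r /= r0 xD] : nbhs x0 D by apply: open_nbhs_nbhs.
pose i0 : 'I_d := Ordinal d0; pose h : R := r / n%:R.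
pose a (j : 'I_n) : rV := \row_i (x0 ord0 i - r / 2 + if i == i0 then j%:R * h else 0).
pose b (j : 'I_n) : rV := \row_i (x0 ord0 i - r / 2 + if i == i0 then j.+1%:R * h else r).
have n0 (j : 'I_n) : 0 < n%:R :> R by rewrite ltr0n; exact: leq_ltn_trans (ltn_ord j).
have h0 (j : 'I_n) : 0 < h by rewrite divr_gt0// (n0 j).
have jh (j : 'I_n) : j.+1%:R * h <= r.
  by rewrite /h mulrCA ler_piMr ?(ltW r0)// ler_pdivrMr ?(n0 j)// mul1r ler_nat.
have ab (j : 'I_n) i : a j ord0 i < b j ord0 i.
  rewrite !mxE ltrD2l; case: ifP => _ //.
  by rewrite ltr_pM2r ?(h0 j)// ltr_nat.
have abD (j : 'I_n) : cbox (a j) (b j) `<=` D.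
  move=> y hy; apply: xD; apply/ball_rVE => // i; have := hy i; rewrite !mxE.
  have := jh j; have : 0 <= j%:R * h by rewrite mulr_ge0// ltW// (h0 j).
  move: (j%:R * h) (j.+1%:R * h) => p q ? ? {n0 h0}; rewrite ltr_norml; case: ifP => _ /andP[? ?]; apply/andP; split; lra.
pose w j := box_bump 0 (a j) (b j).
have tw j : test_function D (w j) by exact: test_box_bump.
have mD := open_measurable_rV oD.
exists w; split=> // j.
  apply: (@dot_gt0 _ (obox (a j) (b j))) => //.
  - exact: measurable_obox.
  - by move=> x /obox_sub_cbox/abD.
  - exact: lebesgue_obox_gt0.
  - exact: test_function_sqint.
  - by move=> x hx; rewrite gt_eqF// box_bump_gt0.
have lt_disj (p q : 'I_n) x : (p < q)%N -> obox (a p) (b p) x -> obox (a q) (b q) x -> False.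
  move=> pq /(_ i0) /andP[_ h1] /(_ i0) /andP[h2 _]; move: h1 h2; rewrite !mxE eqxx.
  move=> h1 h2; have : p.+1%:R * h <= q%:R * h by rewrite ler_pM2r ?(h0 p)// ler_nat.
  by move: (p.+1%:R * h) (q%:R * h) h1 h2 => s t {n0 h0}; lra.
move=> k jk; rewrite /dot; under eq_Rintegral => x _.
  rewrite (_ : w j x * w k x = 0); first by over.
  have [hj|/box_bump_out hj] := pselect (obox (a j) (b j) x); last by rewrite /w hj mul0r.
  have [hk|/box_bump_out hk] := pselect (obox (a k) (b k) x); last by rewrite /w hk mulr0.
  exfalso; case: (ltngtP j k) => [jk'|kj|/val_inj jkE].
  - exact: lt_disj jk' hj hk.
  - exact: lt_disj kj hk hj.
  - by rewrite jkE eqxx in jk.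
by rewrite Rintegral_cst// mul0r.
Qed.

End bumps.

(** * The spectral problem on functions with mean zero *)

Section mean_zero_space.
Context (R : realType) (d : nat).
Notation mu := (lebesgue_rV R d).
Notation rV := ('rV[R]_d).
Variables A D : set rV.
Hypotheses (oA : open A) (finA : (mu A < +oo)%E) (oD : open D) (DA : D `<=` A) (D0 : D !=set0).

Let mA : measurable A. Proof. exact: open_measurable_rV. Qed.
Let mD : measurable D. Proof. exact: open_measurable_rV. Qed.
Let finD : (mu D < +oo)%E.
Proof. by apply: le_lt_trans finA; apply: le_measure; rewrite ?inE. Qed.

Definition mean_zero : set (rV -> R) := [set u | H1 A u /\ \int[mu]_(x in D) u x = 0].

Lemma H1_sqint u : H1 A u -> sqint mu D u.
Proof. by move=> [su _]; exact: sqintS su. Qed.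

Lemma Rintegral_dot1 u : \int[mu]_(x in D) u x = dot mu D u (cst 1).
Proof. by apply: eq_Rintegral => x _; rewrite /= mulr1. Qed.

Lemma subspace_mean_zero : subspace mean_zero.
Proof.
have [H0 HD HZ] := subspace_H1 oA finA; have [_ bD bZ _] := dot_psd mu mD.
have s1 := sqint_cst mD 1 finD.
split; first by split=> //; rewrite Rintegral_cst// mul0r.
- move=> u v [Hu u0] [Hv v0]; split; first exact: HD.
  move: u0 v0; rewrite !Rintegral_dot1 => u0 v0.
  apply: (etrans (bD u v _ (H1_sqint Hu) (H1_sqint Hv) s1)).
  by rewrite u0 v0 addr0.
- move=> k u [Hu u0]; split; first exact: HZ.
  move: u0; rewrite !Rintegral_dot1 => u0.
  by apply: (etrans (bZ k u _ (H1_sqint Hu) s1)); rewrite u0 mulr0.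
Qed.

Lemma mean_zero_dirichlet_psd : psd_form mean_zero (dirichlet A).
Proof. by apply: psd_form_sub (dirichlet_psd oA finA) => u []. Qed.

Lemma mean_zero_dot_psd : psd_form mean_zero (dot mu D).
Proof. by apply: psd_form_sub (dot_psd mu mD) => u [Hu _]; exact: H1_sqint. Qed.

Variables (C : R) (C0 : 0 <= C).
Hypothesis poincareA : forall u g, weak_pair A u g -> \int[mu]_(x in D) u x = 0 ->
  (\int[mu]_(x in A) (u x ^+ 2)%:E <= C%:E * energy A g)%E.

Lemma mean_zero_poincare u : mean_zero u -> dot mu A u u <= C * dirichlet A u u.
Proof.
move=> [Hu u0]; have ug := weak_pair_weak_partial Hu.
rewrite -lee_fin EFinM (dirichlet_energy oA finA ug) dot_EFin//; last by case: ug.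
exact: poincareA.
Qed.

Lemma dot_subset_le u : sqint mu A u -> dot mu D u u <= dot mu A u u.
Proof.
move=> su; rewrite -lee_fin !dot_EFin//; last exact: sqintS su.
apply: ge0_subset_integral => //; first exact: measurable_sqr su.1.
by move=> x _; rewrite lee_fin sqr_ge0.
Qed.

Lemma mean_zero_bounded u : mean_zero u -> dot mu D u u <= C * dirichlet A u u.
Proof.
move=> Vu; apply: le_trans (mean_zero_poincare Vu); apply: dot_subset_le.
by case: Vu => -[].
Qed.

(** A sequence that is Cauchy for the gradients is so in L2 by the Poincare
    inequality, and weak derivatives pass to L2 limits. *)
Lemma mean_zero_complete : geom_complete mean_zero (dirichlet A).
Proof.
move=> u K Vu uK.
have sV := subspace_mean_zero; have fa := mean_zero_dirichlet_psd.
have [_ _ _ a0] := dot_psd mu mA.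
pose g n := fun i => weak_partial A i (u n).
have ug n : weak_pair A (u n) (g n) by apply: weak_pair_weak_partial; case: (Vu n).
have su n : sqint mu A (u n) by case: (ug n).
have sg n i : sqint mu A (g n i) by case: (ug n).
have gK i n m : (n <= m)%N ->
    dot mu A (fun x => g n i x - g m i x) (fun x => g n i x - g m i x) <= K * 4^-1 ^+ n.
  move=> nm; apply: le_trans (uK n m nm).
  have ugnm := weak_pairB oA (ug n) (ug m).
  rewrite [leRHS](dirichletE oA finA ugnm ugnm) (bigD1 i)//= lerDl.
  by apply: sumr_ge0 => j _; apply: a0; exact: sqintB.
have K0 : 0 <= K.
  have := uK 0%N 0%N isT; rewrite expr0 mulr1; apply: le_trans.
  by have [_ _ _ ->//] := fa; apply: subspaceB.
have uCK n m : (n <= m)%N ->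
    dot mu A (fun x => u n x - u m x) (fun x => u n x - u m x) <= C * K * 4^-1 ^+ n.
  move=> nm; have Vnm : mean_zero (u n - u m) by exact: subspaceB.
  apply: le_trans (mean_zero_poincare Vnm) _; rewrite -mulrA ler_wpM2l//; exact: uK.
have /boolp.choice[h hP] : forall i, exists h, sqint mu A h /\ forall n,
    dot mu A (fun x => g n i x - h x) (fun x => g n i x - h x) <= K * 4^-1 ^+ n.
  move=> i; have [h sh hK] := sqint_complete mA (fun n => sg n i) (gK i).
  by exists h.
have [v sv vK] := sqint_complete mA su uCK.
pose K1 := K + C * K.
have p0 n : 0 <= 4^-1 ^+ n :> R by rewrite exprn_ge0// invr_ge0.
have vh : weak_pair A v h.
  split=> // i; first by case: (hP i).
  have [shi hK] := hP i.
  apply: (@weak_partial_limit _ _ A oA i u (fun n => g n i) v (h i) K1) => //.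
  - by move=> n; case: (ug n).
  - move=> n; apply: le_trans (vK n) _; rewrite ler_wpM2r// lerDr//.
  - move=> n; apply: le_trans (hK n) _; rewrite ler_wpM2r// lerDl mulr_ge0//.
have Vv : mean_zero v.
  split; first exact: H1_weak_pair vh.
  have s1 := sqint_cst mD 1 finD.
  have svD : sqint mu D v by exact: sqintS sv.
  apply/eqP; rewrite -sqrf_eq0 eq_le sqr_ge0 andbT; apply/eqP/eqP.
  have m0 : 0 <= dot mu D (cst 1) (cst 1) by have [_ _ _ ->] := dot_psd mu mD.
  apply: (@geom_le0 _ _ (C * K * dot mu D (cst 1) (cst 1))) => n.
  have suD : sqint mu D (u n) by exact: sqintS (su n).
  have := dot_cauchy_schwarz mD (sqintB mD suD svD) s1.
  move: (dot mu D (cst 1) (cst 1)) m0 => m1 m0.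
  rewrite (dotBl mD suD svD s1) -!Rintegral_dot1 (Vu n).2 sub0r sqrrN => /le_trans; apply.
  rewrite [leRHS]mulrAC; apply: ler_wpM2r => //.
  apply: le_trans (vK n); apply: dot_subset_le; exact: sqintB.
exists v, (d%:R * K); split=> // n.
have uvn := weak_pairB oA (ug n) vh.
rewrite [leLHS](dirichletE oA finA uvn uvn) -mulrA mulr_natl -[X in _ *+ X](card_ord d) -sumr_const.
by apply: ler_sum => i _; have [_ ->] := hP i.
Qed.

(** The functionals are the integrals over the cubes of a grid; they are bounded
    for the Dirichlet form by the Poincare inequality. *)
Lemma mean_zero_compact K : bounded_set A -> compact K -> D `<=` K -> K `<=` A ->
  form_compact mean_zero (dirichlet A) (dot mu D).
Proof.
move=> bA cK DK KA e e0.
have [N [Q [c [c0 Q1 Qe]]]] := grid_estimate oA finA mD DK cK KA e0.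
have muA : mu A = (fine (mu A))%:E by rewrite fineK// ge0_fin_numE.
have finQ i : mu (Q i) = (fine (mu (Q i)))%:E.
  rewrite fineK// ge0_fin_numE//; apply: le_lt_trans finA; have [mQ QA] := Q1 i.
  by apply: le_measure; rewrite ?inE.
have ltQ i : (mu (Q i) < +oo)%E by rewrite finQ ltry.
have sQ u i : mean_zero u -> sqint mu (Q i) u.
  by move=> [[su _] _]; have [mQ QA] := Q1 i; exact: sqintS su.
exists N, (fun i u => Num.sqrt c * \int[mu]_(x in Q i) u x), (c * fine (mu A) * C).
split=> [i u v Vu Vv|i u Vu|u Vu].
- have [mQ QA] := Q1 i; rewrite -mulrBr -RintegralB//.
    exact: (sqint_integrable mQ (ltQ i) (sQ _ _ Vu)).
  exact: (sqint_integrable mQ (ltQ i) (sQ _ _ Vv)).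
- have [mQ QA] := Q1 i; rewrite exprMn sqr_sqrtr// -!mulrA ler_wpM2l//.
  have s1 := sqint_cst mQ 1 (ltQ i); have su := sQ _ i Vu.
  have := dot_cauchy_schwarz mQ su s1.
  have -> : dot mu (Q i) u (cst 1) = \int[mu]_(x in Q i) u x.
    by apply: eq_Rintegral => x _; rewrite /= mulr1.
  have -> : dot mu (Q i) (cst 1) (cst 1) = fine (mu (Q i)).
    by apply: (etrans (Rintegral_cst_mass mQ (finQ i) (1 * 1))); rewrite !mul1r.
  move=> /le_trans; apply; rewrite mulrC; apply: ler_pM => //.
  - exact: fine_ge0.
  - by have [_ _ _ ->] := dot_psd mu mQ.
  - apply: fine_le; rewrite ?ge0_fin_numE//.
    by apply: le_measure; rewrite ?inE.
  - apply: le_trans (mean_zero_poincare Vu); rewrite -lee_fin !dot_EFin//; last by case: Vu => -[].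
    apply: ge0_subset_integral => //; first by apply: measurable_sqr; case: Vu => -[[]].
    by move=> x _; rewrite lee_fin sqr_ge0.
have ug : weak_pair A u (fun i => weak_partial A i u) by apply: weak_pair_weak_partial; case: Vu.
have := Qe u _ ug; rewrite -(dirichlet_energy oA finA ug) -(dot_EFin mD); last exact: H1_sqint Vu.1.
rewrite -EFinM -EFinD lee_fin addrC; congr (_ <= _ + _).
by apply: eq_bigr => i _; rewrite exprMn sqr_sqrtr.
Qed.

Lemma test_function_sub f : test_function D f -> test_function A f.
Proof.
by move=> [cf [K [cK KD f0]]]; split=> //; exists K; split=> //; exact: subset_trans DA.
Qed.

(** Combine disjoint bumps; having mean zero is orthogonality to the constant 1,
    one more linear condition. *)
Lemma mean_zero_infinite (s : seq (rV -> R)) : (0 < d)%N -> (forall f, f \in s -> mean_zero f) ->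
  exists v, [/\ mean_zero v, forall f, f \in s -> dot mu D v f = 0 & 0 < dot mu D v v].
Proof.
move=> d0 Vs.
pose s' : seq (rV -> R) := cst 1 :: s.
have [w [tw w0 worth]] := @disjoint_bumps R d (size s').+1 D d0 oD finD D0.
have Hw j : H1 A (w j).
  have := weak_pair_test oA (test_function_sub (tw j)).
  exact: H1_weak_pair.
have [|c [cs c0]] := @orthogonal_combination R _ _ (dot mu D) s' w (subspace_sqint mu mD) (dot_psd mu mD)
  _ (fun j => H1_sqint (Hw j)) w0 worth.
  move=> f; rewrite in_cons => /predU1P[->|/Vs[Hf _]]; last exact: H1_sqint.
  exact: sqint_cst.
exists (\sum_j c j *: w j); split=> //.
  split; first exact: subspace_sum (subspace_H1 oA finA) Hw.
  by rewrite Rintegral_dot1; apply: cs; rewrite mem_head.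
by move=> f fs; apply: cs; rewrite in_cons fs orbT.
Qed.

(** Constants have no gradient, so that the equation on functions with mean
    zero is the equation on all of H^1. *)
Lemma mean_zero_eigenpair (lambda : R) phi : mean_zero phi -> 0 < dot mu D phi phi ->
  (forall v, mean_zero v -> dirichlet A phi v = lambda * dot mu D phi v) ->
  neumann_eigenpair A D lambda phi.
Proof.
move=> [Hphi phi0] phipos E; split=> //.
- move=> phi_ae; suff e : dot mu D phi phi = 0 by rewrite e ltxx in phipos.
  rewrite (_ : 0 = dot mu D (fun=> 0) (fun=> 0)); last first.
    rewrite /dot; under eq_Rintegral do rewrite mul0r.
    by rewrite Rintegral_cst// mul0r.
  have sphi := H1_sqint Hphi; have s0 := sqint0 mu D.
  have e0 : {ae mu, forall x, D x -> phi x = 0} by apply: filterS phi_ae => x h /DA.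
  exact: dot_ae.
move=> psi Hpsi; rewrite -/(dirichlet A phi psi) -/(dot mu D phi psi).
pose m := fine (mu D); have muD : mu D = m%:E by rewrite /m fineK// ge0_fin_numE.
have m0 : 0 < m by rewrite /m fine_gt0// finD andbT; exact: open_lebesgue_gt0.
pose c := (\int[mu]_(x in D) psi x) / m.
have sphi := H1_sqint Hphi; have spsi := H1_sqint Hpsi.
have sc := sqint_cst mD c finD.
have psig := weak_pair_weak_partial Hpsi; have phig := weak_pair_weak_partial Hphi.
have vg := weak_pairBc c oA finA psig.
have Vv : mean_zero (fun x => psi x - c).
  split; first exact: H1_weak_pair vg.
  rewrite RintegralB//; last 2 first.
  - exact: (sqint_integrable mD finD spsi).
  - exact: (sqint_integrable mD finD sc).
  by rewrite (Rintegral_cst_mass mD muD) /c divfK ?subrr// gt_eqF.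
have := E _ Vv; rewrite (dirichletE oA finA phig vg) -(dirichletE oA finA phig psig) => ->.
congr (_ * _); rewrite dotC (dotBl mD spsi sc sphi) dotC.
have -> : dot mu D (cst c) phi = c * \int[mu]_(x in D) phi x.
  by rewrite /dot RintegralZl//; exact: (sqint_integrable mD finD sphi).
by rewrite phi0 mulr0 subr0.
Qed.

End mean_zero_space.

Theorem theorem2p6 (R : realType) (d : nat) (Omega D : set 'rV[R]_d) :
  (2 <= d)%N ->
  bounded_set Omega ->
  lipschitz_domain Omega ->
  simply_connected Omega ->
  lipschitz_domain D ->
  closure D `<=` Omega ->
  exists (lambda : nat -> R) (phi : nat -> 'rV[R]_d -> R),
    [/\ forall k, 0 < lambda k,
        lambda k @[k --> \oo] --> +oo,
        forall k, neumann_eigenpair Omega D (lambda k) (phi k),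
        forall k, \int[lebesgue_rV R d]_(x in D) phi k x = 0 &
        forall k l, k <> l ->
          \int[lebesgue_rV R d]_(x in D) (phi k x * phi l x) = 0].
Proof.
move=> d2 bO [nO oO cO lipO] _ [D0 oD _ _] DO.
have DsO : D `<=` Omega by apply: subset_trans DO; exact: subset_closure.
have mO := open_measurable_rV oO; have mD := open_measurable_rV oD.
have finO := bounded_measure_finite mO bO.
have [C C0 hC] := poincare oO bO cO lipO nO DsO mD (open_lebesgue_gt0 oD D0).
have cK : compact (closure D).
  apply: bounded_closed_compact; last exact: closed_closure.
  by apply: sub_boundedr bO => P h x /DO; exact: h.
have [lambda [phi [l0 loo Vphi Ephi orth]]] := spectral_sequence
  (subspace_mean_zero oO finO oD DsO) (mean_zero_dirichlet_psd D oO finO)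
  (mean_zero_dot_psd oO oD DsO)
  (mean_zero_complete oO finO oD DsO C0 hC)
  (mean_zero_compact oO finO oD DsO hC bO cK (@subset_closure _ D) DO)
  (mean_zero_bounded oO finO oD DsO hC)
  (fun s => mean_zero_infinite oO finO oD DsO D0 (ltnW d2)).
exists lambda, phi; split=> // k.
- have [Vk bk] := Vphi k; exact: (mean_zero_eigenpair oO finO oD DsO D0 Vk bk (Ephi k)).
- by have [[_ ->]] := Vphi k.
Qed.
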